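(* Let $k_n\ge2$ be integers with $k_n\to\infty$ and let $\boldsymbol Z_n=(Z_{n,1},\dots,Z_{n,k_n})$, $Z_{n,i}=(X_{n,i},Y_{n,i})$ with $0<Y_{n,i}\le X_{n,i}$, be a triangular array of random vectors with $\lim_{n\to\infty}\Pr(Z_{n,1}=\cdots=Z_{n,k_n})=0$. Suppose there exist $\rho\in\mathcal C$, $\alpha_0>0$, $(\sigma_n)_n\subset(0,\infty)$ and constants $0<\alpha_-<\alpha_1<\alpha_+<\infty$, where $\alpha_1=\varpi_{\rho_0}\alpha_0$ and $\rho_0=\rho(0)$, such that $$\frac1{k_n}\sum_{i=1}^{k_n} f\Big(\frac{X_{n,i}}{\sigma_n},\frac{Y_{n,i}}{\sigma_n}\Big)\rightsquigarrow\int_{(0,\infty)^2}f\,\mathrm dH_{\rho,\alpha_0,1}\qquad\text{for all } f\in\mathcal F_2(\alpha_-,\alpha_+),$$ and there exist a sequence $0<v_n\to\infty$ and a random vector $\boldsymbol W$ in $\mathbb R^4$ such that $\boldsymbol W_n:=(\mathbb G_nf_1,\mathbb G_nf_2,\mathbb G_nf_3,\mathbb G_nf_4)^\top\rightsquigarrow\boldsymbol W$, where $f_1(x,y)=y^{-\alpha_1}\log y$, $f_2(x,y)=y^{-\alpha_1}$, $f_3(x,y)=\log y$, $f_4(x,y)=\log x$ and $$\mathbb G_nf=v_n\Big\{\frac1{k_n}\sum_{i=1}^{k_n}f\Big(\frac{X_{n,i}}{\sigma_n},\frac{Y_{n,i}}{\sigma_n}\Big)-\int_{(0,\infty)^2}f\,\mathrm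 dH_{\rho,\alpha_0,1}\Big\}.$$ Let $\hat\rho_{0,n}$ be $[0,1]$-valued random variables with $\hat\rho_{0,n}=\rho_0+o_{\mathbb P}(v_n^{-1})$, and, with $(\hat\alpha_n,\hat\sigma_n)=\hat\theta(\boldsymbol Z_n)$ the maximum likelihood estimator, put $$\hat\varpi_n=\varpi_{\hat\rho_{0,n}},\qquad \widetilde\alpha_n=\hat\alpha_n/\hat\varpi_n,\qquad \widetilde\sigma_n=\hat\sigma_n\Big(\frac{\Upsilon_{\hat\rho_{0,n}}(\hat\varpi_n)}2\Big)^{1/\hat\alpha_n}.$$ Then, as $n\to\infty$, $$v_n\begin{pmatrix}\widetilde\alpha_n-\alpha_0\\ \widetilde\sigma_n/\sigma_n-1\end{pmatrix}=M^{\mathrm{bc}}_{\rho_0}(\alpha_0)\boldsymbol W_n+o_{\mathbb P}(1)\rightsquigarrow M^{\mathrm{bc}}_{\rho_0}(\alpha_0)\boldsymbol W,$$ where $$M^{\mathrm{bc}}_{\rho_0}(\alpha_0)=\begin{pmatrix}1/\varpi_{\rho_0}&0\\ \alpha_1^{-1}\log s_1&1/s_1\end{pmatrix}M_{\rho_0}(\alpha_0)\in\mathbb R^{2\times4},\qquad s_1=\Big(\frac2{\Upsilon_{\rho_0}(\varpi_{\rho_0})}\Big)^{1/\alpha_1},$$ with $M_{\rho_0}(\alpha_0)$ the matrix given in the context. If $\rho_0=1$ (i.e., $\rho=\rho_{\mathrm{ind}}$), then $$M_1^{\mathrm{bc}}(\alpha_0)=M_1(\alpha_0)=\frac{6}{2\pi^2-3}\begin{pmatrix}\alpha_0^2&\frac{3-2\gamma}2\alpha_0&-\alpha_0^2&-\alpha_0^2\\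 \frac{2\gamma-3}2&\frac{3-2\pi^2-3(3-2\gamma)^2}{12\alpha_0}&\frac{3-2\gamma}2&\frac{3-2\gamma}2\end{pmatrix}.$$
   Context: $\rightsquigarrow$ denotes weak convergence. Fréchet–Welsch distribution: $\mathcal C$ is the set of concave, nonincreasing $\rho:[0,1]\to[0,1]$ with $0\le\rho(\eta)\le1-\eta$ for all $\eta$; $\rho_{\mathrm{ind}}(\eta):=1-\eta$. For $\rho\in\mathcal C$, $\alpha,\sigma>0$, $\mathcal W(\rho,\alpha,\sigma)$ is the distribution on $(0,\infty)^2$ with cdf $H_{\rho,\alpha,\sigma}(x,y)=\exp(-(x/\sigma)^{-\alpha})$ if $y\ge x>0$ and $\exp(-(y/\sigma)^{-\alpha})\{1+\rho((y/x)^\alpha)(y/\sigma)^{-\alpha}\}$ if $x>y>0$. Maximum likelihood estimator: for $\boldsymbol z=((x_1,y_1),\dots,(x_k,y_k))$, $k\ge2$, $0<y_i\le x_i$, let $\ell(\alpha,\sigma|\boldsymbol z)=2k\log\alpha+2k\alpha\log\sigma-\sum_{i=1}^k\{(\alpha+1)\log(x_iy_i)+\sigma^\alpha y_i^{-\alpha}\}$. If the pairs are not all equal, it has a unique maximizer $\hat\theta(\boldsymbol z)=(\hat\alpha(\boldsymbol z),\hat\sigma(\boldsymbol z))$ over $(0,\infty)^2$. On $\{Z_{n,1}=\cdots=Z_{n,k_n}\}$ set $\hat\alpha_n=\infty$, $\hat\sigma_n=Y_{n,1}$. Constants: for $\rho_0\in[0,1]$, $\Gamma$ the gamma function, $\gamma$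 the Euler–Mascheroni constant, $\Upsilon_{\rho_0}(x)=\rho_0\Gamma(x+2)+(1-\rho_0)\Gamma(x+1)$, $\Pi_{\rho_0}(y)=\frac1y-\frac{\Upsilon_{\rho_0}'(y)}{\Upsilon_{\rho_0}(y)}+\frac{\rho_0}2-\gamma$ ($y>0$), which is a continuous decreasing bijection from $(0,\infty)$ to $\mathbb R$; $\varpi_{\rho_0}\in(0,1]$ is its unique zero. Function class: $\mathcal F_2(\alpha_-,\alpha_+)$ consists of $(x,y)\mapsto\log x$, $(x,y)\mapsto\log y$, $(x,y)\mapsto(\log y)^2$, and $(x,y)\mapsto y^{-\alpha}(\log y)^m$ for all $m\in\{0,1,2\}$, $\alpha_-<\alpha<\alpha_+$. The matrix $M_{\rho_0}(\alpha_0)=(\beta_{jk})_{j\le2,k\le4}$: write $\Upsilon=\Upsilon_{\rho_0}(\varpi_{\rho_0})$, $\Upsilon'=\Upsilon_{\rho_0}'(\varpi_{\rho_0})$, $\Upsilon''=\Upsilon_{\rho_0}''(\varpi_{\rho_0})$, $z_0=\Upsilon/2$ and $\dot\Psi=-\frac2{\alpha_1^2}-2\frac{\Upsilon''\Upsilon-(\Upsilon')^2}{\alpha_0^2\Upsilon^2}$. Then $$(\beta_{11},\beta_{12},\beta_{13},\beta_{14})=\frac1{\dot\Psi}\Big(-\frac2\Upsilon,\,-\frac{2\Upsilon'}{\alpha_0\Upsilon^2},\,1,\,1\Big),$$ $$\beta_{21}=\frac{z_0^{-1/\alpha_1}}{\alpha_1\dot\Psi}\Big\{\frac{\Upsilon'}{2\alpha_0z_0^2}-\frac{\log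 z_0}{\alpha_1z_0}\Big\},\qquad \beta_{22}=\frac{z_0^{-1/\alpha_1}}{\alpha_1\dot\Psi}\Big\{\frac{(\Upsilon')^2}{4\alpha_0^2z_0^3}-\frac{\Upsilon'\log z_0}{2\alpha_0\alpha_1z_0^2}\Big\}-\frac{z_0^{-1/\alpha_1-1}}{2\alpha_1},$$ $$\beta_{23}=\beta_{24}=\frac{z_0^{-1/\alpha_1}}{\alpha_1\dot\Psi}\Big\{\frac{\log z_0}{\alpha_1}-\frac{\Upsilon'}{2\alpha_0z_0}\Big\}.$$ *)

(* Defs.v *)
From HB Require Import structures.
From mathcomp Require Import all_boot all_order all_algebra.
From mathcomp Require Import all_classical all_reals all_analysis.
From mathcomp Require Import measurable_realfun.

Set Implicit Arguments.
Unset Strict Implicit.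
Unset Printing Implicit Defensive.

Import Order.TTheory GRing.Theory Num.Theory.
Import numFieldNormedType.Exports.

Local Open Scope classical_set_scope.
Local Open Scope ring_scope.

(* The n-th element of a random sequence lives on its own probability space
   (Omega n, P n); a sequence on one common space is the constant case. *)
Section stochastic_convergence.
Context {R : realType} {d : nat -> measure_display}
  {Omega : forall n, measurableType (d n)} (P : forall n, probability (Omega n) R).

(* measurability with respect to the Borel sigma-algebra of S *)
Definition random_element d0 (T : measurableType d0) (S : topologicalType)
    (X : T -> S) : Prop :=
  forall U : set S, open U -> measurable (X @^-1` U).

(* The limit is the law under Q of Z; a constant limit c is Z = cst c. *)
Definition weak_cvg (S : topologicalType) (X : forall n, Omega n -> S)
    d0 (T : measurableType d0) (Q : probability T R) (Z : T -> S) : Prop :=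
  [/\ forall n, random_element (X n),
      random_element Z &
      forall g : S -> R, continuous g -> (exists C : R, forall s, `|g s| <= C) ->
        \int[P n]_w g (X n w) @[n --> \oo] --> \int[Q]_w g (Z w)].

(* U_n = o_P(a_n), for positive a_n; extended real U_n are allowed because the
   estimators below take the value +oo on degenerate samples. *)
Definition is_oP (a : R^nat) (U : forall n, Omega n -> \bar R) : Prop :=
  (forall n, measurable_fun setT (U n)) /\
  forall e : R, 0 < e ->
    P n [set w | ((e * a n)%:E < `|U n w|)%E] @[n --> \oo] --> 0%E.

End stochastic_convergence.

Section frechet_welsch.
Context {R : realType}.

Definition pickands_class (rho : R -> R) : Prop :=
  [/\ forall eta, eta \in `[0, 1] -> 0 <= rho eta <= 1 - eta,
      forall eta1 eta2, eta1 \in `[0, 1] -> eta2 \in `[0, 1] ->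
        eta1 <= eta2 -> rho eta2 <= rho eta1 &
      @convex_function R R^o `[0, 1]%classic (fun eta => - rho eta)].

Definition rho_ind (eta : R) : R := 1 - eta.

Definition welsch_cdf (rho : R -> R) (alpha sigma x y : R) : R :=
  if x <= y then expR (- ((x / sigma) `^ (- alpha)))
  else expR (- ((y / sigma) `^ (- alpha))) *
       (1 + rho ((y / x) `^ alpha) * (y / sigma) `^ (- alpha)).

Definition quadrant : set (R * R) := [set p | 0 < p.1 /\ 0 < p.2].

(* H is the distribution on (0,oo)^2 with the above cdf; this determines H. *)
Definition is_welsch (rho : R -> R) (alpha sigma : R)
    (H : probability (R * R)%type R) : Prop :=
  H quadrant = 1%E /\
  forall x y : R, 0 < x -> 0 < y ->
    H (`]-oo, x] `*` `]-oo, y]) = (welsch_cdf rho alpha sigma x y)%:E.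

End frechet_welsch.

Section maximum_likelihood.
Context {R : realType}.
Implicit Types z : seq (R * R).

Definition loglik z (alpha sigma : R) : R :=
  2 * (size z)%:R * ln alpha + 2 * (size z)%:R * alpha * ln sigma -
  \sum_(p <- z) ((alpha + 1) * ln (p.1 * p.2) +
                 sigma `^ alpha * p.2 `^ (- alpha)).

(* the (unique) maximizer of the likelihood, when the pairs are not all equal *)
Definition argmax_loglik z : R * R :=
  get [set th : R * R | [/\ 0 < th.1, 0 < th.2 &
    forall alpha sigma, 0 < alpha -> 0 < sigma ->
      loglik z alpha sigma <= loglik z th.1 th.2]].

Definition mle_alpha z : \bar R :=
  if constant z then +oo%E else (argmax_loglik z).1%:E.

Definition mle_sigma z : R :=
  if constant z then (head (0, 0) z).2 else (argmax_loglik z).2.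

End maximum_likelihood.

Section constants.
Context {R : realType}.

Definition Gamma (x : R) : R :=
  \int[lebesgue_measure]_(t in `]0, +oo[) (t `^ (x - 1) * expR (- t)).

Definition euler_gamma : R :=
  limn (fun n : nat => \sum_(1 <= i < n.+1) i%:R^-1 - ln n%:R).

Definition Upsilon (rho0 x : R) : R :=
  rho0 * Gamma (x + 2) + (1 - rho0) * Gamma (x + 1).

Definition Pi (rho0 y : R) : R :=
  y^-1 - derive1 (Upsilon rho0) y / Upsilon rho0 y + rho0 / 2 - euler_gamma.

Definition varpi (rho0 : R) : R := get [set y | 0 < y /\ Pi rho0 y = 0].

Definition matrix24 (r1 r2 : seq R) : 'M[R]_(2, 4) :=
  \matrix_(i < 2, j < 4) nth 0 (if i == 0 then r1 else r2) j.

Definition M_mle (rho0 alpha0 : R) : 'M[R]_(2, 4) :=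
  let U := Upsilon rho0 (varpi rho0) in
  let U' := derive1 (Upsilon rho0) (varpi rho0) in
  let U'' := derive1n 2 (Upsilon rho0) (varpi rho0) in
  let alpha1 := varpi rho0 * alpha0 in
  let z0 := U / 2 in
  let dPsi := - (2 / alpha1 ^+ 2) -
              2 * ((U'' * U - U' ^+ 2) / (alpha0 ^+ 2 * U ^+ 2)) in
  let c := z0 `^ (- alpha1^-1) / (alpha1 * dPsi) in
  let b23 := c * (ln z0 / alpha1 - U' / (2 * alpha0 * z0)) in
  matrix24
    [:: dPsi^-1 * - (2 / U);
        dPsi^-1 * - (2 * U' / (alpha0 * U ^+ 2));
        dPsi^-1;
        dPsi^-1]
    [:: c * (U' / (2 * alpha0 * z0 ^+ 2) - ln z0 / (alpha1 * z0));
        c * (U' ^+ 2 / (4 * alpha0 ^+ 2 * z0 ^+ 3) -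
             U' * ln z0 / (2 * alpha0 * alpha1 * z0 ^+ 2)) -
          z0 `^ (- alpha1^-1 - 1) / (2 * alpha1);
        b23;
        b23].

Definition M_bc (rho0 alpha0 : R) : 'M[R]_(2, 4) :=
  let alpha1 := varpi rho0 * alpha0 in
  let s1 := (2 / Upsilon rho0 (varpi rho0)) `^ (alpha1^-1) in
  (\matrix_(i < 2, j < 2)
     if i == 0 then (if j == 0 then (varpi rho0)^-1 else 0)
     else (if j == 0 then alpha1^-1 * ln s1 else s1^-1)) *m M_mle rho0 alpha0.

Definition M_ind (alpha0 : R) : 'M[R]_(2, 4) :=
  let g := euler_gamma in
  (6 / (2 * pi ^+ 2 - 3)) *:
  matrix24
    [:: alpha0 ^+ 2; (3 - 2 * g) / 2 * alpha0; - alpha0 ^+ 2; - alpha0 ^+ 2]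
    [:: (2 * g - 3) / 2;
        (3 - 2 * pi ^+ 2 - 3 * (3 - 2 * g) ^+ 2) / (12 * alpha0);
        (3 - 2 * g) / 2;
        (3 - 2 * g) / 2].

End constants.

Section estimation.
Context {R : realType}.
Implicit Types (z : seq (R * R)) (f : R * R -> R).

Definition F2 (am ap : R) : set (R * R -> R) :=
  [set f | [\/ f = (fun p => ln p.1), f = (fun p => ln p.2),
               f = (fun p => ln p.2 ^+ 2) |
               exists m alpha, [/\ (m <= 2)%N, am < alpha < ap &
                 f = (fun p => p.2 `^ (- alpha) * ln p.2 ^+ m)]]].

Definition emp_mean z (s : R) f : R :=
  (size z)%:R^-1 * \sum_(p <- z) f (p.1 / s, p.2 / s).

Definition Gn (H : probability (R * R)%type R) (v : R) z (s : R) f : R :=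
  v * (emp_mean z s f - \int[H]_(p in quadrant) f p).

Definition f1234 (alpha1 : R) (j : 'I_4) : R * R -> R :=
  nth (fun=> 0)
    [:: (fun p => p.2 `^ (- alpha1) * ln p.2);
        (fun p => p.2 `^ (- alpha1));
        (fun p => ln p.2);
        (fun p => ln p.1)] j.

Definition Wvec (H : probability (R * R)%type R) (v : R) z (s alpha1 : R) :
    'cV[R]_4 :=
  \col_j Gn H v z s (f1234 alpha1 j).

(* bias-corrected estimators, r being the estimate of rho(0); on a degenerate
   sample mle_alpha z = +oo and the exponent of bc_sigma is 1 / +oo = 0 *)
Definition bc_alpha (r : R) z : \bar R := (mle_alpha z / (varpi r)%:E)%E.

Definition bc_sigma (r : R) z : R :=
  mle_sigma z * (Upsilon r (varpi r) / 2) `^ (fine ((mle_alpha z)^-1)%E).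

Definition bc_error (alpha0 s v r : R) z : 'cV[\bar R]_2 :=
  \col_(i < 2) if i == 0 then (v%:E * (bc_alpha r z - alpha0%:E))%E
               else (v * (bc_sigma r z / s - 1))%:E.

End estimation.

Definition sample {R : realType} d (T : measurableType d) (P : probability T R)
    k (X Y : 'I_k -> {RV P >-> R}) (w : T) : k.-tuple (R * R) :=
  [tuple (X i w, Y i w) | i < k].

(* Main.v *)
Require Import Defs.
From HB Require Import structures.
From mathcomp Require Import all_boot all_order all_algebra.
From mathcomp Require Import all_classical all_reals all_analysis.
From mathcomp Require Import measurable_realfun.
From mathcomp Require Import ring lra.

(** For a rescaled sample of size k, let S_m be the mean of y^-alpha (ln y)^m and
    C the mean of ln x + ln y. Maximizing the likelihood over sigma leaves the
    equation h(alpha) = 1/alpha + S_1/S_0 - C/2 = 0. Since S_1/S_0 is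
    nonincreasing in alpha, h decreases at least as fast as 1/alpha
    ([half_score_steep]); it has a single zero alphahat unless all pairs are
    equal ([mle_spec]), and |1/alphahat - 1/alpha1| <= |h(alpha1)|
    ([recip_steep_dist]).

    Under the Frechet-Welsch law, X^-alpha0 is standard exponential and
    Y^-alpha0 is a mixture, with weights rho(0) and 1 - rho(0), of the gamma laws
    of shapes 2 and 1 ([welsch_moment1], [welsch_moment2]). The limits of the
    means are therefore values of Upsilon and its derivatives, and the limit of
    h(alpha1) is Pi(varpi) / alpha0 = 0. Hence h(alpha1) = O(1/v), and so is
    alphahat - alpha1. A mean value expansion of h makes alphahat - alpha1 linear
    in the vector W up to o(1/v); the derivative of h near alpha1 converges
    because S_2 is controlled by its values at two neighbouring exponents
    ([power_mean2_dist]). The scale follows from sigmahat^-alphahat =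
    S_0(alphahat)/2 by the delta method. As 1/varpi and Upsilon(varpi) are
    Lipschitz in rho(0), an error o(1/v) in the estimate of rho(0) is absorbed.
    The coefficients found are the rows of M_bc ([M_bc_rows]).

    All this is deterministic, and holds uniformly over the samples whose means
    are close to their limits and whose vector W is bounded ([bc_uniform]):
    along an ultrafilter W converges, and the expansion becomes a computation of
    limits. Probability enters only through the events on which a sample fails
    these conditions ([linearization_events]); they are unlikely by the law of
    large numbers and by tightness of W. The first conclusion follows at once,
    and the second by comparing expectations of bounded test functions.

    For rho(0) = 1 one has varpi = 1, and the entries of the matrix come down to
    Gamma'(1) = - gamma and Gamma''(1) = gamma^2 + pi^2/6. Both are read off the
    recurrences of the digamma and trigamma functions ([digamma1], [trigamma1]),
    with the Basel sum for the second. *)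

Set Implicit Arguments.
Unset Strict Implicit.
Unset Printing Implicit Defensive.

Import Order.TTheory GRing.Theory Num.Theory.
Import numFieldNormedType.Exports.

Local Open Scope classical_set_scope.
Local Open Scope ring_scope.


(** * Mean value inequalities *)

Section mean_value.
Context {R : realType}.
Implicit Types (f df : R -> R) (a b x y : R).

Lemma is_derive_mvt f df a b :
  (forall t, (a <= t <= b) || (b <= t <= a) -> is_derive t (1:R) f (df t)) ->
  exists c, [/\ (a <= c <= b) || (b <= c <= a), `|c - b| <= `|a - b| &
    f a - f b = df c * (a - b)].
Proof.
move=> d; have [ab|ba|<-] := ltgtP a b; last first.
- by exists a; rewrite !lexx; split => //; rewrite !subrr mulr0.
- have [||c] := @MVT R f df b a ba.
  + move=> t; rewrite in_itv/= => /andP[? ?]; apply: d.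
    by apply/orP; right; rewrite !ltW.
  + apply: derivable_within_continuous => t; rewrite in_itv/= => tab.
    by have [|//] := d t; rewrite tab orbT.
  rewrite in_itv/= => /andP[bc ca] e; exists c; split=> //.
    by apply/orP; right; rewrite !ltW.
  by rewrite !ger0_norm ?subr_ge0 ?(ltW ba) ?(ltW bc)// lerD2r ltW.
- have [||c] := @MVT R f df a b ab.
  + move=> t; rewrite in_itv/= => /andP[? ?]; apply: d.
    by apply/orP; left; rewrite !ltW.
  + apply: derivable_within_continuous => t; rewrite in_itv/= => tab.
    by have [|//] := d t; rewrite tab.
  rewrite in_itv/= => /andP[ac cb] e; exists c; split=> //.
  + by apply/orP; left; rewrite !ltW.
  + by rewrite ![`|_ - b|]distrC !ger0_norm ?subr_ge0 ?(ltW ab) ?(ltW cb)// lerB// ltW.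
  + by rewrite -opprB e; ring.
Qed.

Lemma is_derive_le f df x y : x <= y ->
  (forall t, x <= t <= y -> is_derive t (1:R) f (df t)) ->
  (forall t, x <= t <= y -> 0 <= df t) -> f x <= f y.
Proof.
move=> xy d df0; have [|c [cI _ e]] := @is_derive_mvt f df y x.
  by move=> t /orP[/andP[yt tx]|]; [apply: d; rewrite (le_trans xy yt) (le_trans tx xy)|exact: d].
rewrite -subr_ge0 e mulr_ge0 ?subr_ge0//; apply: df0.
by case/orP: cI => // /andP[yc cx]; rewrite (le_trans xy yc) (le_trans cx xy).
Qed.

End mean_value.

(** * The Basel sum *)

Section basel.
Context {R : realType}.
Implicit Types x : R.

Lemma sin_le_id x : 0 <= x -> sin x <= x.
Proof.
move=> x0; rewrite -subr_ge0.
have := @is_derive_le R (fun t => t - sin t) (fun t => 1 - cos t) 0 x x0.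
rewrite sin0 subr0; apply=> t _; last by rewrite subr_ge0 cos_le1.
Qed.

Lemma mulr_cos_le_sin x : 0 <= x <= pi / 2 -> x * cos x <= sin x.
Proof.
move=> /andP[x0 xp]; rewrite -subr_ge0.
have := @is_derive_le R (fun t => sin t - t * cos t) (fun t => t * sin t) 0 x x0.
rewrite sin0 mul0r subrr; apply=> t /andP[t0 tx].
  by apply: is_derive_eq; rewrite /GRing.scale/= !mulr1; ring.
rewrite mulr_ge0// sin_ge0_pi// t0/=.
by have := pi_gt0 R; lra.
Qed.

Definition hofbauer_node n k : R := (k.*2.+1)%:R * pi / 2 ^+ n.+2.

Lemma hofbauer_node_itv n k : (k < 2 ^ n)%N -> 0 < hofbauer_node n k < pi / 2.
Proof.
move=> kn; have pi0 := pi_gt0 R.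
have p0 : 0 < 2 ^+ n :> R by rewrite exprn_gt0.
rewrite /hofbauer_node; apply/andP; split.
  by apply: divr_gt0; [exact: mulr_gt0|rewrite exprn_gt0].
rewrite ltr_pdivrMr ?exprn_gt0// !exprS.
rewrite (_ : pi / 2 * (2 * (2 * 2 ^+ n)) = (2 ^ n.+1)%:R * pi); last first.
  by rewrite natrX exprS; move: p0; set p := 2 ^+ n => p0; field.
by rewrite ltr_pM2r// ltr_nat expnS mul2n ltn_Sdouble.
Qed.

(** Since 1/sin^2 x = (1/sin^2(x/2) + 1/cos^2(x/2)) / 4, each node x of level
    n accounts for the two nodes x/2 and pi/2 - x/2 of level n + 1. *)
Lemma hofbauer_sum n :
  \sum_(k < 2 ^ n) (sin (hofbauer_node n k) ^+ 2)^-1 = 2 * 4 ^+ n.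
Proof.
have e2 m : 2 ^+ m != 0 :> R by rewrite expf_neq0.
elim: n => [|n IH].
  rewrite big_ord1 expr0 mulr1 /hofbauer_node /=.
  rewrite (_ : 1 * pi / 2 ^+ 2 = pi / 4 :> R); last by rewrite mul1r; congr (_ / _); ring.
  have := @sin_mulr2n R (pi / 4).
  rewrite (_ : pi / 4 *+ 2 = pi / 2 :> R); last by rewrite mulr2n; field.
  have t4 := @tan_piquarter R.
  rewrite sin_pihalf.
  have c4 : cos (pi / 4 : R) != 0.
    by apply/eqP => c0; move: t4; rewrite /tan c0 invr0 mulr0 => /eqP; rewrite eq_sym oner_eq0.
  have -> : cos (pi / 4) = sin (pi / 4) :> R.
    by move: t4; rewrite /tan => /(congr1 ( *%R^~ (cos (pi/4)))); rewrite mul1r mulfVK.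
  move=> h; have -> : sin (pi / 4) ^+ 2 = 1/2 :> R by rewrite mulr2n in h; lra.
  by rewrite div1r invrK.
rewrite expnS mul2n -addnn big_split_ord /=.
rewrite [X in _ + X](reindex_inj rev_ord_inj) /= -big_split /=.
rewrite exprS mulrCA -IH mulr_sumr; apply: eq_bigr => k _.
have /andP[x0 xpi] := hofbauer_node_itv (ltn_ord k).
set x := hofbauer_node n k in x0 xpi *.
have -> : hofbauer_node n.+1 k = x / 2.
  by rewrite /x /hofbauer_node [in LHS]exprS invfM; field; rewrite e2.
have -> : hofbauer_node n.+1 (2 ^ n + (2 ^ n - k.+1)) = pi / 2 - x / 2.
  have -> : (2 ^ n + (2 ^ n - k.+1) = 2 ^ n.+1 - k.+1)%N.
    by rewrite addnBA// expnS mul2n addnn.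
  rewrite /x /hofbauer_node.
  have kn : (k < 2 ^ n.+1)%N by rewrite (leq_trans (ltn_ord k))// leq_exp2l.
  have -> : ((2 ^ n.+1 - k.+1).*2.+1 = 2 ^ n.+2 - k.*2.+1)%N.
    rewrite doubleB doubleS -subSn; last by rewrite -doubleS leq_double.
    by rewrite subSS [in RHS]expnS mul2n.
  rewrite natrB; last by rewrite expnS mul2n ltnW// ltn_Sdouble.
  rewrite natrX !exprS.
  by have := e2 n; set p := 2 ^+ n => p0; field; rewrite p0.
rewrite -[sin (_ - _)]opprK -sinN opprB sinBpihalf opprK.
have xE : x = (x / 2) *+ 2 by rewrite mulr2n; field.
have sE : sin x = 2 * (cos (x / 2) * sin (x / 2)).
  by rewrite [in LHS]xE sin_mulr2n mulr2n; ring.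
have s0 : sin (x / 2) != 0 by rewrite gt_eqF// sin_gt0_pihalf//; apply/andP; lra.
have c0 : cos (x / 2) != 0 by rewrite gt_eqF// cos_gt0_pihalf//; apply/andP; lra.
rewrite sE; have := cos2Dsin2 (x / 2).
move: s0 c0; set a := sin _; set b := cos _ => a0 b0 ab.
have -> : (a ^+ 2)^-1 + (b ^+ 2)^-1 = (b ^+ 2 + a ^+ 2) / (a ^+ 2 * b ^+ 2).
  by field; rewrite a0 b0.
by rewrite ab; field; rewrite a0 b0.
Qed.

Let odd_sum N : R := \sum_(k < N) ((k.*2.+1)%:R ^+ 2)^-1.

(** As sin x <= x <= tan x, the terms 1/sin^2 x and 1/x^2 differ by at most 1
    at each of the 2^n nodes, which is negligible against the sum 2 * 4^n. *)
Lemma odd_sum_bounds n :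
  pi ^+ 2 / 8 - pi ^+ 2 / 16 / 2 ^+ n <= odd_sum (2 ^ n) <= pi ^+ 2 / 8.
Proof.
have pi0 := pi_gt0 R.
have p0 : 0 < 2 ^+ n :> R by rewrite exprn_gt0.
have E : \sum_(k < 2 ^ n) (hofbauer_node n k ^+ 2)^-1 =
    16 * (2 ^+ n) ^+ 2 / pi ^+ 2 * odd_sum (2 ^ n).
  rewrite /odd_sum mulr_sumr; apply: eq_bigr => k _.
  rewrite /hofbauer_node !exprS expr0 !mulr1.
  have q0 : 0 < (k.*2.+1)%:R :> R by rewrite ltr0n.
  move: (p0) q0 pi0; move: (2 ^+ n) (k.*2.+1%:R) (pi : R) => p q c p1 q0 c0.
  by field; rewrite !gt_eqF.
have key k : (k < 2 ^ n)%N -> (sin (hofbauer_node n k) ^+ 2)^-1 - 1 <=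
    (hofbauer_node n k ^+ 2)^-1 <= (sin (hofbauer_node n k) ^+ 2)^-1.
  move=> /hofbauer_node_itv /andP[]; set x := hofbauer_node n k => x0 xpi.
  have s0 : 0 < sin x by rewrite sin_gt0_pihalf// x0.
  apply/andP; split; last first.
    rewrite lef_pV2 ?posrE ?exprn_gt0// ler_sqr ?nnegrE ?(ltW x0) ?(ltW s0)//.
    by apply: sin_le_id; exact: ltW.
  have c0 : 0 < cos x by rewrite cos_gt0_pihalf//; apply/andP; lra.
  have -> : (sin x ^+ 2)^-1 - 1 = (cos x / sin x) ^+ 2.
    by rewrite expr_div_n cos2sin2; field; rewrite gt_eqF.
  have h : cos x / sin x <= x^-1.
    rewrite ler_pdivrMr// mulrC ler_pdivlMr// mulrC.
    by apply: mulr_cos_le_sin; rewrite !ltW.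
  have h0 : 0 <= cos x / sin x by apply: divr_ge0; exact: ltW.
  by rewrite -exprVn ler_sqr// nnegrE (le_trans h0 h).
have up : 16 * (2 ^+ n) ^+ 2 / pi ^+ 2 * odd_sum (2 ^ n) <= 2 * 4 ^+ n.
  by rewrite -E -hofbauer_sum; apply: ler_sum => k _; case/andP: (key k (ltn_ord k)).
have lo : 2 * 4 ^+ n - 2 ^+ n <= 16 * (2 ^+ n) ^+ 2 / pi ^+ 2 * odd_sum (2 ^ n).
  rewrite -E -hofbauer_sum.
  have -> : 2 ^+ n = \sum_(k < 2 ^ n) (1 : R).
    by rewrite sumr_const card_ord natrX.
  rewrite -sumrB.
  by apply: ler_sum => k _; case/andP: (key k (ltn_ord k)).
have e4 : 4 ^+ n = (2 ^+ n) ^+ 2 :> R by rewrite -exprM mulnC exprM; congr (_ ^+ _); ring.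
move: p0 up lo; rewrite e4; set p := 2 ^+ n; set o := odd_sum _ => p0 up lo.
move: (pi : R) pi0 up lo => c c0 up lo.
have q0 : 0 < c ^+ 2 / (16 * p ^+ 2) by rewrite divr_gt0 ?mulr_gt0 ?exprn_gt0.
have oE : o = c ^+ 2 / (16 * p ^+ 2) * (16 * p ^+ 2 / c ^+ 2 * o).
  by field; rewrite !gt_eqF.
rewrite oE; apply/andP; split.
- rewrite (_ : _ - _ = c ^+ 2 / (16 * p ^+ 2) * (2 * p ^+ 2 - p)); last first.
    by field; rewrite !gt_eqF.
  by rewrite ler_pM2l.
- rewrite (_ : c ^+ 2 / 8 = c ^+ 2 / (16 * p ^+ 2) * (2 * p ^+ 2)); last first.
    by field; rewrite !gt_eqF.
  by rewrite ler_pM2l.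
Qed.

(** The sum up to 2n is the sum over odd numbers plus a quarter of the sum up
    to n; in the limit, the whole sum is 4/3 of the odd one. *)
Lemma basel : \sum_(1 <= k < n.+1) (k%:R ^+ 2)^-1 @[n --> \oo] --> (pi ^+ 2 / 6 : R).
Proof.
pose T n : R := \sum_(k < n) (k.+1%:R ^+ 2)^-1.
rewrite (_ : (fun n => _) = T); last first.
  apply/funext => n; rewrite big_add1 /= big_mkord /T.
  by [].
have T2 n : T n.*2 = odd_sum n + T n / 4.
  elim: n => [|n IH]; first by rewrite /T /odd_sum !big_ord0 mul0r addr0.
  rewrite doubleS {1}/T !big_ord_recr /= -/(T n.*2) IH /odd_sum /T !big_ord_recr /=.
  rewrite (_ : (n.*2.+2)%:R = 2 * n.+1%:R); last by rewrite -doubleS -mul2n natrM.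
  rewrite [(2 * _) ^+ 2]exprMn [(2 ^+ 2 * _)^-1]invfM.
  rewrite (_ : 2 ^- 2 = 4^-1 :> R); last by congr (_^-1); ring.
  by rewrite -addrA addrACA [in RHS]mulrDl [4^-1 * _]mulrC.
have Tnd : nondecreasing_seq T.
  apply/nondecreasing_seqP => n; rewrite /T big_ord_recr /= lerDl.
  by rewrite invr_ge0 exprn_ge0.
have ond : nondecreasing_seq odd_sum.
  apply/nondecreasing_seqP => n; rewrite /odd_sum big_ord_recr /= lerDl.
  by rewrite invr_ge0 exprn_ge0.
have oub n : odd_sum n <= pi ^+ 2 / 8.
  apply: (@le_trans _ _ (odd_sum (2 ^ n))); first by apply: ond; rewrite ltnW// ltn_expl.
  by case/andP: (odd_sum_bounds n).
have Tub n : T n <= pi ^+ 2 / 6.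
  have : T n <= T n.*2 by apply: Tnd; rewrite -addnn leq_addr.
  by rewrite T2; have := oub n; lra.
have Tcv : cvgn T.
  by apply: nondecreasing_is_cvgn => //; exists (pi ^+ 2 / 6) => _ [n _ <-]; exact: Tub.
have Tl := Tcv; move/cvg_ex: Tl => [l /= Tl].
have half_cv : (2 ^+ n)^-1 @[n --> \oo] --> (0 : R).
  have -> : (fun n => (2 ^+ n)^-1) = @GRing.exp R 2^-1.
    by apply/funext => n; rewrite exprVn.
  by apply: cvg_expr; rewrite ger0_norm; lra.
have Tsub : T (2 ^ n)%N @[n --> \oo] --> l.
  apply: cvg_comp Tl.
  apply/cvgnyPge => m; exists m => // n /= mn.
  by rewrite (leq_trans mn)// ltnW// ltn_expl.
have Tsub' : T (2 ^ n).*2%N @[n --> \oo] --> l.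
  apply: cvg_comp Tl.
  apply/cvgnyPge => m; exists m => // n /= mn.
  by rewrite (leq_trans mn)// -addnn (leq_trans (ltnW (ltn_expl n (isT : (1 < 2)%N))))// leq_addr.
have osub : odd_sum (2 ^ n)%N @[n --> \oo] --> (pi ^+ 2 / 8 : R).
  apply: (squeeze_cvgr (f := fun n => pi ^+ 2 / 8 - pi ^+ 2 / 16 / 2 ^+ n)
    (h := fun=> pi ^+ 2 / 8)).
  - by apply: nearW => n; exact: odd_sum_bounds.
  - rewrite -[X in _ --> X]subr0 -[X in _ - X](mulr0 (pi ^+ 2 / 16)).
    by apply: cvgB; [exact: cvg_cst|apply: cvgM half_cv; exact: cvg_cst].
  - exact: cvg_cst.
have : T (2 ^ n).*2%N @[n --> \oo] --> pi ^+ 2 / 8 + l / 4.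
  under eq_fun do rewrite T2.
  by apply: cvgD osub _; apply: cvgM Tsub _; exact: cvg_cst.
move=> lim2; have lE : l = pi ^+ 2 / 8 + l / 4 by exact: cvg_unique Tsub' lim2.
suff <- : l = pi ^+ 2 / 6 by [].
by move: lE; move: (pi : R) => c; lra.
Qed.

End basel.

(** * Fundamental theorem of calculus on the half-line *)

Section improper.
Context {R : realType}.
Notation mu := (@lebesgue_measure R).
Implicit Types (f F : R -> R) (a b : R).

Let I n : set R := `[(n.+2%:R)^-1, n.+2%:R].

Let I_bigcup : \bigcup_n I n = `]0%R, +oo[%classic.
Proof.
apply/seteqP; split => [x [n _]|x]/=.
  rewrite /I /= !in_itv/= andbT => /andP[nx _].
  by rewrite (lt_le_trans _ nx)// invr_gt0.
rewrite in_itv/= andbT => x0.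
pose n := (Num.truncn x + Num.truncn x^-1)%N.
exists n => //; rewrite /I/= in_itv/=.
have xV0 : 0 < x^-1 by rewrite invr_gt0.
have h1 : x < (Num.truncn x).+1%:R by exact: truncnS_gt.
have h2 : x^-1 < (Num.truncn x^-1).+1%:R by exact: truncnS_gt.
apply/andP; split; last by rewrite (le_trans (ltW h1))// ler_nat ltnS -addnS leq_addr.
rewrite -[leRHS]invrK lef_pV2 ?posrE//.
by rewrite (le_trans (ltW h2))// ler_nat ltnS (leq_trans (leq_addl _ _) (leqnSn _)).
Qed.

Let I_gt0 n x : I n x -> 0 < x.
Proof. by rewrite /I/= in_itv/= => /andP[+ _]; apply: lt_le_trans; rewrite invr_gt0. Qed.

Let nd_I : nondecreasing_seq I.
Proof.
apply/nondecreasing_seqP => n; rewrite /I subsetEset; apply: subset_itv; rewrite bnd_simp.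
  by rewrite lef_pV2 ?posrE// ler_nat.
by rewrite ler_nat.
Qed.

Let mI n : measurable (I n).
Proof. exact: measurable_itv. Qed.

Let FTC_I f F (n : nat) : (forall x : R, 0 < x -> is_derive x (1:R) F (f x)) ->
  (forall x : R, 0 < x -> {for x, continuous f}) ->
  (\int[mu]_(x in I n) (f x)%:E = (F n.+2%:R)%:E - (F (n.+2%:R)^-1)%:E)%E.
Proof.
move=> dF cf.
have n2 : (n.+2%:R)^-1 < n.+2%:R :> R.
  by rewrite (@lt_trans _ _ 1)// ?invf_lt1 ?ltr1n.
have cF x : 0 < x -> {for x, continuous F}.
  move=> x0; apply/differentiable_continuous/derivable1_diffP.
  by have [] := dF x x0.
apply: continuous_FTC2 => //.
- apply: continuous_in_subspaceT => x; rewrite inE => /(@I_gt0 n); exact: cf.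
- split => [x xI||].
  + have [] // := dF x _.
    by move: xI; rewrite in_itv/= => /andP[+ _]; apply: lt_trans; rewrite invr_gt0.
  + by apply: cvg_at_right_filter; apply: cF; rewrite invr_gt0.
  + by apply: cvg_at_left_filter; apply: cF.
- move=> x xI; rewrite derive1E; have [] // := dF x _.
  by move: xI; rewrite in_itv/= => /andP[+ _]; apply: lt_trans; rewrite invr_gt0.
Qed.

Let F_lim F a b : F x @[x --> 0^'+] --> a -> F x @[x --> +oo] --> b ->
  ((F n.+2%:R)%:E - (F (n.+2%:R)^-1)%:E)%E @[n --> \oo] --> ((b - a)%:E)%E.
Proof.
move=> Fa Fb.
under eq_fun do rewrite -EFinB.
apply: cvg_EFin; first exact: nearW.
have n2 : (fun n => n.+2%:R : R) @ \oo --> +oo.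
  apply/cvgryPge => A; near=> n.
  have : A <= n%:R by near: n; exact: nbhs_infty_ger.
  by move=> /le_trans; apply; rewrite ler_nat -addn2 leq_addr.
apply: cvgB; first by apply: cvg_comp Fb.
have/cvg_at_rightP := Fa; apply; split.
  by move=> n; rewrite invr_gt0.
exact: (gtr0_cvgV0 (nearW _ _)).2.
Unshelve. all: by end_near. Qed.

(** The half-line is exhausted by the intervals [1/(n+2), n+2]; monotone
    convergence applies here, dominated convergence in the integrable case
    below. *)
Lemma ge0_FTC_halfline f F a b :
  (forall x : R, 0 < x -> 0 <= f x) ->
  (forall x : R, 0 < x -> is_derive x (1:R) F (f x)) ->
  (forall x : R, 0 < x -> {for x, continuous f}) ->
  F x @[x --> 0^'+] --> a -> F x @[x --> +oo] --> b ->
  (\int[mu]_(x in `]0%R, +oo[) (f x)%:E = (b - a)%:E)%E.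
Proof.
move=> f0 dF cf Fa Fb.
rewrite -I_bigcup.
have mf n : measurable_fun (I n) (EFin \o f).
  apply/measurable_EFinP; apply: (@subspace_continuous_measurable_fun _ (I n)); first exact: mI.
  by apply: continuous_in_subspaceT => x; rewrite inE => /(@I_gt0 n); exact: cf.
have f0' n x : I n x -> (0 <= (EFin \o f) x)%E.
  by move=> /(@I_gt0 n) /f0; rewrite lee_fin.
have := ge0_nondecreasing_set_cvg_integral (mu := mu) nd_I mI mf f0'.
under eq_fun do rewrite (FTC_I _ dF cf).
move=> h; exact: (cvg_unique _ h (F_lim Fa Fb)).
Qed.

Lemma FTC_halfline f F a b :
  (forall x : R, 0 < x -> is_derive x (1:R) F (f x)) ->
  (forall x : R, 0 < x -> {for x, continuous f}) ->
  mu.-integrable `]0%R, +oo[ (EFin \o f) ->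
  F x @[x --> 0^'+] --> a -> F x @[x --> +oo] --> b ->
  (\int[mu]_(x in `]0%R, +oo[) (f x)%:E = (b - a)%:E)%E.
Proof.
move=> dF cf fi Fa Fb.
have mf := measurable_int _ fi.
have h : (\int[mu]_(x in I n) (f x)%:E @[n --> \oo] -->
    \int[mu]_(x in `]0%R, +oo[) (f x)%:E)%E.
  rewrite [X in X @ _ --> _](_ : _ = fun n =>
      (\int[mu]_(x in `]0%R, +oo[) ((EFin \o f) \_ (I n)) x)%E); last first.
    apply/funext => n; rewrite -integral_mkcondr; congr (integral _ _ _).
    by rewrite setIidr// -I_bigcup; exact: bigcup_sup.
  apply: (@dominated_cvg _ _ _ mu _ _ _ _ (abse \o (EFin \o f))) => //.
  - move=> n; apply/(measurable_restrict _ (mI n)) => //.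
    by apply: measurable_funS mf => //; exact: subIsetl.
  - move=> x; rewrite -I_bigcup => -[n _ Inx].
    apply: cvg_near_cst; exists n => // k /= nk; rewrite patchE mem_set//.
    by have /subsetPset := nd_I nk; exact.
  - exact: integrable_abse.
  - move=> n x _ /=; rewrite patchE; case: ifPn => //= _.
    by rewrite normr0 lee_fin.
move: h; under eq_fun do rewrite (FTC_I _ dF cf).
move=> h; exact: (cvg_unique _ h (F_lim Fa Fb)).
Qed.

End improper.

(** * Derivatives of the gamma function *)

Section gamma_integrals.
Context {R : realType}.
Notation mu := (@lebesgue_measure R).
Implicit Types (x p q t : R) (m : nat).

Definition halfline : set (measurableTypeR R) := `]0%R, +oo[%classic.

Lemma measurable_halfline : measurable halfline.
Proof. exact: measurable_itv. Qed.

Lemma halflineE t : halfline t <-> 0 < t.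
Proof. by rewrite /halfline/= in_itv/= andbT. Qed.

Lemma powR_expln p t : 0 < t -> t `^ p = expR (p * ln t).
Proof. by move=> t0; rewrite /powR gt_eqF. Qed.

Lemma gt0_powRD p q t : 0 < t -> t `^ (p + q) = t `^ p * t `^ q.
Proof. by move=> t0; rewrite powRD// (gt_eqF t0) implybT. Qed.

(** A bound uniform in the exponent: q1 serves for t <= 1 and q2 for t > 1. *)
Lemma powR_le_addp p q1 q2 t : 0 < t -> q1 <= p <= q2 ->
  t `^ p <= t `^ q1 + t `^ q2.
Proof.
move=> t0 /andP[p1 p2]; have [t1|t1] := leP t 1.
  by rewrite (@le_trans _ _ (t `^ q1)) ?lerDl ?powR_ge0// ger_powR// t0.
by rewrite (@le_trans _ _ (t `^ q2)) ?lerDr ?powR_ge0// ler_powR// ltW.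
Qed.

Lemma powR_expRN_bounded p : 0 <= p ->
  exists2 C : R, 0 < C & forall t, 0 < t -> t `^ p * expR (- t) <= C.
Proof.
move=> p0; pose n := (Num.truncn p).+1.
have pn : p <= n%:R by rewrite ltW//; exact: truncnS_gt.
exists (1 + n`!%:R); first by rewrite ltr_wpDr.
move=> t t0.
rewrite (@le_trans _ _ ((1 + t ^+ n) * expR (- t)))//.
  rewrite ler_pM2r ?expR_gt0//.
  have := @powR_le_addp p 0 n%:R t t0; rewrite p0 pn powRr0 (powR_mulrn _ (ltW t0)); exact.
rewrite mulrDl mul1r lerD//; first by rewrite expR_le1 oppr_le0 ltW.
rewrite expRN ler_pdivrMr ?expR_gt0// mulrC -ler_pdivrMr ?ltr0n ?fact_gt0//.
by apply: le_trans (expR_ge1Dxn (Num.truncn p) (ltW t0)); rewrite lerDr.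
Qed.

Lemma cvg_powR_expRN_pinfty p : 0 <= p -> t `^ p * expR (- t) @[t --> +oo] --> (0 : R).
Proof.
move=> p0; have [|C C0 HC] := @powR_expRN_bounded (p + 1); first by rewrite addr_ge0.
apply/cvgrPdist_le => e e0; near=> t.
have t0 : 0 < t by near: t; exact: nbhs_pinfty_gt.
rewrite sub0r normrN ger0_norm ?mulr_ge0 ?powR_ge0 ?expR_ge0//.
have := HC _ t0; rewrite gt0_powRD// (powRr1 (ltW t0)).
rewrite mulrAC -ler_pdivlMr// => /le_trans; apply.
by rewrite ler_pdivrMr// -ler_pdivrMl.
Unshelve. all: by end_near. Qed.

Lemma cvg_powR_expRN_0 p : 0 < p -> t `^ p * expR (- t) @[t --> 0^'+] --> (0 : R).
Proof.
move=> p0; rewrite -[X in _ --> X](mul0r (expR (- 0))); apply: cvgM.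
  exact: powR_cvg0.
apply: cvg_at_right_filter; apply: continuous_comp; last exact: continuous_expR.
exact: (@continuousN _ R^o).
Qed.

Definition gamma_density x m t : R := t `^ (x - 1) * expR (- t) * ln t ^+ m.

Lemma continuous_gamma_density x m t : 0 < t ->
  {for t, continuous (gamma_density x m)}.
Proof.
move=> t0; apply: (@continuousM _ R^o); first apply: (@continuousM _ R^o).
- apply/differentiable_continuous/derivable1_diffP.
  by apply: derivable_powR; rewrite in_itv/= t0.
- apply: continuous_comp; last exact: continuous_expR.
  exact: (@continuousN _ R^o).
- apply: (@continuous_comp _ _ _ (@ln R) (fun u => u ^+ m)).
    exact: continuous_ln.
  exact: exprn_continuous.
Qed.

Lemma measurable_gamma_density x m : measurable_fun halfline (gamma_density x m).
Proof.
apply: open_continuous_measurable_fun; first exact: interval_open.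
by move=> t; rewrite inE => /halflineE; exact: continuous_gamma_density.
Qed.

Lemma is_derive_powR_expRN p t : 0 < t ->
  is_derive t (1:R) (fun t => t `^ p * expR (- t))
    (p * (t `^ (p - 1) * expR (- t)) - t `^ p * expR (- t)).
Proof.
move=> t0; have h := is_derive1_powR p t0.
apply: is_derive_eq.
by rewrite /GRing.scale/=; ring.
Qed.

Lemma integrable_gamma_density0 x : 0 < x ->
  mu.-integrable halfline (EFin \o gamma_density x 0).
Proof.
move=> x0.
(* x t^(x-1) / (1 + t^x)^2 has a bounded antiderivative, and dominates t^(x-1)
    e^-t because (1 + t^x)^2 e^-t is bounded. *)
pose F t := - (1 + t `^ x)^-1.
pose f t := x * t `^ (x - 1) / (1 + t `^ x) ^+ 2.
have pos t : 0 < 1 + t `^ x by rewrite ltr_pwDl// powR_ge0.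
have dF t : 0 < t -> is_derive t (1:R) F (f t).
  move=> t0; have h := is_derive1_powR x t0.
  have h1 : 1 + t `^ x != 0 by rewrite gt_eqF.
  have h2 : is_derive t (1:R) (fun t => 1 + t `^ x) (x * t `^ (x - 1)).
    by have := is_deriveD (is_derive_cst (1 : R) t 1) h; rewrite add0r.
  rewrite /F; apply: is_derive_eq.
  by rewrite /f /GRing.scale/= mulNr opprK mulrC -exprVn expr2 -invfM -expr2.
have cf t : 0 < t -> {for t, continuous f}.
  move=> t0; have cp q : {for t, continuous (fun t => t `^ q)}.
    apply/differentiable_continuous/derivable1_diffP.
    by apply: derivable_powR; rewrite in_itv/= t0.
  apply: (@continuousM _ R^o).
    by apply: (@continuousM _ R^o); [exact: cst_continuous|exact: cp].
  apply: (@continuousV _ R^o); first by rewrite expf_neq0// gt_eqF.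
  apply: (@continuous_comp _ _ _ (fun t => 1 + t `^ x) (fun u => u ^+ 2)); last exact: exprn_continuous.
  by apply: (@continuousD _ R^o _ (cst 1)); [exact: cst_continuous|exact: cp].
have f0 t : 0 < t -> 0 <= f t.
  by move=> t0; rewrite /f divr_ge0 ?exprn_ge0 ?mulr_ge0 ?powR_ge0// ltW.
have F0 : F t @[t --> 0^'+] --> (- 1 : R).
  rewrite -[X in _ --> - X]invr1; apply: cvgN; apply: cvgV => //.
  rewrite -[X in _ --> X]addr0; apply: cvgD; first exact: cvg_cst.
  exact: powR_cvg0.
have Foo : F t @[t --> +oo] --> (0 : R).
  rewrite /F -oppr0; apply: cvgN.
  have pos' : \forall t \near +oo, 0 < 1 + t `^ x by exact: nearW.
  apply/(gtr0_cvgV0 pos').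
  apply/cvgryPge => A; near=> t.
  have t1 : 1 <= t by near: t; exact: nbhs_pinfty_ge.
  have [A0|A0] := leP A 1; first by rewrite (le_trans A0)// lerDl powR_ge0.
  rewrite (@le_trans _ _ (t `^ x))// ?lerDr//.
  rewrite -[leLHS](@powRr1 _ A) ?(le_trans _ (ltW A0))//.
  rewrite -(@mulVf _ x) ?gt_eqF// powRrM.
  by rewrite ge0_ler_powR ?nnegrE ?powR_ge0 ?ltW.
have fint : mu.-integrable halfline (EFin \o f).
  apply/integrableP; split.
    apply/measurable_EFinP; apply: open_continuous_measurable_fun; first exact: interval_open.
    by move=> t; rewrite inE => /halflineE; exact: cf.
  rewrite [X in (X < _)%E](_ : _ = (\int[mu]_(x in `]0%R, +oo[) (f x)%:E)%E).
    by rewrite (ge0_FTC_halfline f0 dF cf F0 Foo) ltry.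
  apply: eq_integral => t; rewrite inE => /halflineE t0 /=.
  by rewrite ger0_norm// f0.
have [C1 C10 H1] := powR_expRN_bounded (ltW x0).
have [C2 C20 H2] := @powR_expRN_bounded (x + x) (addr_ge0 (ltW x0) (ltW x0)).
pose C := (1 + 2 * C1 + C2) / x.
apply: (@le_integrable _ _ _ _ _ measurable_halfline _ (fun t => C%:E * (EFin \o f) t)%E).
- by apply/measurable_EFinP; exact: measurable_gamma_density.
- move=> t /halflineE t0 /=.
  rewrite /gamma_density expr0 mulr1 lee_fin !ger0_norm; last 2 first.
  + apply: mulr_ge0; last exact: f0.
    by apply: divr_ge0; [lra|exact: ltW].
  + by rewrite mulr_ge0 ?powR_ge0 ?expR_ge0.
  rewrite /C /f.
  have -> : (1 + 2 * C1 + C2) / x * (x * t `^ (x - 1) / (1 + t `^ x) ^+ 2) =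
    t `^ (x - 1) * ((1 + 2 * C1 + C2) / (1 + t `^ x) ^+ 2).
    by field; rewrite !gt_eqF// ?exprn_gt0.
  rewrite ler_wpM2l ?powR_ge0// ler_pdivlMr ?exprn_gt0//.
  rewrite [leLHS](_ : _ = expR (- t) + 2 * (t `^ x * expR (- t)) + t `^ (x + x) * expR (- t)); last first.
    by rewrite gt0_powRD//; ring.
  rewrite !lerD ?H2// ?ler_pM2l ?H1//.
  by rewrite expR_le1 oppr_le0 ltW.
- exact: (integrableZl measurable_halfline C fint).
Unshelve. all: by end_near. Qed.

(** From w^m / m! <= e^w at w = q |ln t|. *)
Lemma norm_lnX_le m q t : 0 < q -> 0 < t ->
  `|ln t ^+ m| <= m`!%:R / q ^+ m * (t `^ q + t `^ (- q)).
Proof.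
move=> q0 t0; rewrite normrX.
have qm0 : 0 < q ^+ m by rewrite exprn_gt0.
have fact0 : 0 < m`!%:R :> R by rewrite ltr0n fact_gt0.
have key : (q * `|ln t|) ^+ m / m`!%:R <= expR (q * `|ln t|).
  case: m {qm0 fact0} => [|m].
    by rewrite expr0 divr1 -expR0 ler_expR mulr_ge0// ltW.
  by apply: le_trans (expR_ge1Dxn m _); [rewrite lerDr|rewrite mulr_ge0// ltW].
have up : expR (q * `|ln t|) <= t `^ q + t `^ (- q).
  rewrite !powR_expln//; have [l0|l0] := leP 0 (ln t).
    by rewrite ger0_norm// lerDl expR_ge0.
  by rewrite ltr0_norm// mulrN -mulNr lerDr expR_ge0.
have := le_trans key up.
rewrite exprMn ler_pdivrMr// => h.
rewrite mulrAC ler_pdivlMr// mulrC.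
by rewrite [leRHS]mulrC.
Qed.

(** A majorant that does not depend on x in [u, v], for differentiating under
    the integral sign. *)
Lemma norm_gamma_density_le x m u v t : 0 < u -> u <= x <= v -> 0 < t ->
  `|gamma_density x m t| <= m`!%:R / (u / 2) ^+ m * 2 *
    (gamma_density (u / 2) 0 t + gamma_density (v + u / 2) 0 t).
Proof.
move=> u0 /andP[ux xv] t0.
set K := m`!%:R / (u / 2) ^+ m.
have u2 : 0 < u / 2 by rewrite divr_gt0.
have K0 : 0 <= K by rewrite divr_ge0// exprn_ge0// ltW.
rewrite /gamma_density normrM ger0_norm ?mulr_ge0 ?powR_ge0 ?expR_ge0// !expr0 !mulr1.
rewrite (@le_trans _ _ (t `^ (x - 1) * expR (- t) * (K * (t `^ (u / 2) + t `^ (- (u / 2))))))//.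
  by rewrite ler_wpM2l ?mulr_ge0 ?powR_ge0 ?expR_ge0// norm_lnX_le.
rewrite [leLHS](_ : _ = K * expR (- t) * (t `^ (x - 1 + u / 2) + t `^ (x - 1 - u / 2))); last first.
  by rewrite !gt0_powRD//; ring.
rewrite [leRHS](_ : _ = K * expR (- t) * (2 * (t `^ (u / 2 - 1) + t `^ (v + u / 2 - 1)))); last by ring.
apply: ler_wpM2l; first by apply: mulr_ge0 K0 _; exact: expR_ge0.
have h1 : t `^ (x - 1 + u / 2) <= t `^ (u / 2 - 1) + t `^ (v + u / 2 - 1).
  by apply: powR_le_addp => //; apply/andP; split; lra.
have h2 : t `^ (x - 1 - u / 2) <= t `^ (u / 2 - 1) + t `^ (v + u / 2 - 1).
  by apply: powR_le_addp => //; apply/andP; split; lra.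
by rewrite (le_trans (lerD h1 h2))// -mulr2n mulr_natl.
Qed.

Lemma integrable_gamma_majorant c y z : 0 < y -> 0 < z -> mu.-integrable halfline
  (EFin \o (fun t => c * (gamma_density y 0 t + gamma_density z 0 t))).
Proof.
move=> /integrable_gamma_density0 iy /integrable_gamma_density0 iz.
exact: (integrableZl measurable_halfline c (integrableD measurable_halfline iy iz)).
Qed.

Lemma integrable_gamma_density x m : 0 < x ->
  mu.-integrable halfline (EFin \o gamma_density x m).
Proof.
move=> x0.
have x2 : 0 < x / 2 by rewrite divr_gt0.
apply: (@le_integrable _ _ _ _ _ measurable_halfline _ (EFin \o (fun t =>
  m`!%:R / (x / 2) ^+ m * 2 * (gamma_density (x / 2) 0 t + gamma_density (x + x / 2) 0 t)))).
- by apply/measurable_EFinP; exact: measurable_gamma_density.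
- move=> t /halflineE t0; rewrite lee_fin [leRHS]ger0_norm.
    by apply: norm_gamma_density_le; rewrite ?lexx.
  have h : x <= x <= x by rewrite lexx.
  exact: le_trans (normr_ge0 _) (norm_gamma_density_le m x0 h t0).
- by apply: integrable_gamma_majorant; rewrite ?addr_gt0.
Qed.

End gamma_integrals.

(** The m-th derivative of the gamma function. *)
HB.lock Definition gamma_moment {R : realType} (m : nat) (x : R) : R :=
  \int[lebesgue_measure]_(t in halfline) gamma_density x m t.

Section gamma_moments.
Context {R : realType}.
Notation mu := (@lebesgue_measure R).
Implicit Types (x t : R) (m : nat).

Lemma Gamma_moment0 : @Gamma R = gamma_moment 0.
Proof.
apply/funext => x; rewrite /Gamma gamma_moment.unlock; apply: eq_Rintegral => t _.
by rewrite /gamma_density expr0 mulr1.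
Qed.

Lemma is_derive_gamma_density x m t : 0 < t ->
  is_derive x (1:R) (fun x => gamma_density x m t) (gamma_density x m.+1 t).
Proof.
move=> t0.
rewrite (_ : (fun x => _) = (fun x => expR ((x - 1) * ln t) * (expR (- t) * ln t ^+ m))); last first.
  by apply/funext => y; rewrite /gamma_density powR_expln// mulrA.
rewrite /gamma_density powR_expln//.
apply: is_derive_eq.
by rewrite /GRing.scale/= exprS; ring.
Qed.

Lemma is_derive_gamma_moment m x : 0 < x ->
  is_derive x (1:R) (gamma_moment m) (gamma_moment m.+1 x).
Proof.
rewrite gamma_moment.unlock.
move=> x0.
have x2 : 0 < x / 2 by rewrite divr_gt0.
have x4 : 0 < x / 2 / 2 by rewrite divr_gt0.
pose K := m.+1`!%:R / (x / 2 / 2) ^+ m.+1 * 2.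
have K0 : 0 <= K by rewrite mulr_ge0// divr_ge0// exprn_ge0// ltW.
pose G t := K * (gamma_density (x / 2 / 2) 0 t + gamma_density (x + 1 + x / 2 / 2) 0 t).
have gd0 y t : 0 <= gamma_density y 0 t.
  by rewrite /gamma_density expr0 mulr1 mulr_ge0 ?powR_ge0 ?expR_ge0.
have I x' : x / 2 < x' < x + 1 -> 0 < x' by move=> /andP[+ _]; apply: lt_trans.
have xI : x \in `](x / 2), (x + 1)[ by rewrite in_itv/=; apply/andP; split; lra.
have intf y : `](x / 2), (x + 1)[%classic y -> mu.-integrable halfline (EFin \o gamma_density y m).
  by rewrite /= in_itv/= => /I; exact: integrable_gamma_density.
have df y t : `](x / 2), (x + 1)[%classic y -> halfline t ->
    derivable ((gamma_density ^~ m) ^~ t) y 1.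
  by move=> _ /halflineE t0; have [] := is_derive_gamma_density y m t0.
have d1E y t : 0 < t -> partial1of2 (gamma_density ^~ m) y t = gamma_density y m.+1 t.
  by move=> t0; rewrite partial1of2E; have [] := is_derive_gamma_density y m t0.
have G0 t : 0 <= G t by rewrite mulr_ge0// addr_ge0.
have intG : mu.-integrable halfline (EFin \o G).
  by apply: integrable_gamma_majorant; lra.
have Gub y t : `](x / 2), (x + 1)[%classic y -> halfline t ->
    `|partial1of2 (gamma_density ^~ m) y t| <= G t.
  rewrite /= in_itv/= => /andP[xy yx] /halflineE t0; rewrite d1E//.
  by apply: norm_gamma_density_le => //; rewrite !ltW.
split.
  exact: (derivable_under_integral measurable_halfline xI intf df G0 intG Gub).
rewrite -derive1E (differentiation_under_integral measurable_halfline xI intf df G0 intG Gub).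
by apply: eq_Rintegral => t; rewrite inE => /halflineE t0; rewrite d1E.
Qed.

End gamma_moments.

(** * Digamma and trigamma at 1 *)

Section gamma_function.
Context {R : realType}.
Notation mu := (@lebesgue_measure R).
Notation gm := (@gamma_moment R).
Implicit Types (x t : R) (m n : nat).

Lemma integral_gamma_moment m x : 0 < x ->
  (\int[mu]_(t in halfline) (gamma_density x m t)%:E = (gm m x)%:E)%E.
Proof.
move=> x0; rewrite gamma_moment.unlock /Rintegral fineK//.
by apply: integrable_fin_num; [exact: measurable_halfline|exact: integrable_gamma_density].
Qed.

(** Linear combinations of gamma densities, as lists of triples (coefficient,
    shape, power of the logarithm): a pointwise inequality between densities
    becomes one between gamma moments. *)
Definition gamma_comb (s : seq (R * R * nat)) t :=
  \sum_(i <- s) i.1.1 * gamma_density i.1.2 i.2 t.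

Lemma gamma_comb_integral (s : seq (R * R * nat)) :
  all (fun i => 0 < i.1.2) s ->
  mu.-integrable halfline (EFin \o gamma_comb s) /\
  \int[mu]_(t in halfline) gamma_comb s t = \sum_(i <- s) i.1.1 * gm i.2 i.1.2.
Proof.
rewrite gamma_moment.unlock.
have mH := @measurable_halfline R.
elim: s => [_|[[c x] m] s IH] /=.
  rewrite (_ : gamma_comb [::] = cst 0); last by apply/funext => t; rewrite /gamma_comb big_nil.
  by rewrite big_nil Rintegral_cst// mul0r; split=> //; exact: integrable0.
move=> /andP[/= x0 /IH[si Is]].
have ig : mu.-integrable halfline (EFin \o (fun t => c * gamma_density x m t)).
  exact: (integrableZl mH c (integrable_gamma_density m x0)).
rewrite (_ : gamma_comb _ = fun t => c * gamma_density x m t + gamma_comb s t); last first.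
  by apply/funext => t; rewrite /gamma_comb big_cons.
split; first exact: (integrableD mH ig si).
by rewrite RintegralD// big_cons/= Is RintegralZl//; exact: integrable_gamma_density.
Qed.

Lemma continuous_gamma_comb s t : 0 < t -> {for t, continuous (gamma_comb s)}.
Proof.
move=> t0; elim: s => [|i s IH].
  rewrite (_ : gamma_comb [::] = cst 0); first exact: cst_continuous.
  by apply/funext => u; rewrite /gamma_comb big_nil.
rewrite (_ : gamma_comb _ = fun t => i.1.1 * gamma_density i.1.2 i.2 t + gamma_comb s t); last first.
  by apply/funext => u; rewrite /gamma_comb big_cons.
apply: (@continuousD _ R^o) => //; apply: (@continuousM _ R^o); first exact: cst_continuous.
exact: continuous_gamma_density.
Qed.

Lemma gamma_comb_ge0 (s : seq (R * R * nat)) :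
  all (fun i => 0 < i.1.2) s -> (forall t, 0 < t -> 0 <= gamma_comb s t) ->
  0 <= \sum_(i <- s) i.1.1 * gm i.2 i.1.2.
Proof.
move=> /gamma_comb_integral[_ <-] h; apply: Rintegral_ge0 => t /halflineE; exact: h.
Qed.

Lemma Gamma1 : gm 0 1 = 1.
Proof.
suff : (gm 0 1)%:E = 1%:E by case.
rewrite -integral_gamma_moment//.
rewrite (_ : 1%:E = (0 - (-1))%:E :> \bar R); last by rewrite sub0r opprK.
transitivity (\int[mu]_(t in `]0%R, +oo[) ((expR \o -%R) t)%:E)%E; last first.
  apply: (@ge0_FTC_halfline R _ (fun t => - expR (- t))); last first.
  - rewrite -[X in _ --> X]oppr0; apply: cvgN; exact: cvgr_expR.
  - rewrite -[X in _ --> - X]expR0 -[X in expR X]oppr0; apply: cvgN.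
    apply: cvg_at_right_filter; apply: (@continuous_comp _ _ _ -%R expR); last exact: continuous_expR.
    exact: (@continuousN _ R^o).
  - move=> t _; apply: continuous_comp; last exact: continuous_expR.
    exact: (@continuousN _ R^o).
  - by move=> t _; apply: is_derive_eq; rewrite /GRing.scale/=; ring.
  - by move=> t _; exact: expR_ge0.
apply: eq_integral => t; rewrite inE => /halflineE t0.
by rewrite /gamma_density subrr powRr0 mul1r expr0 mulr1.
Qed.

(** Integration by parts: t^x e^-t vanishes at both ends of the half-line. *)
Lemma GammaD1 x : 0 < x -> gm 0 (x + 1) = x * gm 0 x.
Proof.
move=> x0; have x1 : 0 < x + 1 by rewrite addr_gt0.
apply/eqP; rewrite -subr_eq0; apply/eqP.
pose s := [:: (- x, x, 0%N); (1, x + 1, 0%N)].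
have [] := @gamma_comb_integral s; first by rewrite /= x0 x1.
rewrite !big_cons big_nil addr0 /= mul1r mulNr addrC => si <-.
have sE t : 0 < t -> gamma_comb s t = - (x * (t `^ (x - 1) * expR (- t)) - t `^ x * expR (- t)).
  move=> t0; rewrite /gamma_comb !big_cons big_nil addr0 /gamma_density !expr0 !mulr1 addrK mul1r.
  by rewrite /=; ring.
suff h : (\int[mu]_(t in halfline) (gamma_comb s t)%:E = (0 - 0)%:E)%E.
  by rewrite /Rintegral h subrr.
apply: (@FTC_halfline R _ (fun t => - (t `^ x * expR (- t))) 0 0 _ _ si).
- move=> t t0; rewrite sE//; apply: is_deriveN; exact: is_derive_powR_expRN.
- move=> t t0; exact: continuous_gamma_comb.
- by rewrite -[X in _ --> X]oppr0; apply: cvgN; exact: (cvg_powR_expRN_0 x0).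
- by rewrite -[X in _ --> X]oppr0; apply: cvgN; exact: (cvg_powR_expRN_pinfty (ltW x0)).
Qed.

(** The functional equation of Gamma, differentiated m times. *)
Lemma gamma_moment_rec m x : 0 < x ->
  gm m (x + 1) = x * gm m x + m%:R * gm m.-1 x.
Proof.
elim: m x => [|m IH] x x0; first by rewrite GammaD1// mul0r addr0.
have x1 : 0 < x + 1 by rewrite addr_gt0.
have dl : is_derive x (1:R) (fun x => gm m (x + 1)) (gm m.+1 (x + 1)).
  have d1 : is_derive x (1:R) (fun y : R => y + 1) 1.
    by have := is_deriveD (is_derive_id x (1:R)) (is_derive_cst (1 : R) x 1); rewrite addr0.
  have d2 := is_derive_gamma_moment m x1.
  by have := @is_derive1_comp R (gm m) (fun y => y + 1) x _ _ d2 d1; rewrite mulr1.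
have dr : is_derive x (1:R) (fun x => x * gm m x + m%:R * gm m.-1 x)
    (x * gm m.+1 x + m.+1%:R * gm m x).
  have d1 := is_derive_gamma_moment m x0.
  have d2 := is_derive_gamma_moment m.-1 x0.
  apply: is_derive_eq; rewrite /GRing.scale/= mulr1.
  case: m {IH dl d1 d2} => [|m] /=; first by rewrite mul0r addr0 mul1r.
  by rewrite -[in RHS]natr1; ring.
have [_ <-] := dl; have [_ <-] := dr.
apply: near_eq_derive; near=> y; apply: IH.
by near: y; exact: lt_nbhsr.
Unshelve. all: by end_near. Qed.

Lemma Gamma_gt0 x : 0 < x -> 0 < gm 0 x.
Proof.
move=> x0.
pose c := Num.min 1 (2 `^ (x - 1)) * expR (- 2).
have c0 : 0 < c by rewrite mulr_gt0 ?expR_gt0// lt_min ltr01 powR_gt0.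
apply: (lt_le_trans c0); rewrite -lee_fin -integral_gamma_moment//.
apply: (@le_trans _ _ (\int[mu]_(t in `[1%R, 2%R]) c%:E)%E).
  rewrite integral_cst//= lebesgue_measure_itv/= lte_fin ltr1n/= -EFinD.
  by rewrite -EFinM lee_fin [X in _ * X](_ : _ = 1) ?mulr1//; lra.
apply: (@le_trans _ _ (\int[mu]_(t in `[1%R, 2%R]) (gamma_density x 0 t)%:E)%E).
  apply: ge0_le_integral => //.
  - by move=> t _; rewrite lee_fin ltW.
  - apply/measurable_EFinP; apply: measurable_funS (measurable_gamma_density x 0).
      exact: measurable_halfline.
    by move=> t; rewrite /= in_itv/= => /andP[t1 _]; apply/halflineE; exact: lt_le_trans t1.
  - move=> t; rewrite /= in_itv/= => /andP[t1 t2]; rewrite lee_fin /gamma_density expr0 mulr1.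
    have t0 : 0 < t by exact: lt_le_trans t1.
    apply: ler_pM; rewrite ?expR_ge0 ?ler_expR ?lerN2//.
    rewrite ge_min; have [p0|p0] := leP 0 (x - 1).
      by rewrite -[X in X <= _](powRr0 t) ler_powR.
    have h q : q `^ (x - 1) = (q `^ (1 - x))^-1 by rewrite -powRN opprB.
    apply/orP; right; rewrite !h lef_pV2 ?posrE ?powR_gt0//.
    by apply: ge0_ler_powR; rewrite ?nnegrE//; lra.
apply: ge0_subset_integral => //.
- exact: measurable_halfline.
- by apply/measurable_EFinP; exact: measurable_gamma_density.
- by move=> t /halflineE t0; rewrite lee_fin /gamma_density expr0 mulr1 mulr_ge0 ?powR_ge0 ?expR_ge0.
- by move=> t; rewrite /= in_itv/= => /andP[t1 _]; apply/halflineE; exact: lt_le_trans t1.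
Qed.

Definition digamma x := gm 1 x / gm 0 x.
Definition trigamma x := gm 2 x / gm 0 x - digamma x ^+ 2.

Lemma digammaD1 x : 0 < x -> digamma (x + 1) = digamma x + x^-1.
Proof.
move=> x0; have g0 := Gamma_gt0 x0.
rewrite /digamma !gamma_moment_rec//= mul0r addr0 mul1r.
by field; rewrite !gt_eqF.
Qed.

Lemma trigammaD1 x : 0 < x -> trigamma (x + 1) = trigamma x - (x ^+ 2)^-1.
Proof.
move=> x0; have g0 := Gamma_gt0 x0.
rewrite /trigamma digammaD1// /digamma !gamma_moment_rec//= mul0r addr0.
by field; rewrite !gt_eqF.
Qed.

Lemma is_derive_digamma x : 0 < x -> is_derive x (1:R) digamma (trigamma x).
Proof.
move=> x0; have g0 := Gamma_gt0 x0.
have d0 := is_derive_gamma_moment 0 x0.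
have d1 := is_derive_gamma_moment 1 x0.
have gn0 : gm 0 x != 0 by rewrite gt_eqF.
rewrite /digamma; apply: is_derive_eq.
rewrite /trigamma /digamma /GRing.scale/=.
by field.
Qed.

(** trigamma x is the variance of ln t under the gamma law of shape x. *)
Lemma trigamma_ge0 x : 0 < x -> 0 <= trigamma x.
Proof.
move=> x0; have g0 := Gamma_gt0 x0.
have := @gamma_comb_ge0 [:: (1, x, 2%N); (- (2 * digamma x), x, 1%N); (digamma x ^+ 2, x, 0%N)].
rewrite !big_cons big_nil addr0 /= => key.
have : 0 <= 1 * gm 2 x + (- (2 * digamma x) * gm 1 x + digamma x ^+ 2 * gm 0 x).
  apply: key; first by rewrite x0.
  move=> t t0; rewrite /gamma_comb !big_cons big_nil addr0 /= /gamma_density.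
  rewrite (_ : _ + _ = t `^ (x - 1) * expR (- t) * (ln t - digamma x) ^+ 2); last by ring.
  by rewrite mulr_ge0 ?sqr_ge0// mulr_ge0 ?powR_ge0 ?expR_ge0.
rewrite (_ : _ + _ = gm 0 x * trigamma x); first by rewrite pmulr_rge0.
by rewrite /trigamma /digamma; field; rewrite gt_eqF.
Qed.

Lemma digamma_nondecreasing x y : 0 < x -> x <= y -> digamma x <= digamma y.
Proof.
move=> x0 xy; have pos t : x <= t <= y -> 0 < t by move=> /andP[+ _]; exact: lt_le_trans.
apply: (is_derive_le xy (fun t xt => is_derive_digamma (pos t xt))) => t xt.
exact/trigamma_ge0/(pos t).
Qed.

(** ln x is the increment of ln Gamma over [x, x + 1], hence squeezed between the
    values at the ends of its nondecreasing derivative digamma. *)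
Lemma digamma_ln_bounds x : 0 < x -> digamma x <= ln x <= digamma (x + 1).
Proof.
move=> x0; have x1 : x < x + 1 by rewrite ltrDl.
have dl t : 0 < t -> is_derive t (1:R) (fun t => ln (gm 0 t)) (digamma t).
  move=> t0; have d0 := is_derive_gamma_moment 0 t0.
  have dln := is_derive1_ln (Gamma_gt0 t0).
  have := @is_derive1_comp R (@ln R) (gm 0) t _ _ dln d0.
  by rewrite /digamma mulrC.
have [|c [cI _]] := @is_derive_mvt R (fun t => ln (gm 0 t)) digamma (x + 1) x.
  move=> t tI; apply: dl; case/orP: tI => /andP[xt _]; last exact: lt_le_trans xt.
  exact: lt_le_trans (lt_trans x0 x1) xt.
have -> : x + 1 - x = 1 by rewrite addrAC subrr add0r.
rewrite mulr1 GammaD1// lnM ?posrE ?Gamma_gt0// addrK => ->.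
have /andP[xc cx] : x <= c <= x + 1.
  by case/orP: cI => // /andP[h1 h2]; move: (le_lt_trans (le_trans h1 h2) x1); rewrite ltxx.
by rewrite !digamma_nondecreasing// (lt_le_trans x0).
Qed.

Let cvg_invn : (n%:R^-1 : R) @[n --> \oo] --> (0 : R).
Proof.
apply/gtr0_cvgV0; last exact: cvgr_idn.
by near=> n; rewrite ltr0n; near: n; exact: nbhs_infty_gt.
Unshelve. all: by end_near. Qed.

Lemma digammaS n : digamma n.+1%:R = digamma 1 + \sum_(1 <= i < n.+1) i%:R^-1.
Proof.
elim: n => [|n IH]; first by rewrite big_geq ?addr0.
by rewrite -natr1 digammaD1// IH [in RHS]big_nat_recr//= addrA.
Qed.

(** digamma n differs from digamma 1 by a harmonic sum, and from ln n by at
    most 1/n. *)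
Lemma digamma1 : digamma 1 = - euler_gamma.
Proof.
rewrite /euler_gamma.
suff h : (\sum_(1 <= i < n.+1) i%:R^-1 - ln n%:R) @[n --> \oo] --> (- digamma 1 : R).
  by rewrite (cvg_lim _ h)// opprK.
have hV := cvg_invn.
apply: (squeeze_cvgr (f := fun=> - digamma 1) (h := fun n => - digamma 1 + n%:R^-1)).
- near=> n; have n0 : (0 < n)%N by near: n; exact: nbhs_infty_gt.
  have n0' : 0 < n%:R :> R by rewrite ltr0n.
  have /andP[lo up] := digamma_ln_bounds n0'.
  rewrite natr1 digammaS in up.
  move: lo; rewrite -{1}(prednK n0) digammaS prednK//.
  move: up; rewrite big_nat_recr//= => up lo.
  by apply/andP; split; lra.
- exact: cvg_cst.
- rewrite -[X in _ --> X]addr0; apply: cvgD hV; exact: cvg_cst.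
Unshelve. all: by end_near. Qed.

(** With u = e^v this reads v^2 <= (2 sinh (v/2))^2. *)
Lemma ln_sqr_le (u : R) : 0 < u -> ln u ^+ 2 <= u + u^-1 - 2.
Proof.
move=> u0.
have sinh_ge (w : R) : 0 <= w -> 2 * w <= expR w - expR (- w).
  move=> w0; rewrite -subr_ge0.
  have := @is_derive_le R (fun w => expR w - expR (- w) - 2 * w)
    (fun t => expR t + expR (- t) - 2) 0 w w0.
  rewrite oppr0 expR0 subrr mulr0 subrr; apply=> t _.
    by apply: is_derive_eq; rewrite /GRing.scale/=; ring.
  rewrite (_ : _ - _ = (expR t - 1) ^+ 2 * expR (- t)).
    by rewrite mulr_ge0 ?sqr_ge0 ?expR_ge0.
  by rewrite expRN; field; rewrite expR_eq0.
set v := ln u.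
have -> : u + u^-1 - 2 = (expR (`|v| / 2) - expR (- (`|v| / 2))) ^+ 2.
  have aE : expR (`|v| / 2) * expR (- (`|v| / 2)) = 1 by exact: expRxMexpNx_1.
  have -> : u + u^-1 = expR `|v| + expR (- `|v|).
    have -> : u = expR v by rewrite /v lnK.
    have [v0|v0] := leP 0 v; first by rewrite ger0_norm// expRN.
    by rewrite ltr0_norm// opprK expRN addrC.
  have -> : expR `|v| = expR (`|v| / 2) ^+ 2 by rewrite -expRM_natr; congr expR; lra.
  have -> : expR (- `|v|) = expR (- (`|v| / 2)) ^+ 2 by rewrite -expRM_natr; congr expR; lra.
  by move: aE; move: (expR (_ / _)) (expR (- _)) => a b ab; rewrite sqrrB ab; ring.
have h0 : 0 <= `|v| / 2 by rewrite divr_ge0.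
have h := sinh_ge _ h0; rewrite [2 * _]mulrC divfK// in h.
by rewrite -real_normK ?num_real// ler_sqr ?nnegrE// (le_trans _ h).
Qed.

(** The variance of ln t is at most its mean square deviation from ln x, to
    which the bound (ln u)^2 <= u + 1/u - 2 applies at u = t/x. *)
Lemma trigamma_le x : 1 < x -> trigamma x <= (x - 1)^-1.
Proof.
move=> x1; have x0 : 0 < x by rewrite (lt_trans ltr01).
have xm1 : 0 < x - 1 by rewrite subr_gt0.
have g0 := Gamma_gt0 x0.
have := @gamma_comb_ge0 [:: (x^-1, x + 1, 0%N); (x, x - 1, 0%N);
  (- 2 - ln x ^+ 2, x, 0%N); (2 * ln x, x, 1%N); (- 1, x, 2%N)].
rewrite !big_cons big_nil addr0 /= => key.
have : 0 <= x^-1 * gm 0 (x + 1) + (x * gm 0 (x - 1) +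
    ((- 2 - ln x ^+ 2) * gm 0 x + (2 * ln x * gm 1 x + - 1 * gm 2 x))).
  apply: key; first by rewrite xm1 x0 addr_gt0.
  move=> t t0; rewrite /gamma_comb !big_cons big_nil addr0 /= /gamma_density !expr0 !mulr1.
  have -> : t `^ (x + 1 - 1) = t * t `^ (x - 1).
    by rewrite addrAC [LHS]gt0_powRD// (powRr1 (ltW t0)) mulrC.
  have -> : t `^ (x - 1 - 1) = t `^ (x - 1) / t.
    by rewrite [LHS]gt0_powRD// (powR_inv1 (ltW t0)).
  have := ln_sqr_le (divr_gt0 t0 x0).
  rewrite ln_div ?posrE// invf_div -subr_ge0 => h.
  have a0 : 0 <= t `^ (x - 1) * expR (- t) by rewrite mulr_ge0 ?powR_ge0 ?expR_ge0.
  apply: le_trans (mulr_ge0 a0 h) _; rewrite le_eqVlt; apply/orP; left; apply/eqP.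
  by field; rewrite !gt_eqF.
have gx := GammaD1 xm1; rewrite subrK in gx.
have -> : gm 0 (x - 1) = gm 0 x / (x - 1) by rewrite gx; field; rewrite gt_eqF.
rewrite GammaD1// (_ : x^-1 * _ + _ = gm 0 x * ((x - 1)^-1 - trigamma x - (digamma x - ln x) ^+ 2)).
  rewrite pmulr_rge0//; have := sqr_ge0 (digamma x - ln x).
  by move: ((digamma x - ln x) ^+ 2) (trigamma x) ((x - 1)^-1) => q a b; lra.
by rewrite /trigamma /digamma; field; rewrite !gt_eqF.
Qed.

(** The recurrence telescopes into the Basel sum, since trigamma n tends to
    0. *)
Lemma trigamma1 : trigamma 1 = pi ^+ 2 / 6.
Proof.
have TS n : trigamma n.+1%:R = trigamma 1 - \sum_(1 <= i < n.+1) (i%:R ^+ 2)^-1.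
  elim: n => [|n IH]; first by rewrite big_geq ?subr0.
  by rewrite -natr1 trigammaD1// IH [in RHS]big_nat_recr//= opprD addrA.
have hV := cvg_invn.
apply: cvg_unique (@basel R); first exact: norm_hausdorff.
apply: (squeeze_cvgr (f := fun n => trigamma 1 - n%:R^-1) (h := fun=> trigamma 1)).
- near=> n; have n0 : (0 < n)%N by near: n; exact: nbhs_infty_gt.
  have n1 : 1 < n.+1%:R :> R by rewrite ltr1n ltnS.
  have := trigamma_le n1; have := @trigamma_ge0 n.+1%:R (ltr0Sn _ _).
  rewrite TS -[X in _ <= (X - 1)^-1]natr1 addrK => ? ?.
  by apply/andP; split; lra.
- rewrite -[X in _ --> X]subr0; apply: cvgB hV; exact: cvg_cst.
- exact: cvg_cst.
Unshelve. all: by end_near. Qed.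

End gamma_function.

(** * Zeros of steep functions *)

Section reciprocal_steepness.
Context {R : realType}.
Implicit Types (P : R -> R) (x y z : R).

(** Both equations to be solved, Pi = 0 and the likelihood equation, have on
    their left-hand side 1/y minus a nondecreasing function of y. This
    property yields existence, uniqueness, the sign pattern and a quantitative
    location of the zero. *)
Definition recip_steep P := forall x y, 0 < x -> x <= y -> P y - P x <= y^-1 - x^-1.

Lemma recip_steep_zero P b : recip_steep P -> 0 < b -> P b <= 0 ->
  (forall x, 0 < x -> {for x, continuous P}) -> exists2 z, 0 < z <= b & P z = 0.
Proof.
move=> sP b0 Pb cP.
have b0' : 0 < b^-1 by rewrite invr_gt0.
have h1 : b^-1 <= b^-1 - P b by rewrite lerDl oppr_ge0.
have h0 : 0 < b^-1 - P b by exact: lt_le_trans h1.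
(* e is the point where steepness, applied between e and b, forces P e >= 0 *)
pose e := (b^-1 - P b)^-1.
have e0 : 0 < e by rewrite invr_gt0.
have e1 : e <= b by rewrite -[leRHS]invrK lef_pV2 ?posrE.
have Pe : 0 <= P e by have := sP _ _ e0 e1; rewrite invrK; lra.
have cP' : {within `[e, b], continuous P}.
  apply: continuous_in_subspaceT => t; rewrite inE/= in_itv/= => /andP[et _].
  by apply: cP; exact: lt_le_trans et.
have [|z] := @IVT R P e b 0 e1 cP'; first by rewrite ge_min le_max Pb Pe orbT.
by rewrite in_itv/= => /andP[ez zb] Pz; exists z; rewrite // zb (lt_le_trans e0).
Qed.

(** The source of all rates: a function that is small at y has its zero near
    y. *)
Lemma recip_steep_dist P z y : recip_steep P -> 0 < z -> P z = 0 -> 0 < y ->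
  `|z^-1 - y^-1| <= `|P y|.
Proof.
move=> sP z0 Pz y0; have [zy|yz] := leP z y.
- have := sP _ _ z0 zy; rewrite Pz subr0 => h.
  have iv : y^-1 <= z^-1 by rewrite lef_pV2 ?posrE.
  by rewrite ger0_norm ?subr_ge0// -normrN; apply: le_trans (ler_norm _); lra.
- have := sP _ _ y0 (ltW yz); rewrite Pz sub0r => h.
  have iv : z^-1 <= y^-1 by rewrite lef_pV2 ?posrE// ltW.
  by rewrite ler0_norm ?subr_le0//; apply: le_trans (ler_norm _); lra.
Qed.

Lemma recip_steep_le_zero P z y : recip_steep P -> 0 < z -> P z = 0 -> 0 < y ->
  (P y <= 0) = (z <= y).
Proof.
move=> sP z0 Pz y0; apply/idP/idP => [Py|zy].
- rewrite leNgt; apply/negP => yz.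
  have := sP _ _ y0 (ltW yz); rewrite Pz sub0r.
  have : z^-1 < y^-1 by rewrite ltf_pV2 ?posrE.
  lra.
- have := sP _ _ z0 zy; rewrite Pz subr0.
  have : y^-1 <= z^-1 by rewrite lef_pV2 ?posrE.
  lra.
Qed.

End reciprocal_steepness.

(** * Upsilon, Pi and the zero varpi *)

Section varpi_theory.
Context {R : realType}.
Notation gm := (@gamma_moment R).
Implicit Types (r s x y : R) (m : nat).

Let gtN1 x : 0 < x -> - 1 < x.
Proof. by move=> /(lt_trans _); apply; rewrite ltrN10. Qed.

(** The m-th derivative of Upsilon in its second argument. *)
Definition Ups r m x : R := r * gm m (x + 2) + (1 - r) * gm m (x + 1).

Lemma UpsilonE r : Upsilon r = Ups r 0.
Proof. by apply/funext => x; rewrite /Upsilon Gamma_moment0. Qed.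

Lemma is_derive_Ups r m x : - 1 < x -> is_derive x (1:R) (Ups r m) (Ups r m.+1 x).
Proof.
move=> x1.
have sh c : 0 < x + c -> is_derive x (1:R) (fun y => gm m (y + c)) (gm m.+1 (x + c)).
  move=> xc; have d1 : is_derive x (1:R) (fun y : R => y + c) 1.
    by have := is_deriveD (is_derive_id x (1:R)) (is_derive_cst c x 1); rewrite addr0.
  by have := @is_derive1_comp R (gm m) (fun y => y + c) x _ _ (is_derive_gamma_moment m xc) d1; rewrite mulr1.
have d1 := sh 1 ltac:(lra); have d2 := sh 2 ltac:(lra).
by rewrite /Ups; apply: is_derive_eq.
Qed.

Lemma continuous_Ups r m x : - 1 < x -> {for x, continuous (Ups r m)}.
Proof.
move=> x1; apply/differentiable_continuous/derivable1_diffP.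
by have [] := is_derive_Ups r m x1.
Qed.

Lemma derive1_Upsilon r x : - 1 < x -> derive1 (Upsilon r) x = Ups r 1 x.
Proof.
by move=> x1; rewrite UpsilonE derive1E; have [] := is_derive_Ups r 0 x1.
Qed.

Lemma derive1n2_Upsilon r x : - 1 < x -> derive1n 2 (Upsilon r) x = Ups r 2 x.
Proof.
move=> x1; rewrite derive1nS derive1n1 derive1E.
have [_ <-] := is_derive_Ups r 1 x1.
apply: near_eq_derive; near=> y; apply: derive1_Upsilon.
by near: y; exact: lt_nbhsr.
Unshelve. all: by end_near. Qed.

Lemma Ups_gt0 r x : 0 <= r <= 1 -> - 1 < x -> 0 < Ups r 0 x.
Proof.
move=> /andP[r0 r1] x1; rewrite /Ups.
have g1 : 0 < gm 0 (x + 1) by apply: Gamma_gt0; lra.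
have g2 : 0 < gm 0 (x + 2) by apply: Gamma_gt0; lra.
have [r_gt0|r_le0] := ltP 0 r.
  by apply: ltr_pwDl; [exact: mulr_gt0|apply: mulr_ge0; [rewrite subr_ge0|exact: ltW]].
have -> : r = 0 by lra.
by rewrite mul0r add0r subr0 mul1r.
Qed.

(** The mean square deviation of ln t from c under a gamma law. *)
Lemma gamma_quadratic_ge0 c x : 0 < x -> 0 <= gm 2 x - 2 * c * gm 1 x + c ^+ 2 * gm 0 x.
Proof.
move=> x0; have g0 := Gamma_gt0 x0.
rewrite (_ : _ + _ = gm 0 x * (trigamma x + (digamma x - c) ^+ 2)).
  by rewrite mulr_ge0 ?(ltW g0)// addr_ge0 ?sqr_ge0 ?trigamma_ge0.
by rewrite /trigamma /digamma; field; rewrite gt_eqF.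
Qed.

(** Cauchy-Schwarz for the mixture of two gamma integrals that defines
    Upsilon. *)
Lemma Ups_log_convex r x : 0 <= r <= 1 -> - 1 < x ->
  Ups r 1 x ^+ 2 <= Ups r 0 x * Ups r 2 x.
Proof.
move=> r01 x1; have U0 := Ups_gt0 r01 x1; move: r01 => /andP[r0 r1].
pose c := Ups r 1 x / Ups r 0 x.
have := @gamma_quadratic_ge0 c (x + 1) ltac:(lra).
have := @gamma_quadratic_ge0 c (x + 2) ltac:(lra).
move=> /(mulr_ge0 r0) h2 h1.
have r1' : 0 <= 1 - r by lra.
have {}h1 := mulr_ge0 r1' h1.
have h := addr_ge0 h2 h1.
have : 0 <= Ups r 0 x * (Ups r 2 x - 2 * c * Ups r 1 x + c ^+ 2 * Ups r 0 x).
  rewrite mulr_ge0 ?(ltW U0)//; apply: le_trans h _.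
  by rewrite le_eqVlt; apply/orP; left; apply/eqP; rewrite /Ups; ring.
rewrite (_ : _ * _ = Ups r 0 x * Ups r 2 x - Ups r 1 x ^+ 2); first by rewrite subr_ge0.
by rewrite /c; field; rewrite gt_eqF.
Qed.

Lemma Ups_logderiv_nondecreasing r x y : 0 <= r <= 1 -> - 1 < x -> x <= y ->
  Ups r 1 x / Ups r 0 x <= Ups r 1 y / Ups r 0 y.
Proof.
move=> r01 x1 xy.
pose df t := (Ups r 0 t * Ups r 2 t - Ups r 1 t ^+ 2) / Ups r 0 t ^+ 2.
have tN1 t : x <= t <= y -> -1 < t by move=> /andP[+ _]; exact: lt_le_trans.
apply: (@is_derive_le R (fun t => Ups r 1 t / Ups r 0 t) df) => // t /tN1 t1.
  have U0 : Ups r 0 t != 0 by rewrite gt_eqF// Ups_gt0.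
  have d0 := is_derive_Ups r 0 t1; have d1 := is_derive_Ups r 1 t1.
  by apply: is_derive_eq; rewrite /df /GRing.scale/=; field.
by rewrite /df divr_ge0 ?exprn_ge0 ?(ltW (Ups_gt0 _ _))// subr_ge0 Ups_log_convex.
Qed.

Lemma PiE r y : 0 < y ->
  Pi r y = y^-1 - Ups r 1 y / Ups r 0 y + r / 2 - euler_gamma.
Proof. by move=> y0; rewrite /Pi derive1_Upsilon ?UpsilonE//; lra. Qed.

Lemma Pi_steep r : 0 <= r <= 1 -> recip_steep (Pi r).
Proof.
move=> r01 x y x0 xy; rewrite !PiE//; last exact: lt_le_trans xy.
have := @Ups_logderiv_nondecreasing r x y r01 (gtN1 x0) xy.
by move: (_ / _) (_ / _) => a b; lra.
Qed.

Lemma continuous_Pi r t : 0 <= r <= 1 -> 0 < t -> {for t, continuous (Pi r)}.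
Proof.
move=> r01 t0; have tm1 := gtN1 t0.
have U0 : Ups r 0 t != 0 by rewrite gt_eqF// Ups_gt0.
have tn0 : t != 0 by rewrite gt_eqF.
have c0 := @continuous_Ups r 0 t tm1; have c1 := @continuous_Ups r 1 t tm1.
rewrite /prop_for /continuous_at PiE//.
have E : {near t, (fun y => y^-1 - Ups r 1 y / Ups r 0 y + r / 2 - euler_gamma) =1 Pi r}.
  by near=> y; rewrite PiE//; near: y; exact: lt_nbhsr.
apply: cvg_trans (near_eq_cvg E) _.
apply: cvgB; last exact: cvg_cst.
apply: cvgD; last exact: cvg_cst.
apply: cvgB; first by apply: cvgV => //; exact: cvg_id.
by apply: cvgM; [exact: c1|apply: cvgV => //; exact: c0].
Unshelve. all: by end_near. Qed.

Lemma gamma_moment_values : [/\ gm 0 2 = 1, gm 0 3 = 2,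
  gm 1 1 = - euler_gamma, gm 1 2 = 1 - euler_gamma & gm 1 3 = 3 - 2 * euler_gamma].
Proof.
have e2 : 2 = 1 + 1 :> R by ring.
have e3 : 3 = 2 + 1 :> R by ring.
have g11 : gm 1 1 = - euler_gamma.
  by have := @digamma1 R; rewrite /digamma Gamma1 divr1.
have g02 : gm 0 2 = 1 by rewrite e2 GammaD1// Gamma1 mulr1.
have g12 : gm 1 2 = 1 - euler_gamma.
  by rewrite e2 gamma_moment_rec//= g11 Gamma1; ring.
split=> //; first by rewrite e3 GammaD1// g02 mulr1.
by rewrite e3 gamma_moment_rec//= g12 g02; ring.
Qed.

(** The sign of this value places the zero of Pi in ]0, 1]. *)
Lemma Pi1E r : 0 <= r <= 1 -> Pi r 1 = - (r * (1 - r) / (2 * (1 + r))).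
Proof.
move=> /andP[r0 r1]; rewrite PiE// /Ups.
have -> : 1 + 2 = 3 :> R by ring.
have -> : 1 + 1 = 2 :> R by ring.
have [-> -> _ -> ->] := gamma_moment_values.
have h : 1 + r != 0 by rewrite gt_eqF// ltr_wpDr.
rewrite (_ : r * 2 + (1 - r) * 1 = 1 + r); last by ring.
by field.
Qed.

Lemma varpi_spec r : 0 <= r <= 1 -> 0 < varpi r <= 1 /\ Pi r (varpi r) = 0.
Proof.
move=> r01.
have P1 : Pi r 1 <= 0.
  rewrite Pi1E// oppr_le0; case/andP: r01 => r0 r1.
  by rewrite divr_ge0 ?mulr_ge0 ?subr_ge0// addr_ge0.
have cP x := @continuous_Pi r x r01.
have [z /andP[z0 z1] Pz] := recip_steep_zero (Pi_steep r01) ltr01 P1 cP.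
have [v0 Pv] : [set y | 0 < y /\ Pi r y = 0] (varpi r) by apply: getPex; exists z.
by split=> //; rewrite v0/= -(recip_steep_le_zero (Pi_steep r01) v0 Pv).
Qed.

Lemma varpi_gt0 r : 0 <= r <= 1 -> 0 < varpi r.
Proof. by move=> /varpi_spec[/andP[]]. Qed.

Lemma varpi_le1 r : 0 <= r <= 1 -> varpi r <= 1.
Proof. by move=> /varpi_spec[/andP[]]. Qed.

Lemma Pi_varpi r : 0 <= r <= 1 -> Pi r (varpi r) = 0.
Proof. by move=> /varpi_spec[]. Qed.

Lemma varpi_inv_dist r y : 0 <= r <= 1 -> 0 < y ->
  `|(varpi r)^-1 - y^-1| <= `|Pi r y|.
Proof.
move=> r01; apply: recip_steep_dist; [exact: Pi_steep|exact: varpi_gt0|exact: Pi_varpi].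
Qed.

Lemma varpi1 : varpi 1 = 1 :> R.
Proof.
have r01 : 0 <= (1 : R) <= 1 by rewrite ler01 lexx.
have := varpi_inv_dist r01 ltr01.
rewrite Pi1E// subrr mulr0 mul0r oppr0 normr0 normr_le0 invr1 subr_eq0 => /eqP h.
by rewrite -[LHS]invrK h invr1.
Qed.

Lemma Pi_lipschitz y : 0 < y ->
  exists L, forall r s, 0 <= r <= 1 -> 0 <= s <= 1 ->
    `|Pi r y - Pi s y| <= L * `|r - s|.
Proof.
move=> y0.
have ym1 := gtN1 y0.
set a0 := gm 0 (y + 1); set d0 := gm 0 (y + 2).
set a1 := gm 1 (y + 1); set d1 := gm 1 (y + 2).
have a0_gt0 : 0 < a0 by apply: Gamma_gt0; lra.
have d0_gt0 : 0 < d0 by apply: Gamma_gt0; lra.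
pose m := Num.min a0 d0.
have m0 : 0 < m by rewrite lt_min a0_gt0.
have Um r : 0 <= r <= 1 -> m <= Ups r 0 y.
  move=> /andP[r0 r1]; rewrite /Ups -/a0 -/d0.
  have h1 : m <= a0 by rewrite ge_min lexx.
  have h2 : m <= d0 by rewrite ge_min lexx orbT.
  by nra.
exists (`|d1 * a0 - a1 * d0| / m ^+ 2 + 1 / 2) => r s r01 s01.
have Ur := Um _ r01; have Us := Um _ s01.
have Ur0 : 0 < Ups r 0 y by exact: lt_le_trans Ur.
have Us0 : 0 < Ups s 0 y by exact: lt_le_trans Us.
have -> : Pi r y - Pi s y = (r - s) * ((a1 * d0 - d1 * a0) / (Ups r 0 y * Ups s 0 y) + 1 / 2).
  rewrite !PiE//; move: (Ur0) (Us0); rewrite /Ups -/a0 -/d0 -/a1 -/d1 => h1 h2.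
  by field; rewrite !gt_eqF.
rewrite normrM mulrC ler_wpM2r//.
rewrite (le_trans (ler_normD _ _))// (@ger0_norm _ (1 / 2)) ?divr_ge0// lerD2r.
rewrite normrM distrC ler_wpM2l// ger0_norm ?invr_ge0 ?mulr_ge0 ?(ltW Ur0) ?(ltW Us0)//.
rewrite lef_pV2 ?posrE ?exprn_gt0 ?mulr_gt0// expr2.
by apply: ler_pM => //; exact: ltW.
Qed.

Lemma gamma_moment_lipschitz m : exists2 C, 0 <= C &
  forall x y, 1 <= x <= 3 -> 1 <= y <= 3 -> `|gm m x - gm m y| <= C * `|x - y|.
Proof.
have c13 : {within `[1, 3], continuous (fun x : R => `|gm m.+1 x|)}.
  apply: continuous_in_subspaceT => t; rewrite inE/= in_itv/= => /andP[t1 _].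
  have t0 : 0 < t by lra.
  apply: continuous_comp; last exact: norm_continuous.
  apply/differentiable_continuous/derivable1_diffP.
  by have [] := is_derive_gamma_moment m.+1 t0.
have [c _ cmax] := @EVT_max R _ 1 3 ltac:(lra) c13.
exists `|gm m.+1 c| => // x y /andP[x1 x3] /andP[y1 y3].
have between z : (x <= z <= y) || (y <= z <= x) -> 1 <= z <= 3.
  by move=> /orP[|] /andP[h1 h2]; apply/andP; split; lra.
have [t /between /andP[t1 _]|z [/between zI _ ->]] := @is_derive_mvt R (gm m) (gm m.+1) x y.
  by apply: is_derive_gamma_moment; lra.
by rewrite normrM ler_wpM2r//; apply: cmax; rewrite in_itv.
Qed.

(** By this lemma and the next, an error o(1/v) in the estimate of rho(0)
    changes the bias correction only by o(1/v). *)
Lemma varpi_lipschitz s : 0 <= s <= 1 -> exists2 L, 0 <= L &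
  forall r, 0 <= r <= 1 -> `|(varpi r)^-1 - (varpi s)^-1| <= L * `|r - s|.
Proof.
move=> s01; have [L HL] := Pi_lipschitz (varpi_gt0 s01).
exists `|L| => // r r01.
apply: le_trans (varpi_inv_dist r01 (varpi_gt0 s01)) _.
have := HL r s r01 s01; rewrite (Pi_varpi s01) subr0 => /le_trans; apply.
by rewrite ler_wpM2r// ler_norm.
Qed.

Lemma Ups_varpi_lipschitz s : 0 <= s <= 1 -> exists2 L, 0 <= L &
  forall r, 0 <= r <= 1 -> `|Ups r 0 (varpi r) - Ups s 0 (varpi s)| <= L * `|r - s|.
Proof.
move=> s01; have [L L0 HL] := varpi_lipschitz s01.
have [C C0 HC] := gamma_moment_lipschitz 0.
have vs0 := varpi_gt0 s01; have vs1 := varpi_le1 s01.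
exists (C + C * L) => [|r r01]; first by rewrite addr_ge0 ?mulr_ge0.
have vr0 := varpi_gt0 r01; have vr1 := varpi_le1 r01.
set x := varpi r in vr0 vr1 *; set y := varpi s in vs0 vs1 HL *.
have xy : `|x - y| <= L * `|r - s|.
  apply: le_trans (HL r r01); rewrite -/x.
  have -> : x - y = - (x^-1 - y^-1) * (x * y) by field; rewrite !gt_eqF.
  rewrite normrM normrN ler_piMr// ger0_norm ?mulr_ge0 ?(ltW vr0) ?(ltW vs0)//.
  by rewrite mulr_ile1// ltW.
have b1 : `|gm 0 (x + 2) - gm 0 (x + 1)| <= C.
  have := HC (x + 2) (x + 1); rewrite (_ : x + 2 - (x + 1) = 1); last by ring.
  by rewrite normr1 mulr1; apply; apply/andP; split; lra.
have b2 : `|gm 0 (x + 2) - gm 0 (y + 2)| <= C * `|x - y|.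
  have := HC (x + 2) (y + 2); rewrite (_ : x + 2 - (y + 2) = x - y); last by ring.
  by apply; apply/andP; split; lra.
have b3 : `|gm 0 (x + 1) - gm 0 (y + 1)| <= C * `|x - y|.
  have := HC (x + 1) (y + 1); rewrite (_ : x + 1 - (y + 1) = x - y); last by ring.
  by apply; apply/andP; split; lra.
have -> : Ups r 0 x - Ups s 0 y = (r - s) * (gm 0 (x + 2) - gm 0 (x + 1)) +
    (s * (gm 0 (x + 2) - gm 0 (y + 2)) + (1 - s) * (gm 0 (x + 1) - gm 0 (y + 1))).
  by rewrite /Ups; ring.
case/andP: s01 => s0 s1; have s1' : 0 <= 1 - s by rewrite subr_ge0.
rewrite (le_trans (ler_normD _ _))// [leRHS]mulrDl; apply: lerD.
  by rewrite normrM mulrC ler_wpM2r.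
rewrite (@le_trans _ _ (C * `|x - y|))//; last by rewrite -mulrA ler_wpM2l.
rewrite (le_trans (ler_normD _ _))// !normrM (ger0_norm s0) (ger0_norm s1').
rewrite [leRHS](_ : _ = s * (C * `|x - y|) + (1 - s) * (C * `|x - y|)); last by ring.
by apply: lerD; apply: ler_wpM2l.
Qed.

End varpi_theory.

(** * Laws given by a density *)

Section density_measure.
Context d (T : measurableType d) (R : realType) (mu : {measure set T -> \bar R}).
Variables (h : T -> R).

Definition density_measure of (forall t, 0 <= h t) & measurable_fun setT h :=
  fun A : set T => (\int[mu]_(t in A) (h t)%:E)%E.

Hypotheses (h0 : forall t, 0 <= h t) (mh : measurable_fun setT h).
Notation dm := (density_measure h0 mh).

Let density0 : dm set0 = 0%E.
Proof. exact: integral_set0. Qed.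

Let density_ge0 A : (0 <= dm A)%E.
Proof. by apply: integral_ge0 => t _; rewrite lee_fin. Qed.

Let density_sigma_additive : semi_sigma_additive dm.
Proof.
move=> F mF tF mUF; rewrite /density_measure; apply: cvg_toP.
  apply: ereal_nondecreasing_is_cvgn => m n mn.
  by apply: lee_sum_nneg_natr => // k _ _; apply: integral_ge0 => t _; rewrite lee_fin.
rewrite ge0_integral_bigcup//=.
- by apply/measurable_funTS/measurable_EFinP.
- by move=> t _; rewrite lee_fin.
Qed.

HB.instance Definition _ := isMeasure.Build _ _ _ dm
  density0 density_ge0 density_sigma_additive.

End density_measure.

Section law_with_density.
Context (R : realType).
Notation mu := (@lebesgue_measure R).
Variables (nu : probability (measurableTypeR R) R) (h : R -> R).
Hypotheses (h0 : forall t, 0 <= h t) (mh : measurable_fun setT h).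
Hypothesis tail : forall t : R, nu `[t, +oo[%classic = (\int[mu]_(s in `[t, +oo[) (h s)%:E)%E.

(** The half-lines [t, +oo[ are stable under intersection and generate the
    Borel sets. *)
Lemma law_density (A : set (measurableTypeR R)) : measurable A ->
  nu A = (\int[mu]_(s in A) (h s)%:E)%E.
Proof.
move=> mA.
pose g n : set R := `[- n%:R, +oo[%classic.
have mg n : measurable (g n) by exact: measurable_itv.
have setIG : setI_closed (@RGenCInfty.G R).
  move=> _ _ [x ->] [y ->]; exists (Num.max x y).
  apply/seteqP; split=> z /=; rewrite !in_itv/= !andbT ge_max.
    by move=> [-> ->].
  by move=> /andP[].
have Gg n : RGenCInfty.G (g n) by exists (- n%:R).
have g_cover : \bigcup_n g n = setT.
  apply/seteqP; split=> // x _; exists (Num.truncn `|x|).+1 => //=.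
  rewrite /g /= in_itv/= andbT lerNl.
  by rewrite (le_trans (ler_norm _))// normrN ltW// truncnS_gt.
have eqG B : RGenCInfty.G B -> nu B = density_measure mu h0 mh B.
  by move=> [x ->]; exact: tail.
have fin n : (nu (g n) < +oo)%E by exact: le_lt_trans (probability_le1 nu (mg n)) (ltry 1).
rewrite -[RHS]/(density_measure mu h0 mh A).
exact: (@measure_unique _ R (measurableTypeR R) (@RGenCInfty.G R) g
  (@RGenCInfty.measurableE R) setIG Gg g_cover nu (density_measure mu h0 mh) eqG fin A mA).
Qed.

Let fin : mu.-integrable setT (EFin \o h).
Proof.
apply/integrableP; split; first exact/measurable_EFinP.
rewrite [X in (X < _)%E](_ : _ = nu setT); first by rewrite probability_setT ltry.
rewrite law_density//; apply: eq_integral => t _.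
by rewrite /= ger0_norm.
Qed.

Let nu_dom : nu `<< mu.
Proof.
apply/null_content_dominatesP => A mA A0; rewrite law_density//.
apply: (null_set_integral mA) => //.
by apply/measurable_EFinP; exact: measurable_funTS.
Qed.

(** h is the Radon-Nikodym derivative of nu. *)
Lemma ge0_integral_law_density (f : R -> \bar R) (E : set (measurableTypeR R)) :
  measurable E -> measurable_fun setT f -> (forall t, 0 <= f t)%E ->
  (\int[nu]_(t in E) f t = \int[mu]_(t in E) (f t * (h t)%:E))%E.
Proof.
move=> mE mf f0.
have mfE : measurable_fun E f by exact: measurable_funTS.
rewrite -(Radon_Nikodym_SigmaFinite.change_of_variables nu_dom f0 mE mfE).
have ae : ae_eq mu E (Radon_Nikodym_SigmaFinite.f nu mu) (EFin \o h).
  have : ae_eq mu setT (Radon_Nikodym_SigmaFinite.f nu mu) (EFin \o h).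
    apply: integral_ae_eq => //.
    - exact: Radon_Nikodym_SigmaFinite.f_integrable.
    - exact: measurable_int fin.
    - move=> B _ mB; rewrite -Radon_Nikodym_SigmaFinite.f_integral//.
      exact: law_density.
  by apply: ae_eq_subset.
apply: ge0_ae_eq_integral => //.
- apply: emeasurable_funM => //; apply: measurable_funTS.
  exact: measurable_int (Radon_Nikodym_SigmaFinite.f_integrable nu_dom).
- by apply: emeasurable_funM => //; apply: measurable_funTS; exact: measurable_int fin.
- by move=> t _; rewrite mule_ge0// Radon_Nikodym_SigmaFinite.f_ge0.
- by move=> t _; rewrite mule_ge0// lee_fin.
- exact: ae_eqe_mul2l.
Qed.

Lemma integral_law_density (f : R -> R) (E : set (measurableTypeR R)) :
  measurable E -> measurable_fun setT f ->
  (\int[nu]_(t in E) (f t)%:E = \int[mu]_(t in E) (f t * h t)%:E)%E.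
Proof.
move=> mE mf.
have mf' : measurable_fun setT (EFin \o f) by exact/measurable_EFinP.
rewrite integralE [RHS]integralE !ge0_integral_law_density//.
- congr (_ - _)%E; apply: eq_integral => t _.
  + rewrite !funeposE -!EFin_max -EFinM; congr EFin.
    by rewrite maxr_pMl// mul0r.
  + rewrite !funenegE -!EFinN -!EFin_max -EFinM; congr EFin.
    by rewrite maxr_pMl// mul0r mulNr.
- exact: measurable_funeneg.
- exact: measurable_funepos.
Qed.

End law_with_density.

(** * Mixtures of gamma laws *)

(** The law on the positive half-line with survival function (1 + r t) exp(-t):
    the mixture of the gamma laws of shapes 2 and 1 with weights r and 1 - r. *)
Section gamma_mixture.
Context {R : realType} d (T : measurableType d) (P : probability T R).
Notation mu := (@lebesgue_measure R).
Variables (Z : T -> R) (r : R).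
Hypotheses (mZ : measurable_fun setT Z) (r01 : 0 <= r <= 1).
Hypothesis Ztail : forall t : R, 0 < t ->
  P (Z @^-1` `[t, +oo[) = ((1 + r * t) * expR (- t))%:E.

Let h0 (t : R) : R := (1 - r + r * t) * expR (- t).
Let h : R -> R := h0 \_ halfline.
Let S (t : R) : R := - ((1 + r * t) * expR (- t)).

Let h0_ge0 t : 0 < t -> 0 <= h0 t.
Proof.
move=> t0; case/andP: r01 => r0 r1; rewrite mulr_ge0 ?expR_ge0// addr_ge0 ?subr_ge0//.
by rewrite mulr_ge0// ltW.
Qed.

Let h_ge0 t : 0 <= h t.
Proof.
rewrite /h patchE; case: ifPn => //; rewrite inE => /halflineE; exact: h0_ge0.
Qed.

Let hE t : 0 < t -> h t = h0 t.
Proof. by move=> t0; rewrite /h patchE mem_set//; exact/halflineE. Qed.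

Let dS (t : R) : is_derive t (1:R) S (h0 t).
Proof. by rewrite /S; apply: is_derive_eq; rewrite /h0 /GRing.scale/=; ring. Qed.

Let ch0 : continuous h0.
Proof.
move=> t; apply/differentiable_continuous/derivable1_diffP.
by rewrite /h0; apply: ex_derive.
Qed.

Let mh : measurable_fun setT h.
Proof.
apply/(measurable_restrictT _ (@measurable_halfline R)); apply: measurable_funTS.
exact: continuous_measurable_fun.
Qed.

Let S0 : S t @[t --> 0^'+] --> (-1 : R).
Proof.
apply: cvg_at_right_filter.
have : S t @[t --> (0:R)] --> S 0.
  apply/differentiable_continuous/derivable1_diffP; by have [] := dS 0.
by rewrite {2}/S mulr0 addr0 oppr0 expR0 mulr1.
Qed.

Let Soo : S t @[t --> +oo] --> (0 : R).
Proof.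
have e1 : (fun t : R => t `^ 0 * expR (- t)) @ +oo --> (0:R) by exact: cvg_powR_expRN_pinfty.
have e2 : (fun t : R => t `^ 1 * expR (- t)) @ +oo --> (0:R) by apply: cvg_powR_expRN_pinfty.
have : - (t `^ 0 * expR (- t) + r * (t `^ 1 * expR (- t))) @[t --> +oo] --> - (0 + r * 0).
  by apply: cvgN; apply: cvgD => //; apply: cvgM => //; exact: cvg_cst.
rewrite mulr0 addr0 oppr0; apply: cvg_trans; apply: near_eq_cvg.
near=> t; rewrite powRr0 powRr1; first by rewrite /S; ring.
by near: t; exact: nbhs_pinfty_ge.
Unshelve. all: by end_near. Qed.

Let Z_mixin := isMeasurableFun.Build _ _ T (measurableTypeR R) Z mZ.
Let Z_pack := MeasurableFun.Pack (MeasurableFun.Class Z_mixin).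
Let nu : probability (measurableTypeR R) R := distribution P Z_pack.

Let tail_gt0 (t : R) : 0 < t ->
  nu `[t, +oo[%classic = (\int[mu]_(s in `[t, +oo[) (h s)%:E)%E.
Proof.
move=> t0; have -> : nu `[t, +oo[%classic = ((1 + r * t) * expR (- t))%:E by exact: Ztail.
have cS : continuous S.
  by move=> s; apply/differentiable_continuous/derivable1_diffP; have [] := dS s.
have hE' : {in `[t, +oo[%classic, h =1 h0}.
  move=> s; rewrite inE/= in_itv/= andbT => ts; exact: hE (lt_le_trans t0 ts).
have -> : (\int[mu]_(s in `[t, +oo[) (h s)%:E = \int[mu]_(s in `[t, +oo[) (h0 s)%:E)%E.
  by apply: eq_integral => s st; rewrite hE'.
rewrite (@ge0_continuous_FTC2y _ _ S t 0) //.
- by rewrite -EFinB sub0r opprK.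
- by move=> s ts; apply: h0_ge0; exact: lt_le_trans ts.
- by apply: continuous_subspaceT; exact: ch0.
- by apply: cvg_at_right_filter; exact: cS.
- by move=> s _; rewrite derive1E; have [] := dS s.
Qed.

Let tail_le0 (t : R) : t <= 0 ->
  nu `[t, +oo[%classic = (\int[mu]_(s in `[t, +oo[) (h s)%:E)%E.
Proof.
move=> t0.
(* For t <= 0 both sides equal 1; on the left, the tails at s > 0 increase to
    1 as s tends to 0. *)
have -> : (\int[mu]_(s in `[t, +oo[) (h s)%:E = 1)%E.
  rewrite (_ : (fun s => _) = (EFin \o h0) \_ halfline); last first.
    by apply/funext => s; rewrite /h restrict_EFin.
  rewrite -integral_mkcondr setIidr; last first.
    by move=> s /halflineE s0; rewrite /= in_itv/= andbT (le_trans t0)// ltW.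
  have -> : 1%E = (0 - -1)%:E :> \bar R by rewrite sub0r opprK.
  apply: (@ge0_FTC_halfline R h0 S (-1) 0) => //.
  - by move=> s s0; exact: ch0.
have nut (s : R) : 0 < s -> nu `[s, +oo[%classic = ((1 + r * s) * expR (- s))%:E.
  by move=> s0; exact: Ztail.
have mt : measurable (`[t, +oo[%classic : set (measurableTypeR R)) by exact: measurable_itv.
apply/eqP; rewrite eq_le; apply/andP; split; first exact: probability_le1.
have le1 (e : R) : 0 < e -> (((1 + r * e) * expR (- e))%:E <= nu `[t, +oo[%classic)%E.
  move=> e0; rewrite -nut//; apply: le_measure; rewrite ?inE//.
  by move=> s; rewrite /= !in_itv/= !andbT; apply: le_trans; rewrite (le_trans t0)// ltW.
have fnu : nu `[t, +oo[%classic \is a fin_num.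
  exact: fin_num_measure.
rewrite -(fineK fnu) lee_fin.
have h1 : - S e @[e --> 0^'+] --> (1:R) by rewrite -[X in _ --> X]opprK; apply: cvgN.
rewrite -(cvg_lim (@norm_hausdorff _ _) h1); apply: limr_le; first exact: cvgP h1.
near=> e; have e0 : 0 < e by near: e; exact: nbhs_right_gt.
by have := le1 e e0; rewrite -[in X in (_ <= X)%E -> _](fineK fnu) lee_fin /S opprK.
Unshelve. all: by end_near. Qed.

Let tail (t : R) : nu `[t, +oo[%classic = (\int[mu]_(s in `[t, +oo[) (h s)%:E)%E.
Proof. by have [/tail_le0|/tail_gt0] := leP t 0. Qed.

Lemma gamma_mixture_integral (g : R -> R) : measurable_fun setT g ->
  (\int[P]_(x in Z @^-1` halfline) (g (Z x))%:E =
   \int[mu]_(t in halfline) (g t * ((1 - r + r * t) * expR (- t)))%:E)%E.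
Proof.
move=> mg; transitivity (\int[nu]_(t in halfline) (g t)%:E)%E; last first.
  rewrite (integral_law_density h_ge0 mh tail (@measurable_halfline R) mg).
  by apply: eq_integral => t; rewrite inE => /halflineE t0; rewrite hE.
have mge : measurable_fun setT (EFin \o g) by exact/measurable_EFinP.
have pf (F : measurableTypeR R -> \bar R) : measurable_fun setT F -> (forall t, 0 <= F t)%E ->
    (\int[P]_(x in Z @^-1` halfline) (F \o Z) x = \int[nu]_(t in halfline) F t)%E.
  move=> mF F0; apply/esym.
  have mZ' : @measurable_fun _ _ T (measurableTypeR R) setT Z := mZ.
  have mFh : measurable_fun halfline F by exact: measurable_funTS.
  have F0h : {in halfline, forall y, (0 <= F y)%E} by move=> y _; exact: F0.
  exact: (ge0_integral_pushforward mZ' P (@measurable_halfline R) mFh F0h).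
rewrite integralE [RHS]integralE; congr (_ - _)%E.
- rewrite -pf//; last exact: measurable_funepos.
  by apply: eq_integral => x _; rewrite /= !funeposE.
- rewrite -pf//; last exact: measurable_funeneg.
  by apply: eq_integral => x _; rewrite /= !funenegE.
Qed.

Lemma gamma_mixture_moment (c : R) m a : - 1 < a ->
  (\int[P]_(x in Z @^-1` halfline) (c * (Z x `^ a * ln (Z x) ^+ m))%:E = (c * Ups r m a)%:E)%E.
Proof.
move=> a1.
have mg : measurable_fun setT (fun t : R => c * (t `^ a * ln t ^+ m)).
  apply: measurable_funM => //; apply: measurable_funM; first exact: measurable_powR.
  by apply: measurable_funX; exact: measurable_ln.
rewrite (gamma_mixture_integral mg).
have a1' : 0 < a + 1 by rewrite -ltrBlDr sub0r.
have a2' : 0 < a + 2 by rewrite (lt_trans a1')// ltrD2l ltr1n.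
have [ig Eg] := @gamma_comb_integral R [:: (c * r, a + 2, m); (c * (1 - r), a + 1, m)]
  ltac:(by rewrite /= a1' a2').
rewrite (_ : c * _ = \int[mu]_(t in halfline)
    gamma_comb [:: (c * r, a + 2, m); (c * (1 - r), a + 1, m)] t); last first.
  by rewrite Eg !big_cons big_nil addr0 /Ups mulrDr !mulrA.
rewrite /Rintegral fineK; last first.
  by apply: integrable_fin_num ig; exact: measurable_halfline.
apply: eq_integral => t; rewrite inE => /halflineE t0; congr EFin.
rewrite /gamma_comb !big_cons big_nil addr0 /gamma_density/=.
rewrite (_ : a + 2 - 1 = a + 1); last by ring.
by rewrite addrK gt0_powRD// powRr1 ?ltW//; ring.
Qed.

End gamma_mixture.

(** * Concave functions of the class C *)

Section pickands.
Context {R : realType}.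
Variable rho : R -> R.
Hypothesis rhoC : pickands_class rho.

Lemma pickands0 : 0 <= rho 0 <= 1.
Proof.
by have [/(_ 0) + _ _] := rhoC; rewrite subr0 in_itv/= lexx ler01; apply.
Qed.

(** The chord of rho between 0 and 1 lies below rho, and rho 1 >= 0. *)
Lemma pickands_chord eta : 0 <= eta <= 1 -> (1 - eta) * rho 0 <= rho eta <= rho 0.
Proof.
move=> /[dup] eta01 /andP[eta0 eta1]; have [bnd dec cvx] := rhoC.
have i0 : (0 : R) \in `[0, 1] by rewrite in_itv/= lexx ler01.
have i1 : (1 : R) \in `[0, 1] by rewrite in_itv/= lexx ler01.
have ie : eta \in `[0, 1] by rewrite in_itv.
apply/andP; split; last exact: dec.
have r1 : 0 <= rho 1 by have /andP[] := bnd _ i1.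
have h : - rho (eta * 1 + (1 - eta) * 0) <= eta * (- rho 1) + (1 - eta) * (- rho 0).
  by apply: (cvx (Itv01 eta0 eta1) 1 0); rewrite inE/= in_itv/= lexx ler01.
move: h; rewrite mulr1 mulr0 addr0 !mulrN -opprD lerN2; apply: le_trans.
by rewrite lerDr mulr_ge0.
Qed.

(** Concavity excludes a jump at 0, where the second marginal of H is read
    off. *)
Lemma pickands_right_continuous : rho eta @[eta --> 0^'+] --> rho 0.
Proof.
apply: (squeeze_cvgr (f := fun eta => (1 - eta) * rho 0) (h := fun=> rho 0)).
- near=> eta; apply: pickands_chord.
  apply/andP; split; first by rewrite ltW//; near: eta; exact: nbhs_right_gt.
  by near: eta; apply: nbhs_right_le; exact: ltr01.
- rewrite -[X in _ --> X]mul1r; apply: cvgM; last exact: cvg_cst.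
  rewrite -[X in _ --> X]subr0; apply: cvgB; first exact: cvg_cst.
  by apply: cvg_at_right_filter; exact: cvg_id.
- exact: cvg_cst.
Unshelve. all: by end_near. Qed.

Lemma pickands_eq1 : rho 0 = 1 <->
  (forall eta, eta \in `[0, 1] -> rho eta = rho_ind eta).
Proof.
split=> [r1 eta|->]; [|by rewrite /rho_ind subr0|by rewrite in_itv/= lexx ler01].
rewrite in_itv/= => eta01; apply/eqP; rewrite eq_le /rho_ind.
have [/(_ eta) + _ _] := rhoC; rewrite in_itv/= => /(_ eta01)/andP[_ ->].
by have /andP[] := pickands_chord eta01; rewrite r1 mulr1.
Qed.

End pickands.

(** * Moments of the Frechet-Welsch law *)

Section welsch_moments.
Context {R : realType}.
Variables (rho : R -> R) (alpha : R) (H : probability (R * R)%type R).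
Hypotheses (rhoC : pickands_class rho) (alpha0 : 0 < alpha)
  (HE : is_welsch rho alpha 1 H).

Let Hcdf x y : 0 < x -> 0 < y ->
  H (`]-oo, x] `*` `]-oo, y]) = (welsch_cdf rho alpha 1 x y)%:E.
Proof. by have [_] := HE; apply. Qed.

Lemma measurable_quadrant : measurable (@quadrant R).
Proof.
have -> : @quadrant R = halfline `*` halfline.
  by apply/seteqP; split=> p [/= h1 h2]; split=> /=; apply/halflineE.
by apply: measurableX; exact: measurable_halfline.
Qed.

Let H_quadrantI (A : set (R * R)) : measurable A -> H (quadrant `&` A) = H A.
Proof.
move=> mA; have mq := measurable_quadrant; have [Hq _] := HE.
have Hq0 : H (~` quadrant) = 0%E.
  by rewrite probability_setC// Hq subee.
have mqA : measurable (quadrant `&` A) by exact: measurableI.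
have mqA' : measurable (~` quadrant `&` A) by apply: measurableI => //; exact: measurableC.
have AE : A = (quadrant `&` A) `|` (~` quadrant `&` A) by rewrite -setIUl setUv setTI.
rewrite [in RHS]AE measureU//; last first.
  by rewrite setIACA setICr set0I.
rewrite [X in _ = (_ + X)%E](_ : _ = 0%E) ?adde0//.
apply/eqP; rewrite eq_le measure_ge0 andbT -Hq0.
by apply: le_measure; [exact/mem_set|exact/mem_set/measurableC|exact: subIsetl].
Qed.

Let mrect (x y : itv_bound R) (b c : itv_bound R) :
  measurable ([set` Interval x y] `*` [set` Interval b c] : set (R * R)).
Proof. by apply: measurableX; exact: measurable_itv. Qed.

Lemma welsch_marginal1 x : 0 < x ->
  H (`]-oo, x] `*` setT) = (expR (- (x `^ (- alpha))))%:E.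
Proof.
move=> x0.
pose F n : set (R * R) := `]-oo, x] `*` `]-oo, n.+1%:R].
have mF n : measurable (F n) by exact: mrect.
have UF : \bigcup_n F n = `]-oo, x] `*` setT.
  apply/seteqP; split=> [p [n _ []]//|p [/= px _]].
  exists (Num.truncn `|p.2|) => //; split=> //=.
  by rewrite in_itv/= (le_trans (ler_norm _))// ltW// truncnS_gt.
have ndF : nondecreasing_seq F.
  move=> m n mn; apply/subsetPset => p [/= p1 p2]; split=> //=.
  move: p2; rewrite !in_itv/= => /le_trans; apply.
  by rewrite ler_nat ltnS.
have mU : measurable (\bigcup_n F n) by exact: bigcupT_measurable.
have := nondecreasing_cvg_mu (mu := H) mF mU ndF; rewrite UF => /cvg_unique; apply => //.
apply: cvg_near_cst; near=> n.
have xn : x <= n.+1%:R.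
  by rewrite (@le_trans _ _ n%:R) ?ler_nat//; near: n; exact: nbhs_infty_ger.
by rewrite /F /= Hcdf// /welsch_cdf xn divr1.
Unshelve. all: by end_near. Qed.

(** As x grows, y/x tends to 0 and rho enters only through its value at 0. *)
Lemma welsch_marginal2 y : 0 < y ->
  H (setT `*` `]-oo, y]) = ((1 + rho 0 * y `^ (- alpha)) * expR (- (y `^ (- alpha))))%:E.
Proof.
move=> y0.
pose F n : set (R * R) := `]-oo, n.+1%:R] `*` `]-oo, y].
have mF n : measurable (F n) by exact: mrect.
have UF : \bigcup_n F n = setT `*` `]-oo, y].
  apply/seteqP; split=> [p [n _ []]//|p [/= _ py]].
  exists (Num.truncn `|p.1|) => //; split=> //=.
  by rewrite in_itv/= (le_trans (ler_norm _))// ltW// truncnS_gt.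
have ndF : nondecreasing_seq F.
  move=> m n mn; apply/subsetPset => p [/= p1 p2]; split=> //=.
  move: p1; rewrite !in_itv/= => /le_trans; apply.
  by rewrite ler_nat ltnS.
have mU : measurable (\bigcup_n F n) by exact: bigcupT_measurable.
have := nondecreasing_cvg_mu (mu := H) mF mU ndF; rewrite UF => /cvg_unique; apply => //.
pose e n : R := (y / n.+1%:R) `^ alpha.
have e0 : e n @[n --> \oo] --> (0 : R).
  apply: ((cvg_at_rightP _ _ _).1 (powR_cvg0 alpha0)); split.
    by move=> n; rewrite divr_gt0.
  rewrite -[X in _ --> X](mulr0 y); apply: cvgM; first exact: cvg_cst.
  exact: cvg_harmonic.
have e_gt0 n : 0 < e n by rewrite powR_gt0 ?divr_gt0.
have re : rho (e n) @[n --> \oo] --> rho 0.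
  by apply: ((cvg_at_rightP _ _ _).1 (pickands_right_continuous rhoC)); split.
have yE : (y / 1) `^ (- alpha) = y `^ (- alpha) by rewrite divr1.
have lim : (expR (- y `^ (- alpha)) * (1 + rho (e n) * y `^ (- alpha)))%:E @[n --> \oo] -->
    ((1 + rho 0 * y `^ (- alpha)) * expR (- y `^ (- alpha)))%:E.
  apply: cvg_EFin; first exact: nearW.
  rewrite [X in _ --> X]mulrC; apply: cvgM; first exact: cvg_cst.
  by apply: cvgD; [exact: cvg_cst|apply: cvgM re _; exact: cvg_cst].
apply: cvg_trans lim; apply: near_eq_cvg; near=> n.
have yn : y < n.+1%:R.
  rewrite (@lt_le_trans _ _ n%:R) ?ler_nat//.
  by near: n; exact: nbhs_infty_gtr.
by rewrite /F /= Hcdf// /welsch_cdf leNgt yn /= yE.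
Unshelve. all: by end_near. Qed.

Let Y p := ((fun p : R * R => p.2 `^ (- alpha)) \_ quadrant) p.
Let X p := ((fun p : R * R => p.1 `^ (- alpha)) \_ quadrant) p.

Let powR_tail x t : 0 < x -> 0 < t -> (t <= x `^ (- alpha)) = (x <= t `^ (- alpha^-1)).
Proof.
move=> x0 t0.
have an0 : alpha != 0 by rewrite gt_eqF.
rewrite !powR_expln// -{1}(lnK (_ : t \in Num.pos))// -{2}(lnK (_ : x \in Num.pos))//.
rewrite !ler_expR !mulNr lerNr [in RHS]lerNr.
by rewrite ler_pdivrMl// mulrN lerNr.
Qed.

Let tailX t : 0 < t -> H (X @^-1` `[t, +oo[) = ((1 + 0 * t) * expR (- t))%:E.
Proof.
move=> t0; have y0 : 0 < t `^ (- alpha^-1) by rewrite powR_gt0.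
have -> : X @^-1` `[t, +oo[ = quadrant `&` (`]-oo, t `^ (- alpha^-1)] `*` setT).
  apply/seteqP; split=> p /=; rewrite /X patchE !in_itv/= andbT.
    case: ifPn => [|_]; last by rewrite leNgt t0.
    by rewrite inE => /[dup] pq [p1 p2]; rewrite powR_tail.
  by move=> [[p1 p2] [pt _]]; rewrite mem_set// powR_tail.
rewrite H_quadrantI; last by apply: measurableX => //; exact: measurable_itv.
rewrite welsch_marginal1// mul0r addr0 mul1r -powRrM mulrNN mulVf ?gt_eqF//.
by rewrite powRr1 ?ltW.
Qed.

Let tailY t : 0 < t -> H (Y @^-1` `[t, +oo[) = ((1 + rho 0 * t) * expR (- t))%:E.
Proof.
move=> t0; have y0 : 0 < t `^ (- alpha^-1) by rewrite powR_gt0.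
have -> : Y @^-1` `[t, +oo[ = quadrant `&` (setT `*` `]-oo, t `^ (- alpha^-1)]).
  apply/seteqP; split=> p /=; rewrite /Y patchE !in_itv/= andbT.
    case: ifPn => [|_]; last by rewrite leNgt t0.
    by rewrite inE => /[dup] pq [p1 p2]; rewrite powR_tail.
  by move=> [[p1 p2] [_ pt]]; rewrite mem_set// powR_tail.
rewrite H_quadrantI; last by apply: measurableX => //; exact: measurable_itv.
rewrite welsch_marginal2// -powRrM mulrNN mulVf ?gt_eqF//.
by rewrite powRr1 ?ltW.
Qed.

Let preX : X @^-1` halfline = quadrant.
Proof.
apply/seteqP; split=> p; rewrite /preimage/= halflineE /X patchE.
  by case: ifPn => [|_]; [rewrite inE|rewrite ltxx].
by move=> /[dup] [[p1 p2]] pq; rewrite mem_set// powR_gt0.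
Qed.

Let preY : Y @^-1` halfline = quadrant.
Proof.
apply/seteqP; split=> p; rewrite /preimage/= halflineE /Y patchE.
  by case: ifPn => [|_]; [rewrite inE|rewrite ltxx].
by move=> /[dup] [[p1 p2]] pq; rewrite mem_set// powR_gt0.
Qed.

Let mX : measurable_fun setT X.
Proof.
apply/(measurable_restrictT _ measurable_quadrant); apply: measurable_funTS.
by apply: (measurableT_comp (measurable_powR _)).
Qed.

Let mY : measurable_fun setT Y.
Proof.
apply/(measurable_restrictT _ measurable_quadrant); apply: measurable_funTS.
by apply: (measurableT_comp (measurable_powR _)).
Qed.

Let an0 : alpha != 0. Proof. by rewrite gt_eqF. Qed.

(** X^-alpha is standard exponential, the gamma mixture of weight 0. *)
Lemma welsch_moment1 : \int[H]_(p in quadrant) ln p.1 = euler_gamma / alpha.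
Proof.
have r01 : 0 <= (0 : R) <= 1 by rewrite lexx ler01.
have := gamma_mixture_moment mX r01 tailX (- alpha^-1) 1 (ltrN10 R : -1 < 0).
rewrite preX /Ups mul0r subr0 mul1r !add0r.
have [_ _ -> _ _] := @gamma_moment_values R.
rewrite mulrNN mulrC => h; rewrite /Rintegral -[RHS]/(fine (euler_gamma / alpha)%:E) -h.
congr fine; apply: eq_integral => p; rewrite inE => /[dup] pq [p1 p2]; congr EFin.
rewrite /X patchE mem_set// powRr0 mul1r expr1 ln_powR.
by field.
Qed.

(** Y^-alpha follows the gamma mixture of weight rho 0, and Y^-a (ln Y)^m is a
    function of it. *)
Lemma welsch_moment2 m a : - alpha < a ->
  \int[H]_(p in quadrant) (p.2 `^ (- a) * ln p.2 ^+ m) =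
  (- alpha^-1) ^+ m * Ups (rho 0) m (a / alpha).
Proof.
move=> a1; have a2 : -1 < a / alpha by rewrite ltr_pdivlMr// mulN1r.
have := gamma_mixture_moment mY (pickands0 rhoC) tailY ((- alpha^-1) ^+ m) m a2.
rewrite preY => h; rewrite /Rintegral -[RHS]/(fine (_ * _)%:E) -h.
congr fine; apply: eq_integral => p; rewrite inE => /[dup] pq [p1 p2]; congr EFin.
rewrite /Y patchE mem_set// -powRrM ln_powR.
have -> : - alpha * (a / alpha) = - a by field.
rewrite mulrCA; congr (_ * _); rewrite -exprMn; congr (_ ^+ _).
by field.
Qed.

End welsch_moments.

(** * The maximum likelihood estimator of a sample *)

Section power_sums.
Context {R : realType}.
Implicit Types (z : seq (R * R)) (a b c : R) (m : nat).

Definition ordered_pairs z := all (fun p => 0 < p.2 <= p.1) z.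

Definition power_sum z m a : R := \sum_(p <- z) p.2 `^ (- a) * ln p.2 ^+ m.

Definition log_sum z : R := \sum_(p <- z) (ln p.1 + ln p.2).

(** The derivative in alpha of the profile log-likelihood below, divided by 2
    k for a sample of size k. *)
Definition half_score z a : R :=
  a^-1 + power_sum z 1 a / power_sum z 0 a - log_sum z / (2 * (size z)%:R).

Lemma is_derive_power_sum z m a : ordered_pairs z ->
  is_derive a (1:R) (power_sum z m) (- power_sum z m.+1 a).
Proof.
elim: z => [_|p z IH /andP[/andP[p0 _] /IH d]].
  rewrite (_ : power_sum [::] m = cst 0); last by apply/funext => u; rewrite /power_sum big_nil.
  by apply: is_derive_eq; rewrite /power_sum big_nil oppr0.
rewrite (_ : power_sum (p :: z) m = fun u => expR (- u * ln p.2) * ln p.2 ^+ m + power_sum z m u); last first.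
  by apply/funext => u; rewrite /power_sum big_cons powR_expln.
apply: is_derive_eq.
by rewrite /power_sum big_cons powR_expln// /GRing.scale/= exprS; ring.
Qed.

Lemma power_sum_gt0 z a : ordered_pairs z -> z != [::] -> 0 < power_sum z 0 a.
Proof.
case: z => // p z /andP[/andP[p0 _] oz] _; rewrite /power_sum big_cons expr0 mulr1.
by rewrite ltr_pwDl ?powR_gt0// sumr_ge0// => q _; rewrite expr0 mulr1 powR_ge0.
Qed.

Lemma power_sum_cauchy_schwarz z a c :
  0 <= power_sum z 2 a - 2 * c * power_sum z 1 a + c ^+ 2 * power_sum z 0 a.
Proof.
rewrite /power_sum !mulr_sumr -sumrB -big_split/= sumr_ge0// => p _.
rewrite (_ : _ + _ = p.2 `^ (- a) * (ln p.2 - c) ^+ 2); last by ring.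
by rewrite mulr_ge0 ?powR_ge0// sqr_ge0.
Qed.

(** The derivative is minus a weighted variance of ln y. *)
Lemma power_sum_ratio_nonincreasing z a b : ordered_pairs z -> z != [::] -> a <= b ->
  power_sum z 1 b / power_sum z 0 b <= power_sum z 1 a / power_sum z 0 a.
Proof.
move=> oz nz ab; rewrite -lerN2.
pose df t := power_sum z 2 t / power_sum z 0 t - (power_sum z 1 t / power_sum z 0 t) ^+ 2.
apply: (@is_derive_le R (fun t => - (power_sum z 1 t / power_sum z 0 t)) df) => // t _.
  have S0 : power_sum z 0 t != 0 by rewrite gt_eqF// power_sum_gt0.
  have d0 := @is_derive_power_sum z 0 t oz; have d1 := @is_derive_power_sum z 1 t oz.
  by apply: is_derive_eq; rewrite /df /GRing.scale/=; field.
have S0 := power_sum_gt0 t oz nz.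
have := power_sum_cauchy_schwarz z t (power_sum z 1 t / power_sum z 0 t).
rewrite [X in 0 <= X -> _](_ : _ = power_sum z 0 t * df t); first by rewrite pmulr_rge0.
by rewrite /df; field; rewrite gt_eqF.
Qed.

Lemma half_score_steep z : ordered_pairs z -> z != [::] -> recip_steep (half_score z).
Proof.
move=> oz nz a b _ ab; rewrite /half_score.
have := power_sum_ratio_nonincreasing oz nz ab.
by move: (_ / _) (_ / _) => u w; lra.
Qed.

Lemma continuous_half_score z a : ordered_pairs z -> z != [::] -> 0 < a ->
  {for a, continuous (half_score z)}.
Proof.
move=> oz nz a0; have S0 : power_sum z 0 a != 0 by rewrite gt_eqF// power_sum_gt0.
have cS m : {for a, continuous (power_sum z m)}.
  apply/differentiable_continuous/derivable1_diffP.
  by have [] := @is_derive_power_sum z m a oz.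
rewrite /prop_for /continuous_at /half_score; apply: cvgB; last exact: cvg_cst.
apply: cvgD; first by apply: cvgV; [rewrite gt_eqF|exact: cvg_id].
by apply: cvgM; [exact: (cS 1%N)|apply: cvgV => //; exact: (cS 0%N)].
Qed.

Lemma exists_min_snd z : z != [::] -> exists2 p, p \in z & forall q, q \in z -> p.2 <= q.2.
Proof.
elim: z => // p [|p' z] IH _.
  by exists p; rewrite ?mem_head// => q; rewrite inE => /eqP->.
have [//|q qz qmin] := IH; have [pq|qp] := leP p.2 q.2.
- exists p; first exact: mem_head.
  by move=> u; rewrite inE => /predU1P[->//|/qmin]; exact: le_trans.
- exists q; first by rewrite inE qz orbT.
  by move=> u; rewrite inE => /predU1P[->|/qmin//]; exact: ltW.
Qed.

(** As alpha grows, the power weights concentrate on the smallest y, so that the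
    weighted mean of ln y approaches ln min y at speed 1/alpha; the mean of
    (ln x + ln y) / 2 exceeds this value unless the sample is constant. *)
Lemma half_score_neg z : ordered_pairs z -> ~~ constant z ->
  exists2 b, 0 < b & half_score z b <= 0.
Proof.
move=> oz ncz; have nz : z != [::] by case: z ncz {oz}.
have k0 : 0 < (size z)%:R :> R by rewrite ltr0n lt0n size_eq0.
have zP p : p \in z -> 0 < p.2 <= p.1 by move=> /(allP oz).
have [p0 p0z pmin] := exists_min_snd nz; set m := ln p0.2.
have p00 : 0 < p0.2 by have /andP[] := zP _ p0z.
have ym q : q \in z -> m <= ln q.2.
  by move=> qz; rewrite ler_ln ?posrE ?pmin//; have /andP[] := zP _ qz.
have xm q : q \in z -> m <= ln q.1.
  move=> qz; have /andP[q0 qq] := zP _ qz.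
  by rewrite (le_trans (ym _ qz))// ler_ln ?posrE// (lt_le_trans q0).
have c_gt : m < log_sum z / (2 * (size z)%:R).
  rewrite ltr_pdivlMr ?mulr_gt0//.
  have h p : p \in z -> 0 <= (ln p.1 + ln p.2) - 2 * m.
    by move=> pz; have := ym _ pz; have := xm _ pz; lra.
  have -> : log_sum z = \sum_(p <- z | p \in z) ((ln p.1 + ln p.2) - 2 * m) + m * (2 * (size z)%:R).
    rewrite -big_seq sumrB big_const_seq count_predT iter_addr_0 -mulr_natr /log_sum.
    by move: (\sum_(_ <- _) _) => u; ring.
  rewrite ltrDr lt_neqAle sumr_ge0// andbT eq_sym; apply: contra ncz.
  rewrite psumr_eq0// => /allP e; apply: (@all_pred1_constant _ (p0.2, p0.2)).
  apply/allP => q qz; have := e _ qz; rewrite qz => /eqP eq0.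
  have [eq1 eq2] : ln q.1 = m /\ ln q.2 = m.
    by have := ym _ qz; have := xm _ qz; move: eq0 => /=; lra.
  have /andP[q0 qq] := zP _ qz.
  have i1 : q.1 = p0.2 by apply: ln_inj; rewrite ?posrE// (lt_le_trans q0).
  have i2 : q.2 = p0.2 by apply: ln_inj; rewrite ?posrE.
  by case: q i1 i2 {qz eq0 eq1 eq2 q0 qq} => a b /= -> ->.
move: c_gt; set c := log_sum z / _ => c_gt.
(* the positive terms of the half score at b add up to at most m + (k + 1) /
    b *)
pose b := ((size z)%:R + 1) / (c - m).
have b0 : 0 < b by rewrite divr_gt0 ?subr_gt0// ltr_pwDr.
exists b => //; rewrite /half_score -/c.
have S0 := power_sum_gt0 b oz nz.
have weight q : q \in z -> q.2 `^ (- b) * (ln q.2 - m) <= p0.2 `^ (- b) / b.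
  move=> qz; have /andP[q0 _] := zP _ qz.
  rewrite !powR_expln// (_ : - b * ln q.2 = - b * ln p0.2 + - (b * (ln q.2 - m))); last by rewrite /m; ring.
  rewrite expRD -mulrA ler_pM2l ?expR_gt0// expRN mulrC ler_pdivrMr ?expR_gt0//.
  rewrite mulrC ler_pdivlMr// mulrC.
  by rewrite (le_trans _ (expR_ge1Dx _))// lerDr.
have key : power_sum z 1 b - m * power_sum z 0 b <= (size z)%:R * (p0.2 `^ (- b) / b).
  rewrite (_ : _ - _ = \sum_(p <- z | p \in z) p.2 `^ (- b) * (ln p.2 - m)); last first.
    rewrite -big_seq /power_sum mulr_sumr -sumrB; apply: eq_bigr => q _.
    by rewrite expr1 expr0; ring.
  apply: (@le_trans _ _ (\sum_(p <- z | p \in z) (p0.2 `^ (- b) / b))); first exact: ler_sum.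
  by rewrite -big_seq big_const_seq count_predT iter_addr_0 mulr_natl.
have S0ge : p0.2 `^ (- b) <= power_sum z 0 b.
  rewrite /power_sum (big_rem _ p0z)/= expr0 mulr1 lerDl.
  by rewrite sumr_ge0// => q _; rewrite expr0 mulr1 powR_ge0.
have ratio : power_sum z 1 b / power_sum z 0 b <= m + (size z)%:R / b.
  rewrite ler_pdivrMr// mulrDl -lerBlDl (le_trans key)//.
  by rewrite mulrA mulrAC ler_wpM2l// divr_ge0// ltW.
have bE : b * (c - m) = (size z)%:R + 1 by rewrite /b divfK// gt_eqF// subr_gt0.
have : b^-1 + (size z)%:R / b = c - m.
  by rewrite -[RHS](mulfK (lt0r_neq0 b0)) mulrC [(c - m) * _]mulrC bE; field; exact: lt0r_neq0.
by move: ratio; move: (_ / _) (_ / _) => u w; lra.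
Qed.

(** The maximum over sigma of the log-likelihood. *)
Definition profile z a : R :=
  2 * (size z)%:R * (ln a + ln (2 * (size z)%:R / power_sum z 0 a) - 1) -
  (a + 1) * log_sum z.

Lemma loglikE z a t : ordered_pairs z -> 0 < t ->
  loglik z a t = 2 * (size z)%:R * (ln a + ln (t `^ a)) - (a + 1) * log_sum z -
    t `^ a * power_sum z 0 a.
Proof.
move=> oz t0; rewrite /loglik ln_powR big_seq.
rewrite (eq_bigr (fun p => (a + 1) * (ln p.1 + ln p.2) + t `^ a * (p.2 `^ (- a) * ln p.2 ^+ 0))); last first.
  move=> p /(allP oz)/andP[p0 pp].
  by rewrite lnM ?posrE// ?(lt_le_trans p0)// expr0 mulr1.
rewrite -big_seq big_split/= -!mulr_sumr -/(log_sum z) -/(power_sum z 0 a); ring.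
Qed.

Lemma ln_lt_subr1 (u : R) : 0 < u -> u != 1 -> ln u < u - 1.
Proof.
move=> u0 u1; rewrite ltrBrDl -[ltRHS](lnK u0).
by rewrite expR_gt1Dx// ln_eq0.
Qed.

(** In terms of u = sigma^alpha, the log-likelihood is 2 k ln u - S u up to a
    constant, with its strict maximum at u = 2 k / S. *)
Lemma loglik_le_profile z a t : ordered_pairs z -> z != [::] -> 0 < t ->
  loglik z a t <= profile z a ?= iff (t `^ a == 2 * (size z)%:R / power_sum z 0 a).
Proof.
move=> oz nz t0; rewrite loglikE// /profile.
have k0 : 0 < 2 * (size z)%:R :> R by rewrite mulr_gt0// ltr0n lt0n size_eq0.
have S0 := power_sum_gt0 a oz nz; have u0 : 0 < t `^ a by rewrite powR_gt0.
move: (2 * _) (t `^ a) (power_sum _ _ _) k0 u0 S0 => k u S k0 u0 S0.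
have uE : u = (u * S / k) * (k / S) by field; rewrite !gt_eqF.
have w0 : 0 < u * S / k by rewrite divr_gt0 ?mulr_gt0.
have [->|ne] := eqVneq u (k / S).
  apply/leifP/eqP.
  by rewrite [k / S * S]divfK ?gt_eqF//; ring.
have w1 : u * S / k != 1.
  by apply: contra ne => /eqP w1; rewrite [X in X == _]uE w1 mul1r.
have lnu : ln u = ln (u * S / k) + ln (k / S) by rewrite -lnM ?posrE ?divr_gt0 ?mulr_gt0// -uE.
have := ln_lt_subr1 w0 w1; rewrite -(ltr_pM2l k0) => lt1.
apply/leifP; rewrite lnu.
have kuS : k * (u * S / k - 1) = u * S - k by field; rewrite gt_eqF.
by move: lt1; rewrite kuS !mulrDr; lra.
Qed.

Lemma is_derive_profile z a : ordered_pairs z -> z != [::] -> 0 < a ->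
  is_derive a (1:R) (profile z) (2 * (size z)%:R * half_score z a).
Proof.
move=> oz nz a0.
have k0 : 0 < (size z)%:R :> R by rewrite ltr0n lt0n size_eq0.
have S0 t := power_sum_gt0 t oz nz.
have -> : profile z = fun t => 2 * (size z)%:R *
    (ln t + (ln (2 * (size z)%:R) - ln (power_sum z 0 t)) - 1) - (t + 1) * log_sum z.
  by apply/funext => t; rewrite /profile ln_div ?posrE ?mulr_gt0.
have dl := is_derive1_ln a0.
have dS : is_derive a (1:R) (fun t => ln (power_sum z 0 t))
    ((power_sum z 0 a)^-1 * - power_sum z 1 a).
  have d1 := is_derive1_ln (S0 a); have d2 := @is_derive_power_sum z 0 a oz.
  exact: (is_derive1_comp d1 d2).
apply: is_derive_eq; rewrite /half_score /GRing.scale/=.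
by field; rewrite !gt_eqF.
Qed.

Lemma profile_lt z a b : ordered_pairs z -> z != [::] -> 0 < a -> 0 < b ->
  half_score z a = 0 -> b != a -> profile z b < profile z a.
Proof.
move=> oz nz a0 b0 ha.
have k0 : 0 < (size z)%:R :> R by rewrite ltr0n lt0n size_eq0.
have mvt u w : 0 < u -> u < w -> exists2 c, u < c < w &
    profile z w - profile z u = 2 * (size z)%:R * half_score z c * (w - u).
  move=> u0 uw.
  have d t : t \in `]u, w[ -> is_derive t (1:R) (profile z) (2 * (size z)%:R * half_score z t).
    by rewrite in_itv/= => /andP[ut _]; apply: is_derive_profile => //; exact: lt_trans ut.
  have [|c] := MVT uw d; last by rewrite in_itv/=; exists c.
  apply: derivable_within_continuous => t; rewrite in_itv/= => /andP[ut _].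
  by have [] := @is_derive_profile z t oz nz (lt_le_trans u0 ut).
rewrite neq_lt => /orP[ba|ab].
- have [c /andP[bc ca] e] := mvt _ _ b0 ba.
  rewrite -subr_gt0 e; apply: mulr_gt0; last by rewrite subr_gt0.
  apply: mulr_gt0; first exact: mulr_gt0.
  have c0 := lt_trans b0 bc.
  have := half_score_steep oz nz c0 (ltW ca); rewrite ha.
  have : a^-1 < c^-1 by rewrite ltf_pV2 ?posrE.
  by move: (a^-1) (c^-1) => u w; lra.
- have [c /andP[ac cb] e] := mvt _ _ a0 ab.
  rewrite -subr_lt0 e pmulr_llt0 ?subr_gt0// pmulr_rlt0 ?mulr_gt0//.
  have c0 := lt_trans a0 ac.
  have := half_score_steep oz nz a0 (ltW ac); rewrite ha.
  have : c^-1 < a^-1 by rewrite ltf_pV2 ?posrE.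
  by move: (a^-1) (c^-1) => u w; lra.
Qed.

(** The likelihood is maximized in sigma first and then along the profile in
    alpha; both maxima are strict, so the chosen maximizer is this one. *)
Lemma mle_spec z : ordered_pairs z -> ~~ constant z ->
  exists a, [/\ 0 < a, half_score z a = 0, mle_alpha z = a%:E &
    mle_sigma z = (power_sum z 0 a / (2 * (size z)%:R)) `^ (- a^-1)].
Proof.
move=> oz ncz; have nz : z != [::] by case: z ncz {oz}.
have k0 : 0 < 2 * (size z)%:R :> R by rewrite mulr_gt0// ltr0n lt0n size_eq0.
have [b b0 hb] := half_score_neg oz ncz.
have [a /andP[a0 _] ha] := recip_steep_zero (half_score_steep oz nz) b0 hb
  (fun x x0 => continuous_half_score oz nz x0).
exists a; rewrite /mle_alpha /mle_sigma (negbTE ncz).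
have S0 := power_sum_gt0 a oz nz.
pose t := (power_sum z 0 a / (2 * (size z)%:R)) `^ (- a^-1).
have t0 : 0 < t by rewrite powR_gt0// divr_gt0.
have ta : t `^ a = 2 * (size z)%:R / power_sum z 0 a.
  by rewrite /t -powRrM mulNr mulVf ?gt_eqF// powR_inv1 ?invf_div// divr_ge0 ?(ltW S0)// ltW.
have top : loglik z a t = profile z a.
  by apply/eqP; rewrite (loglik_le_profile a oz nz t0) ta.
suff -> : argmax_loglik z = (a, t) by split.
have : (set1 (a, t)) (argmax_loglik z); last by [].
rewrite /argmax_loglik; case: xgetP => [th _ [th1 th2 max]|/(_ (a, t))]; last first.
  case; split=> //= a' t' a'0 t'0; rewrite top.
  apply: le_trans (loglik_le_profile a' oz nz t'0) _.
  have [->//|ne] := eqVneq a' a.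
  exact: ltW (profile_lt oz nz a0 a'0 ha ne).
have le1 := max _ _ a0 t0; rewrite top in le1.
have [le2 eq2] := loglik_le_profile th.1 oz nz th2.
have e1 : th.1 = a.
  apply/eqP; apply: contraT => ne.
  have := profile_lt oz nz a0 th1 ha ne.
  by rewrite ltNge (le_trans le1 le2).
have /eqP : th.2 `^ th.1 == 2 * (size z)%:R / power_sum z 0 th.1.
  by rewrite -eq2 eq_le le2/= {1}e1.
rewrite e1 -ta => e2.
have e3 : th.2 = t.
  apply: ln_inj; rewrite ?posrE//; apply: (mulfI (lt0r_neq0 a0)).
  by rewrite -!ln_powR e2.
by case: th e1 e3 {th1 th2 max le1 le2 eq2 e2} => u w /= -> ->.
Qed.

End power_sums.

(** * Filters, rates and the delta method *)

Section asymptotics.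
Context {R : realType}.

(** A property that has to hold eventually may be checked along ultrafilters,
    where bounded quantities have limits; expansions with bounded terms then
    become statements on limits. *)
Lemma ultra_near I (F : set_system I) (P : set I) : Filter F ->
  (forall U : set_system I, UltraFilter U -> F `<=` U -> U P) -> F P.
Proof.
move=> FF h; have [//|nFP] := pselect (F P).
have pG : ProperFilter (within (~` P) F).
  apply: Build_ProperFilter_ex => A FA; apply: contrapT => nA; apply: nFP.
  apply: filterS (FA : F [set x | ~ P x -> A x]) => x Ax.
  by apply: contrapT => nPx; apply: nA; exists x; exact: Ax.
have [U [UU sU]] := ultraFilterLemma pG.
have UP : U P by apply: h => // A FA; apply: sU; exact: (filterS (fun x Ax _ => Ax) FA).
have UC : U (~` P) by apply: sU; rewrite /within/=; apply: filterE.
by have [x []] := filter_ex (filterI UP UC).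
Qed.

Lemma ultra_bounded_cvg I (U : set_system I) (f : I -> R) (K : R) : UltraFilter U ->
  (\forall i \near U, `|f i| <= K) -> exists l : R, f i @[i --> U] --> l.
Proof.
move=> UU fK.
have fseg : (f @ U) `[- K, K]%classic.
  by apply: filterS fK => i; rewrite /= in_itv/= ler_norml.
have [l [_ lcl]] := @segment_compact R (- K) K (f @ U) _ fseg.
exists l => N Nl; have [//|UC] := in_ultra_setVsetC (f @^-1` N) UU.
by have [x []] := lcl (~` N) N UC Nl.
Qed.

Lemma rate_cvg I (F : set_system I) {FF : Filter F} (v x : I -> R) (c w : R) :
  v i @[i --> F] --> +oo -> v i * (x i - c) @[i --> F] --> w ->
  x i @[i --> F] --> c.
Proof.
move=> voo xw.
have : (v i)^-1 * (v i * (x i - c)) + c @[i --> F] --> 0 * w + c.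
  apply: cvgD; last exact: cvg_cst.
  apply: cvgM xw; apply/gtr0_cvgV0 => //.
  by move/cvgryPgt : voo; exact.
rewrite mul0r add0r; apply: cvg_trans; apply: near_eq_cvg.
near=> i; rewrite mulKf ?subrK// gt_eqF//; near: i.
by move/cvgryPgt : voo; exact.
Unshelve. all: by end_near. Qed.

(** Caratheodory's form f x - f c = g x (x - c) of differentiability, with g
    continuous at c. *)
Lemma delta_method I (F : set_system I) (v x : I -> R) (f : R -> R) (c df w : R) :
  Filter F -> v i @[i --> F] --> +oo -> v i * (x i - c) @[i --> F] --> w ->
  is_derive c (1:R) f df -> v i * (f (x i) - f c) @[i --> F] --> df * w.
Proof.
move=> FF voo xw /is_derive1_caratheodory[g [fE gc gcE]].
have xc : x i @[i --> F] --> c by exact: (rate_cvg voo xw).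
rewrite (_ : (fun i => _) = (fun i => g (x i) * (v i * (x i - c)))); last first.
  by apply/funext => i; rewrite fE; ring.
rewrite -gcE; apply: cvgM xw.
exact: (cvg_comp _ _ xc gc).
Qed.

(** The upper bound is convexity of exp, the lower one its tangent at 0. *)
Lemma expR_scale_dist (l x : R) : 0 <= l <= 1 ->
  `|expR (l * x) - 1| <= l * (expR x + expR (- x)).
Proof.
move=> /andP[l0 l1]; have e0 := expR_gt0 (l * x).
have t1 : expR (l * x) * (1 + (1 - l) * x) <= expR x.
  rewrite [leRHS](_ : _ = expR (l * x) * expR ((1 - l) * x)); last by rewrite -expRD; congr expR; ring.
  by rewrite ler_pM2l// expR_ge1Dx.
have t2 : expR (l * x) * (1 - l * x) <= 1.
  by rewrite -[leRHS](expRxMexpNx_1 (l * x)) ler_pM2l//; exact: expR_ge1Dx.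
have t3 := expR_ge1Dx (- x); have t4 := expR_ge1Dx (l * x); have t5 := expR_ge0 x.
have t6 : l * (expR (l * x) * (1 + (1 - l) * x)) <= l * expR x by apply: ler_wpM2l.
have t7 : (1 - l) * (expR (l * x) * (1 - l * x)) <= 1 - l.
  by rewrite -[leRHS]mulr1 ler_wpM2l// subr_ge0.
have t8 : l * (1 - x) <= l * expR (- x) by apply: ler_wpM2l.
have t9 : 0 <= l * expR x by rewrite mulr_ge0.
have t10 : 0 <= l * expR (- x) by rewrite mulr_ge0// expR_ge0.
rewrite ler_norml mulrDr; apply/andP; split.
  by move: t4 t8 t9; rewrite mulrBr mulr1; lra.
have e : l * (expR (l * x) * (1 + (1 - l) * x)) + (1 - l) * (expR (l * x) * (1 - l * x)) =
  expR (l * x) by ring.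
by move: t6 t7; lra.
Qed.

Definition power_mean (u : seq (R * R)) m a := power_sum u m a / (size u)%:R.

Lemma is_derive_power_mean u m a : ordered_pairs u ->
  is_derive a (1:R) (power_mean u m) (- power_mean u m.+1 a).
Proof.
move=> ou; have d := @is_derive_power_sum R u m a ou.
by rewrite /power_mean; apply: is_derive_eq; rewrite /GRing.scale/=; ring.
Qed.

(** Convergence of the means at the three exponents b - d, b and b + d
    controls them at all exponents near b. *)
Lemma power_mean2_dist u (b s d : R) : ordered_pairs u -> `|s| <= d -> 0 < d ->
  `|power_mean u 2 (b + s) - power_mean u 2 b| <=
  `|s| / d * (power_mean u 2 (b + d) + power_mean u 2 (b - d)).
Proof.
move=> ou sd d0; have l01 : 0 <= `|s| / d <= 1.
  by rewrite divr_ge0 ?(ltW d0)//= ler_pdivrMr// mul1r.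
rewrite /power_mean -mulrBl -mulrDl mulrA normrM [`|(_)^-1|]ger0_norm ?invr_ge0//.
rewrite ler_wpM2r ?invr_ge0// /power_sum -sumrB -big_split/= mulr_sumr.
apply: le_trans (ler_norm_sum _ _ _) _; rewrite big_seq [leRHS]big_seq.
apply: ler_sum => p /(allP ou)/andP[p0 _]; rewrite !powR_expln//.
have L0 : 0 <= ln p.2 ^+ 2 by rewrite sqr_ge0.
move: (ln p.2 ^+ 2) L0 => L L0.
rewrite -mulrBl -mulrDl mulrA normrM (ger0_norm L0) ler_wpM2r//.
have key (e : R) : `|e| = `|s| -> `|expR (- e * ln p.2) - 1| <=
    `|s| / d * (expR (- d * ln p.2) + expR (d * ln p.2)).
  move=> es; have [e0|e0] := leP 0 e.
  - have := expR_scale_dist (- d * ln p.2) l01.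
    rewrite -es (ger0_norm e0) mulrA (_ : e / d * - d = - e) ?mulNr ?opprK//.
    by field; rewrite gt_eqF.
  - have := expR_scale_dist (d * ln p.2) l01; rewrite [expR _ + expR _]addrC -es (ltr0_norm e0) mulrA -mulNr.
    by rewrite (_ : - e / d * d = - e)//; field; rewrite gt_eqF.
have E t : expR (- (b + t) * ln p.2) = expR (- b * ln p.2) * expR (- t * ln p.2).
  by rewrite -expRD; congr expR; ring.
rewrite !E opprK -[X in _ - X]mulr1 -mulrBr -mulrDr normrM gtr0_norm ?expR_gt0//.
by rewrite mulrCA ler_pM2l ?expR_gt0// key.
Qed.

Section local_means.
Variables (I : Type) (F : set_system I) (u : I -> seq (R * R)) (b : R).
Context {FF : Filter F}.
Hypothesis ou : forall i, ordered_pairs (u i).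

(** Convergence of the sample means at exponents that depend on the sample. *)
Definition means_cvg_near m (l : R) := forall x : I -> R, x i @[i --> F] --> b ->
  power_mean (u i) m (x i) @[i --> F] --> l.

Lemma cvg_dist_le (x y : I -> R) : (forall i, `|y i - b| <= `|x i - b|) ->
  x i @[i --> F] --> b -> y i @[i --> F] --> b.
Proof.
move=> yx /cvgrPdist_lt xb; apply/cvgrPdist_lt => e e0; near=> i.
rewrite distrC (le_lt_trans (yx i))// distrC; near: i; exact: xb.
Unshelve. all: by end_near. Qed.

Lemma means_cvg_near2 (d K l : R) : 0 < d ->
  (\forall i \near F, power_mean (u i) 2 (b + d) + power_mean (u i) 2 (b - d) <= K) ->
  power_mean (u i) 2 b @[i --> F] --> l -> means_cvg_near 2 l.
Proof.
move=> d0 nK cl x xb.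
suff c0 : power_mean (u i) 2 (x i) - power_mean (u i) 2 b @[i --> F] --> (0 : R).
  rewrite -[l]add0r (_ : (fun i => power_mean (u i) 2 (x i)) = fun i =>
    (power_mean (u i) 2 (x i) - power_mean (u i) 2 b) + power_mean (u i) 2 b).
    exact: cvgD.
  by apply/funext => i; rewrite subrK.
have x0 : `|x i - b| / d * K @[i --> F] --> (0 : R).
  rewrite -[X in _ --> X](_ : `|b - b| / d * K = 0); last by rewrite subrr normr0 !mul0r.
  apply: cvgM; last exact: cvg_cst.
  apply: cvgM; last exact: cvg_cst.
  by apply: cvg_norm; apply: cvgB => //; exact: cvg_cst.
apply: norm_cvg0; apply: (squeeze_cvgr (f := fun=> 0) (h := fun i => `|x i - b| / d * K)).
- near=> i; rewrite normr_ge0/=.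
  have xd : `|x i - b| <= d.
    by rewrite distrC ltW//; near: i; move/cvgrPdist_lt : xb; exact.
  rewrite -{1}(subrK b (x i)) [x i - b + b]addrC (le_trans (power_mean2_dist _ _ xd d0))//.
  by rewrite ler_wpM2l ?divr_ge0 ?(ltW d0)//; near: i.
- exact: cvg_cst.
- exact: x0.
Unshelve. all: by end_near. Qed.

(** Mean value theorem: up to sign, the mean of order m + 1 is the derivative
    of the mean of order m. *)
Lemma means_cvg_nearS m (l l' : R) : means_cvg_near m.+1 l' ->
  power_mean (u i) m b @[i --> F] --> l -> means_cvg_near m l.
Proof.
move=> cl' cl x xb.
have /choice[c cP] i : exists c, `|c - b| <= `|x i - b| /\
    power_mean (u i) m (x i) - power_mean (u i) m b = - power_mean (u i) m.+1 c * (x i - b).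
  have [c [_ c1 c2]] := @is_derive_mvt R (power_mean (u i) m)
    (fun t => - power_mean (u i) m.+1 t) (x i) b
    (fun t _ => is_derive_power_mean m t (ou i)).
  by exists c.
have cb : c i @[i --> F] --> b by apply: cvg_dist_le xb => i; have [] := cP i.
rewrite (_ : (fun i => _) = fun i =>
    - power_mean (u i) m.+1 (c i) * (x i - b) + power_mean (u i) m b); last first.
  by apply/funext => i; have [_ <-] := cP i; rewrite subrK.
rewrite -[l]add0r -[X in X + l](_ : - l' * (b - b) = 0); last by rewrite subrr mulr0.
apply: cvgD => //; apply: cvgM; first by apply: cvgN; exact: cl'.
by apply: cvgB => //; exact: cvg_cst.
Qed.

End local_means.

Lemma half_scoreE u a : u != [::] -> half_score u a =
  a^-1 + power_mean u 1 a / power_mean u 0 a - log_sum u / (size u)%:R / 2.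
Proof.
move=> nu; have k0 : (size u)%:R != 0 :> R by rewrite pnatr_eq0 size_eq0.
rewrite /half_score /power_mean; congr (_ + _ - _).
  by rewrite invfM invrK mulrACA mulVf// mulr1.
by rewrite invfM [_^-1 * _]mulrC mulrA.
Qed.

Lemma power_mean_gt0 u a : ordered_pairs u -> u != [::] -> 0 < power_mean u 0 a.
Proof.
by move=> ou nu; rewrite divr_gt0 ?power_sum_gt0// ltr0n lt0n size_eq0.
Qed.

Lemma is_derive_half_score u (a : R) : ordered_pairs u -> u != [::] -> 0 < a ->
  is_derive a (1:R) (half_score u)
    (- a^-1 ^+ 2 + (power_mean u 1 a / power_mean u 0 a) ^+ 2 -
     power_mean u 2 a / power_mean u 0 a).
Proof.
move=> ou nu a0; have S0 : power_mean u 0 a != 0 by rewrite gt_eqF// power_mean_gt0.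
have aN : a != 0 by rewrite gt_eqF.
have d0 := @is_derive_power_mean u 0 a ou; have d1 := @is_derive_power_mean u 1 a ou.
rewrite (_ : half_score u = fun a =>
  a^-1 + power_mean u 1 a / power_mean u 0 a - log_sum u / (size u)%:R / 2).
  have dV := @is_deriveV R id a 1 1 aN (is_derive_id a 1).
  by apply: is_derive_eq; rewrite /GRing.scale/=; field; rewrite S0 aN.
by apply/funext => t; exact: half_scoreE.
Qed.

(** * Expansion of the maximum likelihood estimator *)

Section mle_asymptotics.
(** Samples u i are followed along a filter. A, B and D are the limits at b of
    the means of y^-b (ln y)^m for m = 1, 0, 2, and c is that of the means of
    ln x + ln y; slope is the limit of the derivative of the half score at
    b. *)
Variables (I : Type) (F : set_system I) (u : I -> seq (R * R)) (v a : I -> R).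
Variables (b d K A B D c w1 w2 w34 : R).
Context {FF : Filter F}.
Hypotheses (ou : forall i, ordered_pairs (u i)) (nu : forall i, u i != [::]).
Hypotheses (a_gt0 : forall i, 0 < a i) (ha : forall i, half_score (u i) (a i) = 0).
Hypotheses (b_gt0 : 0 < b) (B_gt0 : 0 < B) (d_gt0 : 0 < d).
Hypothesis voo : v i @[i --> F] --> +oo.
Hypothesis AW : v i * (power_mean (u i) 1 b - A) @[i --> F] --> w1.
Hypothesis BW : v i * (power_mean (u i) 0 b - B) @[i --> F] --> w2.
Hypothesis CW : v i * (log_sum (u i) / (size (u i))%:R - c) @[i --> F] --> w34.
Hypothesis DD : power_mean (u i) 2 b @[i --> F] --> D.
Hypothesis DK : \forall i \near F,
  power_mean (u i) 2 (b + d) + power_mean (u i) 2 (b - d) <= K.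
Hypothesis b_root : b^-1 + A / B - c / 2 = 0.

Let slope := - b^-1 ^+ 2 + (A / B) ^+ 2 - D / B.
Hypothesis slope_neq0 : slope != 0.
Let what := - (((w1 - A / B * w2) / B - w34 / 2) / slope).

Let B_neq0 : B != 0. Proof. by rewrite gt_eqF. Qed.

Let cvg2 : means_cvg_near F u b 2 D.
Proof. exact: (means_cvg_near2 ou d_gt0 DK DD). Qed.

Let cvg1 : means_cvg_near F u b 1 A.
Proof. exact: (means_cvg_nearS ou cvg2 (rate_cvg voo AW)). Qed.

Let cvg0 : means_cvg_near F u b 0 B.
Proof. exact: (means_cvg_nearS ou cvg1 (rate_cvg voo BW)). Qed.

Let half_score_rate : v i * half_score (u i) b @[i --> F] -->
  (w1 - A / B * w2) / B - w34 / 2.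
Proof.
rewrite (_ : (fun i => _) = fun i =>
  (v i * (power_mean (u i) 1 b - A) - A / B * (v i * (power_mean (u i) 0 b - B))) /
    power_mean (u i) 0 b - v i * (log_sum (u i) / (size (u i))%:R - c) / 2).
  apply: cvgB; last by apply: cvgM => //; exact: cvg_cst.
  apply: cvgM; last by apply: cvgV => //; exact: (rate_cvg voo BW).
  by apply: cvgB => //; apply: cvgM => //; exact: cvg_cst.
apply/funext => i; rewrite half_scoreE//.
have S0 : power_mean (u i) 0 b != 0 by rewrite gt_eqF// power_mean_gt0.
have -> : b^-1 = c / 2 - A / B by move: b_root; lra.
by move: (log_sum _ / _) => L; field; rewrite S0 B_neq0.
Qed.

(** Steepness bounds 1/a - 1/b by the half score at b, which tends to 0. *)
Lemma mle_consistent : a i @[i --> F] --> b.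
Proof.
have h0 : half_score (u i) b @[i --> F] --> (0 : R).
  by apply: (rate_cvg voo); under eq_fun do rewrite subr0; exact: half_score_rate.
have aV : (a i)^-1 @[i --> F] --> b^-1.
  apply/cvgrPdist_lt => e e0; near=> i.
  rewrite distrC; apply: le_lt_trans (recip_steep_dist (half_score_steep (ou i) (nu i)) (a_gt0 i) (ha i) b_gt0) _.
  by rewrite -[half_score _ _]subr0 distrC; near: i; move/cvgrPdist_lt : h0; exact.
rewrite -[b]invrK (_ : a = fun i => (a i)^-1^-1).
  by apply: cvgV => //; rewrite invr_neq0// gt_eqF.
by apply/funext => i; rewrite invrK.
Unshelve. all: by end_near. Qed.

(** The half score vanishes at a, so that its mean value expansion between a
    and b determines a - b. *)
Lemma mle_alpha_rate : v i * (a i - b) @[i --> F] --> what.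
Proof.
have /choice[x xP] i : exists x, `|x - b| <= `|a i - b| /\
    half_score (u i) (a i) - half_score (u i) b =
    (- x^-1 ^+ 2 + (power_mean (u i) 1 x / power_mean (u i) 0 x) ^+ 2 -
     power_mean (u i) 2 x / power_mean (u i) 0 x) * (a i - b).
  have [|x [_ x1 x2]] := @is_derive_mvt R (half_score (u i))
    (fun x => - x^-1 ^+ 2 + (power_mean (u i) 1 x / power_mean (u i) 0 x) ^+ 2 -
     power_mean (u i) 2 x / power_mean (u i) 0 x) (a i) b; last by exists x.
  move=> t tab; apply: is_derive_half_score => //.
  by case/orP: tab => /andP[h _]; exact: lt_le_trans h.
have xb : x i @[i --> F] --> b.
  by apply: (cvg_dist_le _ mle_consistent) => i; have [] := xP i.
pose s i := - (x i)^-1 ^+ 2 + (power_mean (u i) 1 (x i) / power_mean (u i) 0 (x i)) ^+ 2 -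
     power_mean (u i) 2 (x i) / power_mean (u i) 0 (x i).
have s_cvg : s i @[i --> F] --> slope.
  have V0 : (power_mean (u i) 0 (x i))^-1 @[i --> F] --> B^-1.
    by apply: cvgV => //; exact: cvg0.
  apply: cvgB; last by apply: cvgM => //; exact: cvg2.
  apply: cvgD; last by rewrite expr2; apply: cvgM; apply: cvgM => //; exact: cvg1.
  by apply: cvgN; rewrite expr2; apply: cvgM; apply: cvgV => //; rewrite gt_eqF.
have : - (v i * half_score (u i) b / s i) @[i --> F] --> what.
  by apply: cvgN; apply: cvgM half_score_rate _; apply: cvgV.
apply: cvg_trans; apply: near_eq_cvg; near=> i.
have si0 : s i != 0.
  by near: i; apply: (cvgr_neq0 slope).
have [_] := xP i; rewrite ha sub0r -/(s i) => e.
by rewrite -mulNr -mulrN e; field.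
Unshelve. all: by end_near. Qed.

Lemma mle_mean_rate : v i * (power_mean (u i) 0 (a i) - B) @[i --> F] --> w2 - A * what.
Proof.
have /choice[x xP] i : exists x, `|x - b| <= `|a i - b| /\
    power_mean (u i) 0 (a i) - power_mean (u i) 0 b = - power_mean (u i) 1 x * (a i - b).
  have [x [_ x1 x2]] := @is_derive_mvt R (power_mean (u i) 0)
    (fun t => - power_mean (u i) 1 t) (a i) b
    (fun t _ => is_derive_power_mean 0 t (ou i)).
  by exists x.
have xb : x i @[i --> F] --> b.
  by apply: (cvg_dist_le _ mle_consistent) => i; have [] := xP i.
rewrite (_ : (fun i => _) = fun i => v i * (power_mean (u i) 0 b - B) -
    power_mean (u i) 1 (x i) * (v i * (a i - b))).
  by apply: cvgB => //; apply: cvgM mle_alpha_rate; exact: cvg1.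
apply/funext => i; have [_ e] := xP i.
rewrite -[power_mean _ _ (a i)](subrK (power_mean (u i) 0 b)) e; ring.
Qed.

End mle_asymptotics.

End asymptotics.

(** * Expansion of the bias-corrected estimators *)

Section bias_correction.
Context {R : realType}.

Definition rescale (s : R) (z : seq (R * R)) := [seq (p.1 / s, p.2 / s) | p <- z].

Lemma emp_meanE z s f :
  emp_mean z s f = (\sum_(p <- rescale s z) f p) / (size (rescale s z))%:R.
Proof. by rewrite /emp_mean /rescale big_map size_map mulrC. Qed.

Lemma ordered_rescale s z : 0 < s -> ordered_pairs z -> ordered_pairs (rescale s z).
Proof.
move=> s0 /allP oz; apply/allP => _ /mapP[p /oz/andP[p0 pp] ->]/=.
by rewrite divr_gt0//= ler_pM2r ?invr_gt0.
Qed.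

Lemma power_sum_rescale s z a : 0 < s -> ordered_pairs z ->
  power_sum (rescale s z) 0 a = s `^ a * power_sum z 0 a /\
  power_sum (rescale s z) 1 a = s `^ a * (power_sum z 1 a - ln s * power_sum z 0 a).
Proof.
move=> s0 /allP oz; have e p : p \in z ->
    (p.2 / s) `^ (- a) = s `^ a * p.2 `^ (- a) /\ ln (p.2 / s) = ln p.2 - ln s.
  move=> /oz/andP[p0 _]; rewrite lnM ?posrE ?invr_gt0// lnV ?posrE//; split=> //.
  rewrite !powR_expln ?divr_gt0// -expRD lnM ?posrE ?invr_gt0// lnV ?posrE//.
  by congr expR; ring.
rewrite /power_sum /rescale !big_map; split; rewrite ?mulrBr !mulr_sumr -?sumrB;
  rewrite !big_seq; apply: eq_bigr => p /e[e1 e2] /=; rewrite e1 ?e2 !(expr0,expr1); ring.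
Qed.

Lemma half_score_rescale s z a : 0 < s -> ordered_pairs z -> z != [::] ->
  half_score (rescale s z) a = half_score z a.
Proof.
move=> s0 oz nz; have k0 : (size z)%:R != 0 :> R by rewrite pnatr_eq0 size_eq0.
have [e0 e1] := power_sum_rescale a s0 oz.
have S0 : power_sum z 0 a != 0 by rewrite gt_eqF// power_sum_gt0.
have sa : s `^ a != 0 by rewrite gt_eqF// powR_gt0.
have -> : half_score (rescale s z) a = a^-1 + (power_sum z 1 a / power_sum z 0 a - ln s) -
    log_sum (rescale s z) / (2 * (size z)%:R).
  rewrite /half_score e0 e1 size_map; congr (_ + _ - _).
  by move: (power_sum _ _ _) (power_sum _ _ _) (ln s) S0 sa => u w l S0 sa; field; rewrite sa S0.
have -> : log_sum (rescale s z) = log_sum z - (size z)%:R * (2 * ln s).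
  rewrite /log_sum /rescale big_map big_seq.
  rewrite (eq_bigr (fun p => ln p.1 + ln p.2 - 2 * ln s)); last first.
    move=> p /(allP oz)/andP[p0 pp] /=.
    have p1 := lt_le_trans p0 pp.
    by rewrite !ln_div ?posrE//; ring.
  by rewrite -big_seq sumrB big_const_seq count_predT iter_addr_0 -[X in _ - X = _]mulr_natl.
rewrite /half_score; move: (power_sum _ _ _ / _) (ln s) (log_sum z) (a^-1) => u l w c.
by field.
Qed.

Lemma mle_spec_rescaled s z : 0 < s -> ordered_pairs z -> ~~ constant z ->
  exists a, [/\ 0 < a, half_score (rescale s z) a = 0, mle_alpha z = a%:E &
    mle_sigma z / s = (power_mean (rescale s z) 0 a / 2) `^ (- a^-1)].
Proof.
move=> s0 oz ncz; have nz : z != [::] by case: z ncz {oz}.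
have k0 : 0 < 2 * (size z)%:R :> R by rewrite mulr_gt0// ltr0n lt0n size_eq0.
have [a [a0 ha e1 e2]] := mle_spec oz ncz.
exists a; split=> //; first by rewrite half_score_rescale.
rewrite e2 /power_mean (power_sum_rescale a s0 oz).1 size_map.
have S0 := power_sum_gt0 a oz nz.
have P0 : 0 < power_sum z 0 a / (2 * (size z)%:R) by rewrite divr_gt0.
rewrite (_ : s `^ a * _ / _ / 2 = s `^ a * (power_sum z 0 a / (2 * (size z)%:R))); last first.
  by field; rewrite (lt0r_neq0 _)//; move: k0; rewrite pmulr_rgt0.
move: P0; set Q := (power_sum z 0 a / _) => P0.
rewrite [in RHS]powRM ?powR_ge0 ?(ltW P0)// -powRrM mulrN mulfV ?gt_eqF// powR_inv1 ?(ltW s0)//.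
by rewrite mulrC.
Qed.

(** Written with exp, the scale component is ready for the delta method. *)
Lemma bc_errorE (alpha0 s v r : R) z : 0 < s -> ordered_pairs z -> ~~ constant z ->
  0 <= r <= 1 -> exists a, [/\ 0 < a, half_score (rescale s z) a = 0 &
    bc_error alpha0 s v r z = map_mx EFin (\col_(i < 2)
      if i == 0 then v * (a * (varpi r)^-1 - alpha0)
      else v * (expR (a^-1 * (ln (Ups r 0 (varpi r)) -
                              ln (power_mean (rescale s z) 0 a))) - 1))].
Proof.
move=> s0 oz ncz r01; have nz : z != [::] by case: z ncz {oz}.
have [a [a0 ha e1 e2]] := mle_spec_rescaled s0 oz ncz.
exists a; split=> //; apply/matrixP => i j; rewrite !mxE; case: ifP => _.
  by rewrite /bc_alpha e1 inver gt_eqF ?varpi_gt0.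
congr (_ * (_ - 1))%:E.
rewrite /bc_sigma mulrAC e2 e1 inver gt_eqF//= UpsilonE.
have U0 : 0 < Ups r 0 (varpi r).
  by apply: Ups_gt0 => //; rewrite (lt_trans _ (varpi_gt0 r01))// ltrN10.
have nr : rescale s z != [::] by rewrite -size_eq0 size_map size_eq0.
have B0 := power_mean_gt0 a (ordered_rescale s0 oz) nr.
have [B20 U20] : 0 < power_mean (rescale s z) 0 a / 2 /\ 0 < Ups r 0 (varpi r) / 2.
  by split; apply: divr_gt0.
rewrite (powR_expln _ B20) (powR_expln _ U20) -expRD; congr expR.
move: (power_mean _ _ _) (Ups _ _ _) B0 U0 {B20 U20} => B U B0 U0; rewrite !ln_div ?posrE//.
ring.
Qed.

Lemma sum_ord4 (f : 'I_4 -> R) :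
  \sum_(j < 4) f j = f ord0 + f (inord 1) + f (inord 2) + f (inord 3).
Proof.
rewrite !big_ord_recl big_ord0 addr0 !addrA.
by congr (f _ + f _ + f _ + f _); apply/val_inj; rewrite /= inordK.
Qed.

Lemma sum_ord2 (f : 'I_2 -> R) : \sum_(j < 2) f j = f ord0 + f (inord 1).
Proof.
rewrite !big_ord_recl big_ord0 addr0.
by congr (f _ + f _); apply/val_inj; rewrite /= inordK.
Qed.

Lemma matrix24_mul (r1 r2 : seq R) (w : 'cV[R]_4) i :
  (matrix24 r1 r2 *m w) i ord0 = let r := if i == 0 then r1 else r2 in
  r`_0 * w ord0 ord0 + r`_1 * w (inord 1) ord0 + r`_2 * w (inord 2) ord0 +
  r`_3 * w (inord 3) ord0.
Proof. by rewrite !mxE sum_ord4 !mxE !inordK. Qed.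

Lemma M_bc_mul (rho0 alpha0 : R) (w : 'cV[R]_4) :
  let Mw := M_mle rho0 alpha0 *m w in
  let alpha1 := varpi rho0 * alpha0 in
  let s1 := (2 / Upsilon rho0 (varpi rho0)) `^ (alpha1^-1) in
  (M_bc rho0 alpha0 *m w) ord0 ord0 = (varpi rho0)^-1 * Mw ord0 ord0 /\
  (M_bc rho0 alpha0 *m w) (inord 1) ord0 =
    alpha1^-1 * ln s1 * Mw ord0 ord0 + s1^-1 * Mw (inord 1) ord0.
Proof.
rewrite /M_bc -mulmxA; move: (M_mle _ _ *m w) => Mw.
have i10 : (inord 1 : 'I_2) == 0 = false by apply/eqP => /(congr1 val); rewrite /= inordK.
by rewrite !mxE !sum_ord2 !mxE i10 eqxx mul0r addr0.
Qed.

Section bc_asymptotics.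
Variables (I : Type) (F : set_system I) (u : I -> seq (R * R)) (v r a : I -> R).
Variables (alpha0 rho0 d K : R) (w : 'cV[R]_4).
Context {FF : Filter F}.

Let p := varpi rho0.
Let b := p * alpha0.
Let U m := Ups rho0 m p.

Hypotheses (rho01 : 0 <= rho0 <= 1) (alpha0_gt0 : 0 < alpha0) (d_gt0 : 0 < d).
Hypotheses (ou : forall i, ordered_pairs (u i)) (nu : forall i, u i != [::]).
Hypotheses (a_gt0 : forall i, 0 < a i) (ha : forall i, half_score (u i) (a i) = 0).
Hypothesis r01 : forall i, 0 <= r i <= 1.
Hypothesis voo : v i @[i --> F] --> +oo.
Hypothesis rW : v i * (r i - rho0) @[i --> F] --> (0 : R).
Hypothesis W1 : v i * (power_mean (u i) 1 b - - (U 1 / alpha0)) @[i --> F] --> w ord0 ord0.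
Hypothesis W2 : v i * (power_mean (u i) 0 b - U 0) @[i --> F] --> w (inord 1) ord0.
Hypothesis W34 : v i * (log_sum (u i) / (size (u i))%:R -
  (2 * euler_gamma - rho0) / alpha0) @[i --> F] --> w (inord 2) ord0 + w (inord 3) ord0.
Hypothesis DD : power_mean (u i) 2 b @[i --> F] --> U 2 / alpha0 ^+ 2.
Hypothesis DK : \forall i \near F,
  power_mean (u i) 2 (b + d) + power_mean (u i) 2 (b - d) <= K.

Let p_gt0 : 0 < p. Proof. exact: varpi_gt0. Qed.
Let b_gt0 : 0 < b. Proof. by rewrite mulr_gt0. Qed.
Let p_gtN1 : -1 < p. Proof. by rewrite (lt_trans _ p_gt0)// ltrN10. Qed.
Let U0_gt0 : 0 < U 0. Proof. exact: Ups_gt0. Qed.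

(** Half of the constant dPsi in the definition of M_mle. *)
Definition mle_slope := - b^-1 ^+ 2 + (- (U 1 / alpha0) / U 0) ^+ 2 - U 2 / alpha0 ^+ 2 / U 0.

Let slope_lt0 : mle_slope < 0.
Proof.
have : U 1 ^+ 2 <= U 0 * U 2 by exact: Ups_log_convex.
rewrite -(ler_pM2r (_ : 0 < (alpha0 ^+ 2 * U 0 ^+ 2)^-1)); last first.
  by rewrite invr_gt0 mulr_gt0 ?exprn_gt0.
have a0 : alpha0 != 0 by rewrite gt_eqF.
have u0 : U 0 != 0 by rewrite gt_eqF.
rewrite (_ : U 1 ^+ 2 / _ = (- (U 1 / alpha0) / U 0) ^+ 2); last by field; rewrite a0 u0.
rewrite (_ : U 0 * U 2 / _ = U 2 / alpha0 ^+ 2 / U 0); last by field; rewrite a0 u0.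
have : 0 < b^-1 ^+ 2 by rewrite exprn_gt0// invr_gt0.
by rewrite /mle_slope; move: (_ ^+ 2) (_ ^+ 2) (_ / U 0) => x y z; lra.
Qed.

(** This is the equation Pi rho0 (varpi rho0) = 0, divided by alpha0. *)
Let b_root : b^-1 + - (U 1 / alpha0) / U 0 - (2 * euler_gamma - rho0) / alpha0 / 2 = 0.
Proof.
have := Pi_varpi rho01; rewrite PiE// -/p -/(U 1) -/(U 0) => e.
have a0 : alpha0 != 0 by rewrite gt_eqF.
have u0 : U 0 != 0 by rewrite gt_eqF.
have p0 : p != 0 by rewrite gt_eqF.
transitivity ((p^-1 - U 1 / U 0 + rho0 / 2 - euler_gamma) / alpha0); last by rewrite e mul0r.
by rewrite /b; move: p (U 1) (U 0) a0 u0 p0 => x y z a0 u0 p0; field; rewrite a0 u0 p0.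
Qed.

Let what := - (((w ord0 ord0 - - (U 1 / alpha0) / U 0 * w (inord 1) ord0) / U 0 -
  (w (inord 2) ord0 + w (inord 3) ord0) / 2) / mle_slope).

Let alpha_rate : v i * (a i - b) @[i --> F] --> what.
Proof.
by apply: (mle_alpha_rate ou nu a_gt0 ha b_gt0 U0_gt0 d_gt0 voo W1 W2 W34 DD DK b_root);
  rewrite lt_eqF.
Qed.

Let mean_rate : v i * (power_mean (u i) 0 (a i) - U 0) @[i --> F] -->
  w (inord 1) ord0 - - (U 1 / alpha0) * what.
Proof.
by apply: (mle_mean_rate ou nu a_gt0 ha b_gt0 U0_gt0 d_gt0 voo W1 W2 W34 DD DK b_root);
  rewrite lt_eqF.
Qed.

Let lipschitz_rate (f : R -> R) L : 
  (forall t, 0 <= t <= 1 -> `|f t - f rho0| <= L * `|t - rho0|) ->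
  v i * (f (r i) - f rho0) @[i --> F] --> (0 : R).
Proof.
move=> fL; apply: norm_cvg0.
apply: (squeeze_cvgr (f := fun=> 0) (h := fun i => L * `|v i * (r i - rho0)|)).
- near=> i; rewrite normr_ge0/= !normrM mulrCA ler_wpM2l//; exact: fL.
- exact: cvg_cst.
- rewrite -[X in _ --> X](mulr0 L); apply: cvgM; first exact: cvg_cst.
  by rewrite -(normr0 R); apply: cvg_norm.
Unshelve. all: by end_near. Qed.

Lemma bc_alpha_rate : v i * (a i * (varpi (r i))^-1 - alpha0) @[i --> F] --> p^-1 * what.
Proof.
have [L _ HL] := varpi_lipschitz rho01.
have pr := lipschitz_rate (f := fun t => (varpi t)^-1) HL.
have pc : (varpi (r i))^-1 @[i --> F] --> p^-1 by exact: (rate_cvg voo pr).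
rewrite (_ : (fun i => _) = fun i => (varpi (r i))^-1 * (v i * (a i - b)) +
   b * (v i * ((varpi (r i))^-1 - p^-1))).
  rewrite -[X in _ --> X]addr0 -[X in _ + X](mulr0 b).
  by apply: cvgD; apply: cvgM => //; exact: cvg_cst.
apply/funext => i; rewrite /b; have p0 : p != 0 by rewrite gt_eqF.
by move: (varpi _)^-1 => x; field.
Qed.

Lemma bc_sigma_rate : v i * (expR ((a i)^-1 * (ln (Ups (r i) 0 (varpi (r i))) -
    ln (power_mean (u i) 0 (a i)))) - 1) @[i --> F] -->
  - (b^-1 * ((w (inord 1) ord0 - - (U 1 / alpha0) * what) / U 0)).
Proof.
have [L _ HL] := Ups_varpi_lipschitz rho01.
have Ur := lipschitz_rate (f := fun t => Ups t 0 (varpi t)) HL.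
have l1 := delta_method FF voo Ur (is_derive1_ln U0_gt0).
have l2 := delta_method FF voo mean_rate (is_derive1_ln U0_gt0).
have aV : (a i)^-1 @[i --> F] --> b^-1.
  by apply: cvgV; [rewrite gt_eqF|exact: (rate_cvg voo alpha_rate)].
have l3 : v i * ((a i)^-1 * (ln (Ups (r i) 0 (varpi (r i))) -
    ln (power_mean (u i) 0 (a i))) - 0) @[i --> F] -->
    b^-1 * ((U 0)^-1 * 0 - (U 0)^-1 * (w (inord 1) ord0 - - (U 1 / alpha0) * what)).
  rewrite (_ : (fun i => _) = fun i => (a i)^-1 *
    (v i * (ln (Ups (r i) 0 (varpi (r i))) - ln (U 0)) -
     v i * (ln (power_mean (u i) 0 (a i)) - ln (U 0)))).
    by apply: cvgM => //; exact: cvgB.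
  by apply/funext => i; ring.
have := delta_method FF voo l3 (is_derive_expR 0).
rewrite expR0 mul1r mulr0 sub0r mulrN [(U 0)^-1 * _]mulrC; exact.
Qed.

(** Combining the rows of M_mle into those of M_bc cancels all terms in ln
    s1. *)
Lemma M_bc_rows : let Mw := M_bc rho0 alpha0 *m w in
  Mw ord0 ord0 = p^-1 * what /\
  Mw (inord 1) ord0 = - (b^-1 * ((w (inord 1) ord0 - - (U 1 / alpha0) * what) / U 0)).
Proof.
move=> Mw; rewrite /Mw.
have [-> ->] := M_bc_mul rho0 alpha0 w.
rewrite /M_mle !matrix24_mul.
have i10 : (inord 1 : 'I_2) == 0 = false by apply/eqP => /(congr1 val); rewrite /= inordK.
rewrite i10 eqxx -/p derive1n2_Upsilon// derive1_Upsilon// UpsilonE /= -/(U 0) -/(U 1) -/(U 2) -/b.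
have U20 : 0 < U 0 / 2 by rewrite divr_gt0.
have -> : (2 / U 0) `^ b^-1 = (U 0 / 2) `^ (- b^-1).
  by rewrite -[2 / _]invf_div -(powR_inv1 (ltW U20)) -powRrM mulN1r.
rewrite gt0_powRD// ln_powR powR_inv1 ?(ltW U20)//.
have t0 : (U 0 / 2) `^ (- b^-1) != 0 by rewrite gt_eqF// powR_gt0.
have sl : mle_slope != 0 by rewrite lt_eqF.
have bn : b != 0 by rewrite gt_eqF.
have pn : p != 0 by rewrite gt_eqF.
have un : U 0 != 0 by rewrite gt_eqF.
have an : alpha0 != 0 by rewrite gt_eqF.
have dE : - (2 / b ^+ 2) - 2 * ((U 2 * U 0 - U 1 ^+ 2) / (alpha0 ^+ 2 * U 0 ^+ 2)) =
    2 * mle_slope.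
  rewrite /mle_slope; move: (U 0) (U 1) (U 2) b un an bn => x y z t un an bn.
  by field; rewrite un an bn.
rewrite dE /what.
move: (_ `^ _) (ln (U 0 / 2)) t0 => t l t0.
move: (w ord0 ord0) (w (inord 1) ord0) (w (inord 2) ord0) (w (inord 3) ord0) => x1 x2 x3 x4.
move: mle_slope (U 0) (U 1) p b sl un pn bn => S x y q c sl un pn bn.
by split; field; rewrite ?sl ?un ?pn ?bn ?an ?t0.
Qed.

End bc_asymptotics.

End bias_correction.

(** * Uniformity of the expansion over samples *)

Section uniform_linearization.
Context {R : realType}.

Lemma cvg_mx (T : topologicalType) m n I (F : set_system I) {FF : Filter F}
    (x : I -> 'M[T]_(m, n)) (y : 'M[T]_(m, n)) :
  (forall i j, x t i j @[t --> F] --> y i j) -> x t @[t --> F] --> y.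
Proof.
move=> h A [P Py sPA]; rewrite /nbhs/=.
apply: filterS (_ : F [set t | forall i, forall j, P i j (x t i j)]).
  by move=> t /sPA.
apply: filter_forall => i; apply: filter_forall => j.
exact: h (Py i j).
Qed.

Lemma cvg_mulmx m n q I (F : set_system I) {FF : Filter F} (M : 'M[R]_(m, n))
    (x : I -> 'M[R]_(n, q)) (y : 'M[R]_(n, q)) :
  (forall i j, x t i j @[t --> F] --> y i j) ->
  forall i j, (M *m x t) i j @[t --> F] --> (M *m y) i j.
Proof.
move=> h i j.
have key (e : seq 'I_n) : (fun t => \sum_(l <- e) M i l * x t l j) @ F -->
    \sum_(l <- e) M i l * y l j.
  elim: e => [|l e IH].
    rewrite big_nil (_ : (fun _ => _) = cst 0); first exact: cvg_cst.
    by apply/funext => t; rewrite big_nil.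
  rewrite big_cons (_ : (fun _ => _) = fun t => M i l * x t l j + \sum_(l <- e) M i l * x t l j).
    by apply: cvgD IH; apply: cvgM => //; exact: cvg_cst.
  by apply/funext => t; rewrite big_cons.
rewrite mxE (_ : (fun t => _) = fun t => \sum_l M i l * x t l j); first exact: key.
by apply/funext => t; rewrite mxE.
Qed.

Lemma WvecE (rho : R -> R) (alpha0 alpha1 : R) (H : probability (R * R)%type R) v z s :
  pickands_class rho -> 0 < alpha0 -> is_welsch rho alpha0 1 H ->
  alpha1 = varpi (rho 0) * alpha0 ->
  let u := rescale s z in let U m := Ups (rho 0) m (varpi (rho 0)) in
  let W := Wvec H v z s alpha1 in
  [/\ W ord0 ord0 = v * (power_mean u 1 alpha1 - - (U 1 / alpha0)),
      W (inord 1) ord0 = v * (power_mean u 0 alpha1 - U 0) &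
      W (inord 2) ord0 + W (inord 3) ord0 =
        v * (log_sum u / (size u)%:R - (2 * euler_gamma - rho 0) / alpha0)].
Proof.
move=> rhoC a0 HE a1E u U W.
have p0 := varpi_gt0 (pickands0 rhoC).
have a1N : - alpha0 < alpha1.
  by rewrite (@lt_trans _ _ 0) ?oppr_lt0// a1E mulr_gt0.
have a1a0 : alpha1 / alpha0 = varpi (rho 0) by rewrite a1E mulfK// gt_eqF.
have mom m := welsch_moment2 rhoC a0 HE m a1N.
rewrite a1a0 in mom.
rewrite /W !mxE /Gn !emp_meanE -/u /f1234 !inordK//=; split.
- congr (_ * (_ - _)).
  have := mom 1; rewrite expr1 => e.
  transitivity (- alpha0^-1 * U 1); first exact: e.
  by rewrite mulNr mulrC.
- congr (_ * (_ - _)).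
    by congr (_ / _); apply: eq_bigr => p _; rewrite mulr1.
  rewrite -[RHS]mul1r -[X in X * _](expr0 (- alpha0^-1)) -mom.
  by congr Rintegral; apply/funext => p; rewrite mulr1.
- have i3 : \int[H]_(p in quadrant) ln p.2 = (euler_gamma - rho 0) / alpha0.
    have a00 : - alpha0 < 0 by rewrite oppr_lt0.
    have := welsch_moment2 rhoC a0 HE 1 a00; rewrite mul0r expr1 => e.
    transitivity (- alpha0^-1 * Ups (rho 0) 1 0).
      rewrite -e; congr Rintegral; apply/funext => p.
      by rewrite oppr0 powRr0 mul1r.
    rewrite /Ups !add0r; have [_ _ -> -> _] := @gamma_moment_values R.
    by move: euler_gamma => g; ring.
  rewrite i3 (welsch_moment1 a0 HE) /log_sum big_split/=.
  by move: euler_gamma (\sum_(_ <- _) _) (\sum_(_ <- _) _) (_^-1) => g x y k; ring.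
Qed.

(** Closeness of a sample to the model: up to eta for what converges, up to K
    for what is only bounded. *)
Definition near_model (H : probability (R * R)%type R) (rho0 alpha1 d K eta s v r : R)
    (z : seq (R * R)) : Prop :=
  let log2 (a : R) (p : R * R) := p.2 `^ (- a) * ln p.2 ^+ 2 in
  [/\ eta^-1 <= v, `|v * (r - rho0)| <= eta,
      forall j, `|Wvec H v z s alpha1 j ord0| <= K,
      `|emp_mean z s (log2 alpha1) - \int[H]_(p in quadrant) log2 alpha1 p| <= eta &
      emp_mean z s (log2 (alpha1 + d)) + emp_mean z s (log2 (alpha1 - d)) <= K].

Lemma near_model_le H rho0 alpha1 d K eta eta' s v r z : 0 < eta -> eta <= eta' ->
  near_model H rho0 alpha1 d K eta s v r z -> near_model H rho0 alpha1 d K eta' s v r z.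
Proof.
move=> e0 ee [h1 h2 h3 h4 h5]; split=> //.
- by apply: le_trans h1; rewrite lef_pV2 ?posrE// (lt_le_trans e0).
- exact: le_trans ee.
- exact: le_trans ee.
Qed.

(** The linear expansion of the error, uniformly over samples near the model.
    The relation C stands for closeness of two vectors: of one component for
    the expansion in probability, of the values of a continuous test function
    for the convergence in law. The conditions for eta tending to 0 generate a
    filter on samples, and Wvec has a limit along each ultrafilter that
    refines it. *)
Lemma bc_uniform (rho : R -> R) (alpha0 : R) (H : probability (R * R)%type R)
    (alpha1 d K : R) (C : 'cV[R]_2 -> 'cV[R]_2 -> Prop) :
  pickands_class rho -> 0 < alpha0 -> is_welsch rho alpha0 1 H ->
  alpha1 = varpi (rho 0) * alpha0 -> 0 < d ->
  (forall y : 'cV[R]_2, \forall x \near y & x' \near y, C x x') ->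
  exists2 eta, 0 < eta & forall s v r z, 0 < s -> 0 <= r <= 1 ->
    ordered_pairs z -> ~~ constant z -> near_model H (rho 0) alpha1 d K eta s v r z ->
    exists2 x, bc_error alpha0 s v r z = map_mx EFin x &
      C x (M_bc (rho 0) alpha0 *m Wvec H v z s alpha1).
Proof.
move=> rhoC a0 HE a1E d0 Cdiag.
have rho01 := pickands0 rhoC.
have p0 := varpi_gt0 rho01.
have a10 : 0 < alpha1 by rewrite a1E mulr_gt0.
pose static (t : R * R * R * seq (R * R)) :=
  [/\ 0 < t.1.1.1, 0 <= t.1.2 <= 1, ordered_pairs t.2 & ~~ constant t.2].
pose I := {t : R * R * R * seq (R * R) | static t}.
pose s (i : I) := (sval i).1.1.1; pose v (i : I) := (sval i).1.1.2.
pose r (i : I) := (sval i).1.2; pose z (i : I) := (sval i).2.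
pose B eta := [set i : I | near_model H (rho 0) alpha1 d K eta (s i) (v i) (r i) (z i)].
pose F := filter_from [set e : R | 0 < e] B.
have FF : Filter F.
  apply: filter_from_filter; first by exists 1; exact: ltr01.
  move=> e1 e2 /= e10 e20; exists (Num.min e1 e2); first by rewrite /= lt_min e10.
  move=> i /= h; have m0 : 0 < Num.min e1 e2 by rewrite lt_min e10.
  by split; apply: near_model_le h; rewrite // ge_min lexx ?orbT.
suff [eta eta0 h] : F [set i | exists2 x, bc_error alpha0 (s i) (v i) (r i) (z i) = map_mx EFin x &
    C x (M_bc (rho 0) alpha0 *m Wvec H (v i) (z i) (s i) alpha1)].
  exists eta => // s' v' r' z' s'0 r'01 oz nz near'.
  have st : static (s', v', r', z') by [].
  exact: (h (exist _ _ st) near').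
have s0 i : 0 < s i by have [] := svalP i.
have r01 i : 0 <= r i <= 1 by have [] := svalP i.
have oz i : ordered_pairs (z i) by have [] := svalP i.
have ncz i : ~~ constant (z i) by have [] := svalP i.
have nu i : rescale (s i) (z i) != [::].
  by have := ncz i; rewrite -size_eq0 size_map size_eq0; case: (z i).
have ou i : ordered_pairs (rescale (s i) (z i)) by exact: ordered_rescale.
have /choice[a aP] i := bc_errorE alpha0 (v i) (s0 i) (oz i) (ncz i) (r01 i).
apply: ultra_near => U UU FU.
have nearU eta : 0 < eta -> \forall i \near U,
    near_model H (rho 0) alpha1 d K eta (s i) (v i) (r i) (z i).
  by move=> e0; apply: FU; exists eta.
have voo : v i @[i --> U] --> +oo.
  apply/cvgryPge => A.
  have e0 : 0 < (Num.max A 1)^-1 by rewrite invr_gt0 lt_max ltr01 orbT.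
  near=> i.
  have [+ _ _ _ _] : near_model H (rho 0) alpha1 d K (Num.max A 1)^-1 (s i) (v i) (r i) (z i).
    by near: i; exact: nearU.
  by rewrite invrK ge_max => /andP[].
have rW : v i * (r i - rho 0) @[i --> U] --> (0 : R).
  apply/cvgrPdist_le => e e0; near=> i.
  have [_ + _ _ _] : near_model H (rho 0) alpha1 d K e (s i) (v i) (r i) (z i).
    by near: i; exact: nearU.
  by rewrite sub0r normrN.
have /choice[w wP] (j : 'I_4) : exists l : R, Wvec H (v i) (z i) (s i) alpha1 j ord0 @[i --> U] --> l.
  apply: (@ultra_bounded_cvg _ _ _ _ K); near=> i.
  have [_ _ + _ _] : near_model H (rho 0) alpha1 d K 1 (s i) (v i) (r i) (z i).
    by near: i; exact: nearU.
  exact.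
pose wv : 'cV[R]_4 := \col_j w j.
have Wcvg (j : 'I_4) : Wvec H (v i) (z i) (s i) alpha1 j ord0 @[i --> U] --> wv j ord0.
  by rewrite mxE.
have WE i := WvecE (v i) (z i) (s i) rhoC a0 HE a1E.
have W1 : v i * (power_mean (rescale (s i) (z i)) 1 alpha1 -
    - (Ups (rho 0) 1 (varpi (rho 0)) / alpha0)) @[i --> U] --> wv ord0 ord0.
  rewrite (_ : (fun i => _) = fun i => Wvec H (v i) (z i) (s i) alpha1 ord0 ord0)//.
  by apply/funext => i; have [-> _ _] := WE i.
have W2 : v i * (power_mean (rescale (s i) (z i)) 0 alpha1 -
    Ups (rho 0) 0 (varpi (rho 0))) @[i --> U] --> wv (inord 1) ord0.
  rewrite (_ : (fun i => _) = fun i => Wvec H (v i) (z i) (s i) alpha1 (inord 1) ord0)//.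
  by apply/funext => i; have [_ -> _] := WE i.
have W34 : v i * (log_sum (rescale (s i) (z i)) / (size (rescale (s i) (z i)))%:R -
    (2 * euler_gamma - rho 0) / alpha0) @[i --> U] --> wv (inord 2) ord0 + wv (inord 3) ord0.
  rewrite (_ : (fun i => _) = fun i => Wvec H (v i) (z i) (s i) alpha1 (inord 2) ord0 +
    Wvec H (v i) (z i) (s i) alpha1 (inord 3) ord0); first exact: cvgD.
  by apply/funext => i; have [_ _ ->] := WE i.
have a1N : - alpha0 < alpha1.
  by rewrite (@lt_trans _ _ 0) ?oppr_lt0.
have a1a0 : alpha1 / alpha0 = varpi (rho 0) by rewrite a1E mulfK// gt_eqF.
have DD : power_mean (rescale (s i) (z i)) 2 alpha1 @[i --> U] -->
    Ups (rho 0) 2 (varpi (rho 0)) / alpha0 ^+ 2.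
  have e2 := welsch_moment2 rhoC a0 HE 2 a1N; rewrite a1a0 in e2.
  have -> : Ups (rho 0) 2 (varpi (rho 0)) / alpha0 ^+ 2 =
    (- alpha0^-1) ^+ 2 * Ups (rho 0) 2 (varpi (rho 0)) by rewrite sqrrN exprVn mulrC.
  rewrite -e2; apply/cvgrPdist_le => e e0; near=> i.
  have [_ _ _ + _] : near_model H (rho 0) alpha1 d K e (s i) (v i) (r i) (z i).
    by near: i; exact: nearU.
  by rewrite emp_meanE distrC.
have DK : \forall i \near U, power_mean (rescale (s i) (z i)) 2 (alpha1 + d) +
    power_mean (rescale (s i) (z i)) 2 (alpha1 - d) <= K.
  near=> i.
  have [_ _ _ _] : near_model H (rho 0) alpha1 d K 1 (s i) (v i) (r i) (z i).
    by near: i; exact: nearU.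
  by rewrite !emp_meanE.
have a_gt0 i : 0 < a i by have [] := aP i.
have ha i : half_score (rescale (s i) (z i)) (a i) = 0 by have [] := aP i.
rewrite a1E in W1 W2 DD DK.
have r0 := bc_alpha_rate rho01 a0 d0 ou nu a_gt0 ha r01 voo rW W1 W2 W34 DD DK.
have r1 := bc_sigma_rate rho01 a0 d0 ou nu a_gt0 ha r01 voo rW W1 W2 W34 DD DK.
have [M0 M1] := M_bc_rows wv rho01 a0.
pose x i : 'cV[R]_2 := \col_(l < 2) if l == 0 then v i * (a i * (varpi (r i))^-1 - alpha0)
  else v i * (expR ((a i)^-1 * (ln (Ups (r i) 0 (varpi (r i))) -
                      ln (power_mean (rescale (s i) (z i)) 0 (a i)))) - 1).
pose y i := M_bc (rho 0) alpha0 *m Wvec H (v i) (z i) (s i) alpha1.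
have xcvg : x i @[i --> U] --> M_bc (rho 0) alpha0 *m wv.
  apply: cvg_mx => l j; rewrite ord1.
  rewrite (_ : (fun i => _) = fun i => if l == 0 then v i * (a i * (varpi (r i))^-1 - alpha0)
  else v i * (expR ((a i)^-1 * (ln (Ups (r i) 0 (varpi (r i))) -
                      ln (power_mean (rescale (s i) (z i)) 0 (a i)))) - 1)); last first.
    by apply/funext => i; rewrite mxE.
  have [->|l0] := eqVneq l ord0; first by rewrite M0; exact: r0.
  have -> : l = inord 1 by
    case: l l0 => -[|[|//]] // l2 _; apply/val_inj; rewrite /= inordK.
  by rewrite M1; exact: r1.
have ycvg : y i @[i --> U] --> M_bc (rho 0) alpha0 *m wv.
  by apply: cvg_mx; apply: cvg_mulmx => l j; rewrite ord1.
have Cxy : \forall i \near U, C (x i) (y i).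
  have [[A1 A2] [nA1 nA2] sub] := Cdiag (M_bc (rho 0) alpha0 *m wv).
  near=> i; apply: (sub (x i, y i)); split; near: i.
  - exact: xcvg.
  - exact: ycvg.
near=> i; exists (x i); first by have [] := aP i.
by near: i.
Unshelve. all: by end_near. Qed.

End uniform_linearization.

(** * Expectations and probabilities *)

Section expectation_bounds.
Context {R : realType} d (T : measurableType d) (P : probability T R).
Implicit Types (f g : T -> R) (A B : set T) (C e : R).

Lemma bounded_integrable f C : measurable_fun setT f -> (forall w, `|f w| <= C) ->
  P.-integrable setT (EFin \o f).
Proof.
move=> mf fC; apply: measurable_bounded_integrable => //.
  by rewrite ltey_eq fin_num_measure.
exists C; split; first exact: num_real.
by move=> M CM w _ /=; rewrite (le_trans (fC w))// ltW.
Qed.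

Lemma indic_integrable A : measurable A -> P.-integrable setT (EFin \o (\1_A : T -> R)).
Proof.
move=> mA; apply: (@bounded_integrable _ 1); first exact: measurable_indic.
by move=> w; rewrite indicE; case: (w \in A); rewrite ?normr0 ?normr1.
Qed.

Lemma Rintegral_indicT A : measurable A -> \int[P]_w (\1_A w : R) = fine (P A).
Proof. by move=> mA; rewrite /Rintegral integral_indic// setIT. Qed.

Lemma prob_le_Rintegral A f C : measurable A -> measurable_fun setT f ->
  (forall w, 0 <= f w <= C) -> (forall w, A w -> 1 <= f w) ->
  fine (P A) <= \int[P]_w f w.
Proof.
move=> mA mf fC Af; rewrite -Rintegral_indicT//; apply: le_Rintegral => //.
- exact: indic_integrable.
- apply: (@bounded_integrable _ C) => // w.
  by have /andP[f0 ?] := fC w; rewrite ger0_norm.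
- move=> w _; rewrite indicE; case: (boolP (w \in A)) => [/set_mem/Af//|_].
  by have /andP[] := fC w.
Qed.

Lemma Rintegral_le_prob A f : measurable A -> measurable_fun setT f ->
  (forall w, 0 <= f w <= 1) -> (forall w, ~ A w -> f w <= 0) ->
  \int[P]_w f w <= fine (P A).
Proof.
move=> mA mf fC Af; rewrite -Rintegral_indicT//; apply: le_Rintegral => //.
- apply: (@bounded_integrable _ 1) => // w.
  by have /andP[f0 ?] := fC w; rewrite ger0_norm.
- exact: indic_integrable.
- move=> w _; rewrite indicE; case: (boolP (w \in A)) => [_|/negP nA].
    by have /andP[] := fC w.
  by apply: Af => Aw; apply: nA; exact: mem_set.
Qed.

Lemma Rintegral_dist_le f g A e C : measurable A -> measurable_fun setT f ->
  measurable_fun setT g -> 0 <= e -> (forall w, `|f w| <= C) -> (forall w, `|g w| <= C) ->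
  (forall w, ~ A w -> `|f w - g w| <= e) ->
  `|\int[P]_w f w - \int[P]_w g w| <= e + 2 * C * fine (P A).
Proof.
move=> mA mf mg e0 fC gC fg.
have intf := bounded_integrable mf fC; have intg := bounded_integrable mg gC.
have mfg : measurable_fun setT (fun w => f w - g w) by exact: measurable_funB.
have fgC w : `|f w - g w| <= 2 * C.
  by rewrite (le_trans (ler_normB _ _))// mulrDl mul1r lerD.
have C0 : 0 <= C by rewrite (le_trans _ (fC point)).
have intfg := bounded_integrable mfg fgC.
have P1 : fine (P setT) = 1 by rewrite probability_setT.
rewrite -RintegralB//; apply: le_trans (le_normr_Rintegral _ intfg) _ => //.
have -> : e + 2 * C * fine (P A) = \int[P]_w (e + 2 * C * \1_A w).
  rewrite RintegralD//.
  - rewrite Rintegral_cst// RintegralZl//; last exact: indic_integrable.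
    rewrite Rintegral_indicT//; congr (_ + _).
    by rewrite -[LHS]mulr1; congr (_ * _); exact: esym P1.
  - by apply: (@bounded_integrable _ e) => // w; rewrite ger0_norm.
  - apply: (@bounded_integrable _ (2 * C)).
      by apply: measurable_funM => //; exact: measurable_indic.
    move=> w; rewrite normrM indicE ger0_norm ?mulr_ge0//.
    by case: (w \in A); rewrite ?normr0 ?normr1 ?mulr0 ?mulr1 ?mulr_ge0.
apply: le_Rintegral => //.
- apply: (@bounded_integrable _ (2 * C)); first exact: measurableT_comp.
  by move=> w; rewrite normr_id.
- apply: (@bounded_integrable _ (e + 2 * C)).
    apply: measurable_funD => //; apply: measurable_funM => //; exact: measurable_indic.
  move=> w; rewrite ger0_norm; last by rewrite addr_ge0// !mulr_ge0.
  rewrite lerD2l indicE; case: (w \in A); rewrite ?mulr1// mulr0 mulr_ge0//.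
- move=> w _; rewrite indicE; case: (boolP (w \in A)) => [_|/negP nA].
    by rewrite mulr1 (le_trans (fgC w))// lerDr.
  by rewrite mulr0 addr0 fg// => Aw; apply: nA; exact: mem_set.
Qed.

End expectation_bounds.

(** * Random elements *)

Section random_elements.
Context {R : realType} d (T : measurableType d).

Lemma random_element_measurable (X : T -> R) : random_element X -> measurable_fun setT X.
Proof.
move=> rX; apply: (measurability _ (RGenOInfty.measurableE R)).
by move=> _ [_ [x ->] <-]; rewrite setTI; apply: rX; exact: interval_open.
Qed.

Lemma measurable_random_element (X : T -> R) : measurable_fun setT X -> random_element X.
Proof.
by move=> mX U oU; rewrite -[_ @^-1` _]setTI; apply: mX => //; exact: open_measurable.
Qed.

Lemma random_element_comp (S S' : topologicalType) (X : T -> S) (g : S -> S') :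
  continuous g -> random_element X -> random_element (g \o X).
Proof.
move=> cg rX U oU; rewrite comp_preimage; apply: rX.
by apply: open_comp => // x _; exact: cg.
Qed.

Lemma continuous_clip (S : topologicalType) (f : S -> R) : continuous f ->
  continuous (fun x => Num.min (Num.max (f x) 0) 1).
Proof.
move=> cf x.
have cm := @continuous_max R S f (cst 0) x (cf x) (@cst_continuous _ _ _ x).
exact: (@continuous_min R S (f \max cst 0) (cst 1) x cm (@cst_continuous _ _ _ x)).
Qed.

Lemma clip_itv (t : R) : 0 <= Num.min (Num.max t 0) 1 <= 1.
Proof. by rewrite le_min ler01 andbT le_max lexx orbT/= ge_min lexx orbT. Qed.

Lemma clip_ge1 (t : R) : 1 <= t -> 1 <= Num.min (Num.max t 0) 1.
Proof. by move=> t1; rewrite le_min lexx andbT le_max t1. Qed.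

Lemma clip_le0 (t : R) : t <= 0 -> Num.min (Num.max t 0) 1 <= 0.
Proof. by move=> t0; rewrite ge_min ge_max t0 lexx. Qed.

End random_elements.

(** * Vanishing probabilities and tightness *)

Section stochastic_orders.
Context {R : realType} {d : nat -> measure_display}
  {Omega : forall n, measurableType (d n)} (P : forall n, probability (Omega n) R).

Definition vanishing (A : forall n, set (Omega n)) : Prop :=
  (forall n, measurable (A n)) /\ fine (P n (A n)) @[n --> \oo] --> (0 : R).

Lemma vanishingU A B : vanishing A -> vanishing B -> vanishing (fun n => A n `|` B n).
Proof.
move=> [mA cA] [mB cB]; split; first by move=> n; exact: measurableU.
apply: (squeeze_cvgr (f := fun=> 0) (h := fun n => fine (P n (A n)) + fine (P n (B n)))).
- apply: nearW => n; rewrite fine_ge0//=.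
  rewrite -fineD ?fin_num_measure// fine_le ?fin_numD ?fin_num_measure//.
    exact: measurableU.
  exact: measureU2.
- exact: cvg_cst.
- by rewrite -[X in _ --> X](addr0 0); exact: cvgD.
Qed.

Lemma vanishing_cvge A : (forall n, measurable (A n)) ->
  P n (A n) @[n --> \oo] --> 0%E -> vanishing A.
Proof. by move=> mA /fine_cvgP[_ h]. Qed.

Lemma cvge_vanishing A : vanishing A -> P n (A n) @[n --> \oo] --> 0%E.
Proof.
move=> [mA cA]; apply/fine_cvgP; split => //.
by apply: nearW => n; exact: fin_num_measure.
Qed.

Context d0 (T : measurableType d0) (Q : probability T R).

(** Weak convergence is tested on the clipped distance to c. *)
Lemma weak_cvg_cst_vanishing (X : forall n, Omega n -> R) (c e : R) : 0 < e ->
  weak_cvg P X Q (cst c) -> vanishing (fun n => [set w | e < `|X n w - c|]).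
Proof.
move=> e0 [rX _ hX].
have open_far : open [set x : R | e < `|x - c|].
  rewrite (_ : [set _ | _] = (fun x : R => `|x - c|) @^-1` [set y | e < y])//.
  apply: open_comp; last exact: open_gt.
  by move=> x _; apply: cvg_norm; apply: cvgB; [exact: cvg_id|exact: cvg_cst].
split; first by move=> n; exact: (rX n _ open_far).
pose g (x : R) := Num.min (Num.max (`|x - c| / e) 0) 1.
have g01 x : 0 <= g x <= 1 by exact: clip_itv.
have cg : continuous g.
  apply: continuous_clip => x; apply: cvgM; last exact: cvg_cst.
  by apply: cvg_norm; apply: cvgB; [exact: cvg_id|exact: cvg_cst].
have gc : g c = 0 by rewrite /g subrr normr0 mul0r maxxx min_l.
have hg := hX g cg.
have h : \int[P n]_w g (X n w) @[n --> \oo] --> (0 : R).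
  rewrite -[X in _ --> X](_ : \int[Q]_w g (cst c w) = 0); last first.
    by rewrite /cst gc Rintegral_cst// mul0r.
  by apply: hg; exists 1 => x; have /andP[? ?] := g01 x; rewrite ger0_norm.
apply: (squeeze_cvgr (f := fun=> 0) (h := fun n => \int[P n]_w g (X n w))) => //.
- apply: nearW => n; rewrite fine_ge0//=.
  apply: (@prob_le_Rintegral _ _ _ _ _ _ 1) => //.
  + exact: (rX n _ open_far).
  + apply: random_element_measurable; exact: random_element_comp.
  + by move=> w /= ew; apply: clip_ge1; rewrite ler_pdivlMr// mul1r ltW.
- exact: cvg_cst.
Qed.

(** Weak convergence is tested on a clipped norm whose mean under the limit
    law is small. *)
Lemma weak_cvg_tight m (X : forall n, Omega n -> 'cV[R]_m) (W : T -> 'cV[R]_m) (e : R) :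
  0 < e -> weak_cvg P X Q W ->
  exists K, (forall n, measurable [set w | K < `|X n w|]) /\
    \forall n \near \oo, fine (P n [set w | K < `|X n w|]) <= e.
Proof.
move=> e0 [rX rW hX].
have onorm (k : R) : open [set x : 'cV[R]_m | k < `|x|].
  rewrite (_ : [set _ | _] = (fun x : 'cV[R]_m => `|x|) @^-1` [set y | k < y])//.
  by apply: open_comp; [move=> x _; exact: norm_continuous|exact: open_gt].
have [N QN] : exists N : nat, fine (Q [set w | N%:R < `|W w|]) <= e / 2.
  have mW k : measurable [set w | k < `|W w|] by exact: (rW _ (onorm k)).
  have cQ : Q [set w | k%:R < `|W w|] @[k --> \oo] --> 0%E.
    have F0 : \bigcap_k [set w | k%:R < `|W w|] = set0.
      apply/seteqP; split => // w /(_ (Num.bound `|W w|) I)/=.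
      by rewrite ltNge ltW// archi_boundP.
    rewrite -[X in _ --> X](measure0 Q) -F0.
    apply: nonincreasing_cvg_mu => //.
    - by rewrite ltey_eq fin_num_measure.
    - exact: bigcap_measurable.
    - apply/nonincreasing_seqP => k; apply/subsetPset => w /=.
      by apply: le_lt_trans; rewrite ler_nat.
  have /fine_cvgP[_ /cvgrPdist_le h] := cQ.
  have [N _ HN] := h (e / 2) (divr_gt0 e0 (ltr0Sn R 1)); exists N.
  have := HN N (leqnn _); rewrite /= sub0r normrN ger0_norm// fine_ge0//.
exists (N%:R + 1); split; first by move=> n; exact: (rX n _ (onorm _)).
pose g (x : 'cV[R]_m) := Num.min (Num.max (`|x| - N%:R) 0) 1.
have g01 x : 0 <= g x <= 1 by exact: clip_itv.
have cg : continuous g.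
  apply: continuous_clip => x.
  have cn : `|y| @[y --> x] --> `|x| by exact: norm_continuous.
  by apply: (cvgB cn); exact: cvg_cst.
have hg := hX g cg.
have /cvgrPdist_le hc : \int[P n]_w g (X n w) @[n --> \oo] --> \int[Q]_w g (W w).
  by apply: hg; exists 1 => x; have /andP[? ?] := g01 x; rewrite ger0_norm.
have gW : \int[Q]_w g (W w) <= e / 2.
  apply: le_trans QN; apply: Rintegral_le_prob => //.
  - exact: (rW _ (onorm _)).
  - apply: random_element_measurable; exact: random_element_comp.
  - move=> w /negP; rewrite -leNgt => wN.
    by apply: clip_le0; rewrite subr_le0.
near=> n; apply: (@le_trans _ _ (\int[P n]_w g (X n w))).
  apply: (@prob_le_Rintegral _ _ _ _ _ _ 1) => //.
  - exact: (rX n _ (onorm _)).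
  - apply: random_element_measurable; exact: random_element_comp.
  - by move=> w /= ew; apply: clip_ge1; rewrite lerBrDl ltW.
have : `|\int[Q]_w g (W w) - \int[P n]_w g (X n w)| <= e / 2.
  by near: n; apply: hc; rewrite divr_gt0.
by rewrite ler_norml => /andP[]; move: gW; lra.
Unshelve. all: by end_near. Qed.

End stochastic_orders.

(** * Measurability of the estimation error *)

Section measurability.
Context {R : realType} d (T : measurableType d).

Lemma measurable_inv_ge0 (f : T -> R) : (forall w, 0 <= f w) ->
  measurable_fun setT f -> measurable_fun setT (fun w => (f w)^-1).
Proof.
move=> f0 mf; rewrite (_ : (fun _ => _) = (fun x => x `^ (-1)) \o f).
  by apply: measurableT_comp => //; exact: measurable_powR.
by apply/funext => w /=; rewrite powR_inv1.
Qed.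

Lemma measurable_boolset (f : T -> bool) : measurable_fun setT f -> measurable [set w | f w].
Proof. by move=> /(_ measurableT [set true] I); rewrite setTI. Qed.

Lemma measurable_all I (s : seq I) (f : I -> T -> bool) :
  (forall i, measurable_fun setT (f i)) -> measurable_fun setT (fun w => all (f^~ w) s).
Proof.
move=> mf; elim: s => [|i s IH]/=; first exact: measurable_cst.
exact: measurable_and.
Qed.

(** Composed with the clipping to [0, 1], g becomes continuous on the whole
    line. *)
Lemma measurable_lipschitz01 (g : R -> R) (r : T -> R) :
  (forall s, 0 <= s <= 1 -> exists2 L, 0 <= L &
    forall t, 0 <= t <= 1 -> `|g t - g s| <= L * `|t - s|) ->
  (forall w, 0 <= r w <= 1) -> measurable_fun setT r ->
  measurable_fun setT (g \o r).
Proof.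
move=> gL r01 mr.
pose c (t : R) := Num.min (Num.max t 0) 1.
have cc : continuous c by apply: continuous_clip => t; exact: cvg_id.
have gc : continuous (g \o c).
  move=> t; have [L L0 HL] := gL (c t) (clip_itv t).
  apply/cvgrPdist_lt => e e0; near=> u; rewrite /= distrC.
  apply: le_lt_trans (HL _ (clip_itv u)) _.
  apply: (@le_lt_trans _ _ ((L + 1) * `|c u - c t|)).
    by rewrite ler_wpM2r// lerDl.
  rewrite mulrC -ltr_pdivlMr ?ltr_pwDr// distrC; near: u.
  have /cvgrPdist_lt := cc t; apply.
  by rewrite divr_gt0// ltr_pwDr.
rewrite (_ : g \o r = (g \o c) \o r).
  by apply: measurableT_comp => //; exact: continuous_measurable_fun.
apply/funext => w /=; congr g; have /andP[r0 r1] := r01 w.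
by rewrite /c (max_idPl r0) (min_idPl r1).
Unshelve. all: by end_near. Qed.

(** Open sets of the plane are countable unions of boxes with rational
    data. *)
Lemma random_element_col2 (x y : T -> R) : measurable_fun setT x -> measurable_fun setT y ->
  random_element (fun w => \col_(i < 2) (if i == 0 then x w else y w) : 'cV[R]_2).
Proof.
move=> mx my U oU.
pose box (t : rat * rat * rat) := [set w | `|x w - ratr t.1.1| < ratr t.2 /\
  `|y w - ratr t.1.2| < ratr t.2].
pose D := [set t : rat * rat * rat | forall a b : R, `|a - ratr t.1.1| < ratr t.2 ->
  `|b - ratr t.1.2| < ratr t.2 -> U (\col_(i < 2) (if i == 0 then a else b))].
have -> : (fun w => \col_(i < 2) (if i == 0 then x w else y w) : 'cV[R]_2) @^-1` U =
    \bigcup_t (if t \in D then box t else set0).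
  apply/seteqP; split => [w /= Uw|w [t _]]; last first.
    by case: ifP => // /set_mem Dt [xw yw]; exact: Dt.
  have /nbhs_ballP[e /= e0 eU] : nbhs (\col_(i < 2) (if i == 0 then x w else y w) : 'cV[R]_2) U.
    exact: open_nbhs_nbhs.
  have [q] := @rat_in_itvoo R 0 (e / 2) (divr_gt0 e0 (ltr0Sn R 1)).
  rewrite in_itv/= => /andP[q0 qe].
  have near_rat (a : R) : exists p : rat, `|a - ratr p| < ratr q.
    have [p] := @rat_in_itvoo R (a - ratr q) (a + ratr q) ltac:(by rewrite ltrD2l gtrN).
    rewrite in_itv/= => /andP[p1 p2]; exists p.
    by rewrite ltr_distlC p1 p2.
  have [p1 xp1] := near_rat (x w); have [p2 yp2] := near_rat (y w).
  exists (p1, p2, q) => //; rewrite ifT//; apply/mem_set => a b /= ap bp.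
  have tri (u v : R) (p : rat) : `|u - ratr p| < ratr q -> `|v - ratr p| < ratr q -> `|u - v| < e.
    by move=> up; rewrite distrC => vp; have := ler_distD (ratr p) u v; lra.
  by apply: eU; split=> // i j; rewrite !mxE; case: ifP => _; [apply: (tri _ _ p1)|apply: (tri _ _ p2)].
apply: countable_bigcupT_measurable => //.
move=> t; case: ifP => // _.
apply: measurableI; apply: (@measurable_boolset (fun w => `|_ w - _| < _));
  apply: measurable_fun_ltr => //; apply: measurableT_comp => //; exact: measurable_funB.
Qed.

Lemma continuous_map_EFin m n : continuous (fun x : 'M[R]_(m, n) => map_mx EFin x).
Proof.
move=> x; apply: (cvg_mx (FF := nbhs_filter x)) => i j; rewrite mxE.
rewrite (_ : (fun y : 'M[R]_(m, n) => _) = fun y => (y i j)%:E); last first.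
  by apply/funext => y; rewrite mxE.
by apply: cvg_EFin; [exact: nearW|exact: coord_continuous].
Qed.

(** Infinite values occur only on B; on each of the two parts the vector is a
    continuous image of a real random element. *)
Lemma random_element_ext_col2 (B : T -> bool) (x y : T -> R) (e : T -> 'cV[\bar R]_2) :
  measurable_fun setT B -> measurable_fun setT x -> measurable_fun setT y ->
  (forall w, e w = \col_(i < 2) if i == 0 then (if B w then +oo%E else (x w)%:E) else (y w)%:E) ->
  random_element e.
Proof.
move=> mB mx my eE U oU.
pose c (t : R) : 'cV[\bar R]_2 := \col_(i < 2) if i == 0 then +oo%E else t%:E.
have cc : continuous c.
  move=> t; apply: (cvg_mx (FF := nbhs_filter t)) => i j; rewrite mxE.
  rewrite (_ : (fun y : R => _) = fun y => if i == 0 then +oo%E else y%:E); last first.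
    by apply/funext => u; rewrite mxE.
  case: ifP => _; first exact: cvg_cst.
  by apply: cvg_EFin; [exact: nearW|exact: cvg_id].
have -> : e @^-1` U = ([set w | B w] `&` (c \o y) @^-1` U) `|` ([set w | ~~ B w] `&`
    (fun w => map_mx EFin (\col_(i < 2) (if i == 0 then x w else y w) : 'cV[R]_2)) @^-1` U).
  apply/seteqP; split => [w|w].
  - rewrite /= eE; case: (boolP (B w)) => Bw Ue; [left|right]; split => //=.
    by congr U: Ue; apply/matrixP => i j; rewrite !mxE; case: ifP.
  - rewrite /= eE; move=> [[Bw]|[/negPf Bw]]; rewrite Bw//= => Ue.
    by congr U: Ue; apply/matrixP => i j; rewrite !mxE; case: ifP.
apply: measurableU; apply: measurableI.
- exact: measurable_boolset.
- apply: (random_element_comp cc) => //; exact: measurable_random_element.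
- by apply: measurable_boolset; exact: measurable_neg.
- apply: (random_element_comp (@continuous_map_EFin 2 1)) => //.
  exact: random_element_col2.
Qed.

End measurability.

Section estimator_measurability.
Context {R : realType} d (T : measurableType d) (P : probability T R).
Variables (k : nat) (X Y : 'I_k -> {RV P >-> R}).
Hypotheses (k_ge2 : (2 <= k)%N) (XY : forall i w, 0 < Y i w <= X i w).

Let S w := sample X Y w.

Let mX i : measurable_fun setT (X i). Proof. exact: measurable_funP. Qed.
Let mY i : measurable_fun setT (Y i). Proof. exact: measurable_funP. Qed.
Let Y_gt0 i w : 0 < Y i w. Proof. by have /andP[] := XY i w. Qed.
Let X_gt0 i w : 0 < X i w.
Proof. by have /andP[h1 h2] := XY i w; exact: lt_le_trans h2. Qed.

Lemma sample_ordered w : ordered_pairs (S w).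
Proof. by apply/allP => p /mapP[i _ ->]; exact: XY. Qed.

Lemma sum_sample (f : R * R -> R) w : \sum_(p <- S w) f p = \sum_(i < k) f (X i w, Y i w).
Proof. by rewrite big_map big_enum. Qed.

Lemma sample_neq0 w : tval (S w) != [::].
Proof. by rewrite -size_eq0 size_tuple -lt0n (leq_trans _ k_ge2). Qed.

Let const w := constant (S w).

Lemma constant_all (s : seq (R * R)) :
  constant s = all (fun p => all (fun q => p == q) s) s.
Proof.
apply/idP/idP.
  move=> /(constantP (0, 0))[x ->]; apply/allP => p /nseqP[-> _].
  by apply/allP => q /nseqP[-> _].
case: s => // p s /allP/(_ p (mem_head _ _))/allP h /=.
by apply/allP => q qs; rewrite /= eq_sym h// inE qs orbT.
Qed.

Lemma measurable_constant : measurable_fun setT const.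
Proof.
have -> : const = fun w => all (fun i => all (fun j =>
    (X i w == X j w) && (Y i w == Y j w)) (enum 'I_k)) (enum 'I_k).
  apply/funext => w; rewrite /const constant_all /S /sample /= all_map.
  apply: eq_all => i /=; rewrite all_map; apply: eq_all => j /=.
  by rewrite xpair_eqE.
apply: measurable_all => i; apply: measurable_all => j.
by apply: measurable_and; exact: measurable_fun_eqr.
Qed.

Lemma measurable_power_sum m (a : T -> R) : measurable_fun setT a ->
  measurable_fun setT (fun w => power_sum (S w) m (a w)).
Proof.
move=> ma; rewrite (_ : (fun _ => _) = fun w =>
    \sum_(i < k) expR (- a w * ln (Y i w)) * ln (Y i w) ^+ m).
  apply: measurable_sum => i.
  have ml : measurable_fun setT (fun w => ln (Y i w)).
    by apply: measurableT_comp => //; exact: measurable_ln.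
  apply: measurable_funM; last exact: measurable_funX.
  apply: measurableT_comp => //; apply: measurable_funM => //.
  exact: measurableT_comp.
apply/funext => w; rewrite /power_sum sum_sample; apply: eq_bigr => i _.
by rewrite /= powR_expln // ; exact: Y_gt0.
Qed.

Lemma measurable_half_score a : measurable_fun setT (fun w => half_score (S w) a).
Proof.
apply: measurable_funB.
  apply: measurable_funD => //; apply: measurable_funM.
    exact: (measurable_power_sum 1 (measurable_cst a)).
  apply: measurable_inv_ge0; last exact: (measurable_power_sum 0 (measurable_cst a)).
  by move=> w; apply: ltW; apply: power_sum_gt0; [exact: sample_ordered|exact: sample_neq0].
rewrite (_ : (fun w => _) = fun w => (\sum_(i < k) (ln (X i w) + ln (Y i w))) / (2 * k%:R)).
  apply: measurable_funM => //; apply: measurable_sum => i.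
  by apply: measurable_funD; apply: measurableT_comp => //; exact: measurable_ln.
by apply/funext => w; rewrite /log_sum sum_sample size_tuple.
Qed.

Let alphahat w := mle_alpha (S w).

Lemma alphahat_cst w : const w -> alphahat w = +oo%E.
Proof. by rewrite /alphahat /mle_alpha /const => ->. Qed.

(** When the pairs are not all equal, x < alphahat holds exactly if the half
    score is positive at x. *)
Lemma measurable_alphahat : measurable_fun setT alphahat.
Proof.
have sign a w x : 0 < a -> half_score (S w) a = 0 -> 0 < x ->
    (x < a) = (0 < half_score (S w) x).
  move=> a0 ha x0; rewrite !ltNge; congr (~~ _); apply/esym.
  exact: (recip_steep_le_zero (half_score_steep (sample_ordered w) (sample_neq0 w)) a0 ha x0).
apply: (measurability _ (ErealGenOInfty.measurableE R)) => _ [_ [x ->] <-].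
rewrite setTI (_ : _ @^-1` _ = if 0 < x then [set w | const w || (0 < half_score (S w) x)] else setT).
  case: ifP => // _; apply: measurable_boolset; apply: measurable_or.
    exact: measurable_constant.
  by apply: measurable_fun_ltr => //; exact: measurable_half_score.
apply/seteqP; split => [w|w].
- rewrite /= in_itv/= andbT; case: ifP => // x0.
  case: (boolP (const w)) => [cw _|nc]; first by apply/orP; left.
  have [a [a0 ha aE _]] := mle_spec (sample_ordered w) nc.
  rewrite /alphahat aE lte_fin (sign a w x) // => h.
  by apply/orP; right.
- rewrite /= in_itv/= andbT; case: (boolP (const w)) => [cw _|nc].
    by rewrite alphahat_cst// ltry.
  have [a [a0 ha aE _]] := mle_spec (sample_ordered w) nc.
  rewrite /alphahat aE lte_fin; case: ifP => [x0|/negbT]; last first.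
    by rewrite -leNgt => x0 _; exact: le_lt_trans a0.
  by move=> /orP[cw|]; [case/negP: nc|rewrite (sign a w x)].
Qed.

Let a w := fine (alphahat w).

Let a_ge0 w : 0 <= a w.
Proof.
rewrite /a /alphahat; case: (boolP (const w)) => cw; first by rewrite /mle_alpha ifT.
by have [b [b0 _ -> _]] := mle_spec (sample_ordered w) cw; exact: ltW.
Qed.

Let ma : measurable_fun setT a.
Proof. by apply: measurableT_comp measurable_alphahat; exact: fine_measurable. Qed.

Let maV : measurable_fun setT (fun w => (a w)^-1).
Proof. exact: measurable_inv_ge0. Qed.

(** This includes degenerate samples, where both sides are 0. *)
Lemma fine_inv_alphahat w : fine (alphahat w)^-1 = (a w)^-1.
Proof.
rewrite /a /alphahat; case: (boolP (const w)) => cw.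
  by rewrite /mle_alpha ifT//= invr0.
have [b [b0 _ -> _]] := mle_spec (sample_ordered w) cw.
by rewrite inver gt_eqF.
Qed.

Lemma measurable_sigmahat : measurable_fun setT (fun w => mle_sigma (S w)).
Proof.
have k_gt0 : (0 < k)%N by exact: leq_trans k_ge2.
rewrite (_ : (fun w => _) = fun w => if const w then Y (Ordinal k_gt0) w else
    expR (- (a w)^-1 * ln (power_sum (S w) 0 (a w) / (2 * k%:R)))).
  apply: measurable_fun_ifT => //; first exact: measurable_constant.
  apply: measurableT_comp => //; apply: measurable_funM; first exact: measurableT_comp.
  apply: (measurableT_comp (@measurable_ln R)); apply: measurable_funM => //.
  exact: measurable_power_sum.
apply/funext => w; case: (boolP (const w)) => cw.
  rewrite /mle_sigma ifT//.
  have -> : head (0, 0) (S w) = tnth (S w) (Ordinal k_gt0) by rewrite (tnth_nth (0, 0)) nth0.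
  by rewrite tnth_mktuple.
rewrite /a /alphahat.
have [b [b0 _ -> ->]] := mle_spec (sample_ordered w) cw.
rewrite powR_expln ?size_tuple// divr_gt0//.
  by rewrite power_sum_gt0//; [exact: sample_ordered|exact: sample_neq0].
by rewrite mulr_gt0// ltr0n.
Qed.

Variables (r : T -> R) (alpha0 s v : R).
Hypotheses (r01 : forall w, 0 <= r w <= 1) (mr : measurable_fun setT r) (v_gt0 : 0 < v).

Let mvarpi : measurable_fun setT (fun w => (varpi (r w))^-1).
Proof.
apply: (measurable_lipschitz01 (g := fun t => (varpi t)^-1)) => // t.
exact: varpi_lipschitz.
Qed.

Let mUps : measurable_fun setT (fun w => Ups (r w) 0 (varpi (r w))).
Proof.
apply: (measurable_lipschitz01 (g := fun t => Ups t 0 (varpi t))) => // t.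
exact: Ups_varpi_lipschitz.
Qed.

Let e1 w := v * (bc_sigma (r w) (S w) / s - 1).

Let me1 : measurable_fun setT e1.
Proof.
rewrite /e1; apply: measurable_funM => //; apply: measurable_funB => //.
apply: measurable_funM => //.
rewrite (_ : (fun w => _) = fun w => mle_sigma (S w) *
    expR ((a w)^-1 * ln (Ups (r w) 0 (varpi (r w)) / 2))).
  apply: measurable_funM; first exact: measurable_sigmahat.
  apply: measurableT_comp => //; apply: measurable_funM => //.
  by apply: (measurableT_comp (@measurable_ln R)); apply: measurable_funM.
apply/funext => w; rewrite /bc_sigma -/(alphahat w) fine_inv_alphahat UpsilonE powR_expln//.
rewrite divr_gt0// Ups_gt0// (lt_trans _ (varpi_gt0 (r01 w)))// ltrN10.
Qed.

Let bc_alphaE w : bc_alpha (r w) (S w) = (alphahat w * ((varpi (r w))^-1)%:E)%E.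
Proof. by rewrite /bc_alpha inver gt_eqF// varpi_gt0. Qed.

Lemma measurable_bc_error i :
  measurable_fun setT (fun w => bc_error alpha0 s v (r w) (S w) i ord0).
Proof.
rewrite (_ : (fun w => _) = if i == 0
    then (fun w => (v%:E * (alphahat w * ((varpi (r w))^-1)%:E - alpha0%:E))%E)
    else (EFin \o e1)).
  case: ifP => _; last exact/measurable_EFinP.
  apply: emeasurable_funM => //; apply: emeasurable_funB => //.
  apply: emeasurable_funM; first exact: measurable_alphahat.
  exact/measurable_EFinP.
by apply/funext => w; rewrite /bc_error mxE bc_alphaE; case: ifP.
Qed.

Lemma random_element_bc_error : random_element (fun w => bc_error alpha0 s v (r w) (S w)).
Proof.
apply: (@random_element_ext_col2 _ _ _ const (fun w => v * (a w * (varpi (r w))^-1 - alpha0)) e1).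
- exact: measurable_constant.
- apply: measurable_funM => //; apply: measurable_funB => //; exact: measurable_funM.
- exact: me1.
move=> w; apply/matrixP => i j; rewrite !mxE bc_alphaE; case: ifP => // _.
rewrite /a; case: (boolP (const w)) => cw.
  rewrite alphahat_cst// mulyr gtr0_sg ?invr_gt0 ?varpi_gt0// mul1e.
  by rewrite addye// mulry gtr0_sg// mul1e.
rewrite /alphahat.
by have [b [b0 _ -> _]] := mle_spec (sample_ordered w) cw.
Qed.

End estimator_measurability.

(** * The matrix for rho(0) = 1 *)

Section independence_matrix.
Context {R : realType}.
Notation gm := (@gamma_moment R).

(** The second derivative of Gamma at 3, from its value at 1 by two steps of
    the recurrence. *)
Lemma gamma_moment23 : gm 2 3 = pi ^+ 2 / 3 + 2 * euler_gamma ^+ 2 - 6 * euler_gamma + 2.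
Proof.
have [_ _ g11 g12 _] := @gamma_moment_values R.
have g01 : gm 0 1 = 1 by exact: Gamma1.
have r1 := @gamma_moment_rec R 2 1 ltr01.
have r2 := @gamma_moment_rec R 2 2 (ltr0Sn R 1).
have t1 := @trigamma1 R; rewrite /trigamma /digamma g01 g11 !divr1 sqrrN in t1.
have -> : (3 : R) = 2 + 1 by ring.
rewrite r2 (_ : 2 = 1 + 1 :> R)// r1 -(_ : 2 = 1 + 1 :> R)// g11 g12.
have -> : gm 2 1 = pi ^+ 2 / 6 + euler_gamma ^+ 2 by rewrite -t1 subrK.
by move: pi euler_gamma => p g; field.
Qed.

Lemma pi2_gt : 0 < 2 * pi ^+ 2 - 3 :> R.
Proof.
have h := @pi_ge2 R.
by move: (pi : R) h => p h; nra.
Qed.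

Lemma M_mle1 (alpha0 : R) : 0 < alpha0 -> M_mle 1 alpha0 = M_ind alpha0.
Proof.
move=> a0; have [_ g03 _ _ g13] := @gamma_moment_values R.
have N1 : -1 < (1 : R) by exact: lt_trans (ltrN10 R) ltr01.
have E2 : 1 + 2 = 3 :> R by ring.
have U0 : Upsilon 1 1 = 2 :> R by rewrite UpsilonE /Ups subrr mul0r addr0 mul1r E2.
have U1 : derive1 (Upsilon 1) 1 = 3 - 2 * euler_gamma :> R.
  by rewrite derive1_Upsilon// /Ups subrr mul0r addr0 mul1r E2.
have U2 : derive1n 2 (Upsilon 1) 1 = pi ^+ 2 / 3 + 2 * euler_gamma ^+ 2 - 6 * euler_gamma + 2 :> R.
  by rewrite derive1n2_Upsilon// /Ups subrr mul0r addr0 mul1r E2 gamma_moment23.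
rewrite /M_mle varpi1 U0 U1 U2 !mul1r divff ?pnatr_eq0// !powR1 ln1 /M_ind.
have an : alpha0 != 0 by rewrite gt_eqF.
have Pn := pi2_gt.
move: pi euler_gamma Pn => p g Pn.
have dE : - (2 / alpha0 ^+ 2) - 2 * (((p ^+ 2 / 3 + 2 * g ^+ 2 - 6 * g + 2) * 2 -
    (3 - 2 * g) ^+ 2) / (alpha0 ^+ 2 * 2 ^+ 2)) = - ((2 * p ^+ 2 - 3) / (6 * alpha0 ^+ 2)).
  by field.
rewrite dE; move: (2 * p ^+ 2) (lt0r_neq0 Pn) => x xn.
apply/matrixP => i j; rewrite !mxE.
case: i => [[|[|//]] ?]; case: j => [[|[|[|[|//]]]] ?] /=; by field; rewrite ?an ?xn.
Qed.

Lemma M_bc1 (alpha0 : R) : M_bc 1 alpha0 = M_mle 1 alpha0.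
Proof.
have [_ g03 _ _ _] := @gamma_moment_values R.
have U0 : Upsilon 1 1 = 2 :> R.
  by rewrite UpsilonE /Ups subrr mul0r addr0 mul1r (_ : 1 + 2 = 3 :> R)//; ring.
rewrite /M_bc varpi1 U0 divff ?pnatr_eq0// powR1 ln1 mulr0 invr1.
rewrite -[RHS]mul1mx; congr (_ *m _); apply/matrixP => i j; rewrite !mxE.
by case: i => [[|[|//]] ?]; case: j => [[|[|//]] ?].
Qed.

End independence_matrix.

(** * The limit theorem *)

Section error_events.
Context {R : realType}.

Lemma coord_le_norm m n (x : 'M[R]_(m, n)) i j : `|x i j| <= `|x|.
Proof.
by rewrite [leRHS]/Num.norm /= mx_normrE; apply/bigmax_geP; right => /=; exists (i, j).
Qed.

Lemma continuous_mulmx m n q (M : 'M[R]_(m, n)) :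
  continuous (fun x : 'M[R]_(n, q) => M *m x).
Proof.
move=> x; apply: (cvg_mx (FF := nbhs_filter x)) => i j.
by apply: cvg_mulmx => i' j'; exact: coord_continuous.
Qed.

Lemma near_diag_continuous (S : topologicalType) (f : S -> R) (e : R) (y : S) : 0 < e ->
  continuous f -> \forall x \near y & x' \near y, `|f x - f x'| <= e.
Proof.
move=> e0 cf; pose A := [set x : S | `|f x - f y| < e / 2].
have nA : nbhs y A.
  have /cvgrPdist_lt/(_ (e / 2) (divr_gt0 e0 (ltr0Sn R 1))) := cf y.
  by apply: filterS => x; rewrite distrC.
exists (A, A) => // -[x x'] /= [xA x'A].
have := ler_distD (f y) (f x) (f x').
by move: xA x'A; rewrite /A/= [`|f x' - _|]distrC; lra.
Qed.

End error_events.

Section limit_theorem.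
Context {R : realType} (d : nat -> measure_display)
  (Omega : forall n, measurableType (d n)) (P : forall n, probability (Omega n) R).
Variables (k : nat -> nat) (X Y : forall n, 'I_(k n) -> {RV (P n) >-> R}).
Arguments X : clear implicits.
Arguments Y : clear implicits.
Hypotheses (k_ge2 : forall n, (2 <= k n)%N)
  (XY_pos : forall n i w, 0 < Y n i w <= X n i w)
  (ties : P n [set w | constant (sample (X n) (Y n) w)] @[n --> \oo] --> 0%E).
Variables (rho : R -> R) (alpha0 : R) (sigma : nat -> R) (am alpha1 ap : R).
Hypotheses (rhoC : pickands_class rho) (alpha0_gt0 : 0 < alpha0)
  (sigma_gt0 : forall n, 0 < sigma n) (alpha1E : alpha1 = varpi (rho 0) * alpha0)
  (am_alpha1 : am < alpha1) (alpha1_ap : alpha1 < ap).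
Variable (H : probability (R * R)%type R).
Hypothesis HE : is_welsch rho alpha0 1 H.
Context (d' : measure_display) (T : measurableType d') (Q : probability T R).
Hypothesis lln : forall f, F2 am ap f ->
  weak_cvg P (fun n w => emp_mean (sample (X n) (Y n) w) (sigma n) f)
           Q (cst (\int[H]_(p in quadrant) f p)).
Variable v : nat -> R.
Hypotheses (v_gt0 : forall n, 0 < v n) (v_infty : v n @[n --> \oo] --> +oo).
Variable W : T -> 'cV[R]_4.
Let Wn n w := Wvec H (v n) (sample (X n) (Y n) w) (sigma n) alpha1.
Hypothesis clt : weak_cvg P Wn Q W.
Variable rhat : forall n, {RV (P n) >-> R}.
Hypotheses (rhat01 : forall n w, 0 <= rhat n w <= 1)
  (rhat_cvg : is_oP P (fun n => (v n)^-1) (fun n w => (rhat n w - rho 0)%:E)).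

Let err n w := bc_error alpha0 (sigma n) (v n) (rhat n w) (sample (X n) (Y n) w).
Let Mbc := M_bc (rho 0) alpha0.

Let rv_rhat : forall n, measurable_fun setT (rhat n).
Proof. by move=> n; exact: measurable_funP. Qed.

(** The exceptional events are ties, a bad estimate of rho(0), sample means
    off their limits, and a large value of Wn. The last one is controlled by
    tightness; the others have vanishing probability. *)
Lemma linearization_events (C : 'cV[R]_2 -> 'cV[R]_2 -> Prop) (e : R) : 0 < e ->
  (forall y : 'cV[R]_2, \forall x \near y & x' \near y, C x x') ->
  exists B : forall n, set (Omega n), (forall n, measurable (B n)) /\
    \forall n \near \oo, fine (P n (B n)) <= e /\
      forall w, ~ B n w -> exists2 x, err w = map_mx EFin x & C x (Mbc *m Wn w).
Proof.
move=> e0 Cdiag; have e20 : 0 < e / 2 by rewrite divr_gt0.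
have [K1 [mK1 tight]] := weak_cvg_tight e20 clt.
(* alpha1 - dl and alpha1 + dl stay inside the interval of admissible
    exponents *)
pose dl := Num.min (alpha1 - am) (ap - alpha1) / 2.
have dl0 : 0 < dl by rewrite divr_gt0// lt_min !subr_gt0 am_alpha1.
have [dl1 dl2] : am < alpha1 - dl /\ alpha1 + dl < ap.
  have := am_alpha1; have := alpha1_ap.
  by rewrite /dl; case: (leP (alpha1 - am) (ap - alpha1)); lra.
pose lg (a : R) (p : R * R) := p.2 `^ (- a) * ln p.2 ^+ 2.
have F2lg a : am < a < ap -> F2 am ap (lg a).
  by move=> aI; apply: Or44; exists 2%N, a; split.
pose mu a := \int[H]_(p in quadrant) lg a p.
pose K := Num.max K1 (mu (alpha1 + dl) + mu (alpha1 - dl) + 2).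
have [eta eta0 lin] := bc_uniform K rhoC alpha0_gt0 HE alpha1E dl0 Cdiag.
have far a c : am < a < ap -> 0 < c -> vanishing P (fun n => [set w |
    c < `|emp_mean (sample (X n) (Y n) w) (sigma n) (lg a) - mu a|]).
  by move=> aI c0; apply: weak_cvg_cst_vanishing c0 (lln (F2lg a aI)).
have Vtie : vanishing P (fun n => [set w | constant (sample (X n) (Y n) w)]).
  apply: vanishing_cvge => // n; apply: measurable_boolset; exact: measurable_constant.
have Vrho : vanishing P (fun n => [set w | eta * (v n)^-1 < `|rhat n w - rho 0|]).
  apply: vanishing_cvge; last exact: rhat_cvg.2.
  move=> n; apply: (@measurable_boolset _ _ (fun w => eta * (v n)^-1 < `|rhat n w - rho 0|)).
  apply: measurable_fun_ltr => //; apply: measurableT_comp => //.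
  exact: measurable_funB.
have aI0 : am < alpha1 < ap by rewrite am_alpha1.
have aI1 : am < alpha1 + dl < ap by rewrite dl2 andbT (lt_trans am_alpha1)// ltrDl.
have aI2 : am < alpha1 - dl < ap by rewrite dl1/= (lt_trans _ alpha1_ap)// gtrBl.
have V := vanishingU (vanishingU Vtie Vrho) (vanishingU (far _ _ aI0 eta0)
  (vanishingU (far _ _ aI1 ltr01) (far _ _ aI2 ltr01))).
move: V; set V := (fun n => _ `|` _) => -[mV cV].
exists (fun n => V n `|` [set w | K1 < `|Wn w|]); split.
  by move=> n; exact: measurableU.
near=> n; split.
  rewrite (splitr e); apply: (@le_trans _ _ (fine (P n (V n)) + fine (P n [set w | K1 < `|Wn w|]))).
    rewrite -fineD ?fin_num_measure// fine_le ?fin_numD ?fin_num_measure//.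
      exact: measurableU.
    exact: measureU2.
  apply: lerD; last by near: n.
  have : `|0 - fine (P n (V n))| <= e / 2.
    by near: n; move/cvgrPdist_le : cV; exact.
  by rewrite sub0r normrN ger0_norm// fine_ge0.
move=> w /not_orP[/not_orP[/not_orP[nt nr] /not_orP[nD /not_orP[nDp nDm]]] nW].
apply: lin => //.
- exact: sample_ordered.
- exact/negP.
- split.
  + by near: n; move/cvgryPge : v_infty; exact.
  + move/negP: nr; rewrite -leNgt ler_pdivlMr// => nr.
    by rewrite normrM gtr0_norm// mulrC.
  + move=> j; apply: le_trans (coord_le_norm _ _ _) _.
    by move/negP: nW; rewrite -leNgt /K le_max => ->.
  + by move/negP: nD; rewrite -leNgt.
  + have h1 : emp_mean (sample (X n) (Y n) w) (sigma n) (lg (alpha1 + dl)) - mu (alpha1 + dl) <= 1.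
      by apply: le_trans (ler_norm _) _; rewrite leNgt; exact: (introN idP nDp).
    have h2 : emp_mean (sample (X n) (Y n) w) (sigma n) (lg (alpha1 - dl)) - mu (alpha1 - dl) <= 1.
      by apply: le_trans (ler_norm _) _; rewrite leNgt; exact: (introN idP nDm).
    rewrite /K le_max -/(lg (alpha1 + dl)) -/(lg (alpha1 - dl)); apply/orP; right.
    move: h1 h2; move: (emp_mean _ _ _) (emp_mean _ _ _) (mu _) (mu _) => x1 x2 x3 x4; lra.
Unshelve. all: by end_near. Qed.

Let rW : forall n, random_element (fun w => Mbc *m @Wn n w).
Proof.
move=> n; have [rWn _ _] := clt.
exact: (random_element_comp (@continuous_mulmx _ _ _ _ Mbc) (rWn n)).
Qed.

Lemma bc_error_oP i :
  is_oP P (fun=> 1) (fun n w => (err w i ord0 - ((Mbc *m Wn w) i ord0)%:E)%E).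
Proof.
have mU n : measurable_fun setT (fun w => (@err n w i ord0 - ((Mbc *m Wn w) i ord0)%:E)%E).
  apply: emeasurable_funB; first exact: measurable_bc_error.
  apply/measurable_EFinP; apply: random_element_measurable.
  exact: (random_element_comp (@coord_continuous _ _ _ i ord0) (@rW n)).
split=> // e e0; apply: cvge_vanishing; split.
  move=> n; rewrite -[X in measurable X]setTI; apply: emeasurable_fun_o_infty => //.
  exact: measurableT_comp.
apply/cvgrPdist_le => c c0.
have [B [mB nB]] := linearization_events c0
  (fun y => near_diag_continuous y e0 (@coord_continuous R 2 1 i ord0)).
near=> n; rewrite sub0r normrN ger0_norm ?fine_ge0//.
have [PB lin] : fine (P n (B n)) <= c /\ forall w, ~ B n w ->
    exists2 x, err w = map_mx EFin x & `|x i ord0 - (Mbc *m Wn w) i ord0| <= e.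
  by near: n.
apply: le_trans PB; rewrite fine_le ?fin_num_measure//.
  rewrite -[X in measurable X]setTI; apply: emeasurable_fun_o_infty => //.
  exact: measurableT_comp.
apply: le_measure; rewrite ?inE//.
  rewrite -[X in measurable X]setTI; apply: emeasurable_fun_o_infty => //.
  exact: measurableT_comp.
move=> w /= ew; apply: contrapT => /lin[x xE xle].
by move: ew; rewrite xE mxE -EFinB abse_EFin lte_fin mulr1 ltNge xle.
Unshelve. all: by end_near. Qed.

(** Slutsky's argument: the means of a test function at the error and at its
    linear approximation differ by at most c + 2 C P(B), where B is the
    exceptional event. *)
Lemma bc_error_weak_cvg : weak_cvg P err Q (fun w => map_mx EFin (Mbc *m W w)).
Proof.
have [rWn rWl cW] := clt.
have cEM : continuous (fun x : 'cV[R]_4 => map_mx EFin (Mbc *m x)).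
  move=> x; apply: (@continuous_comp _ _ _ (fun y : 'cV[R]_4 => Mbc *m y)).
    exact: continuous_mulmx.
  exact: continuous_map_EFin.
have rerr n : random_element (@err n) by exact: random_element_bc_error.
split => //; first exact: (random_element_comp cEM rWl).
move=> g cg [C gC].
have C0 : 0 <= C by rewrite (le_trans _ (gC (const_mx 0%E))).
have cgE : continuous (fun x : 'cV[R]_2 => g (map_mx EFin x)).
  move=> x; apply: (@continuous_comp _ _ _ (fun y : 'cV[R]_2 => map_mx EFin y)).
    exact: continuous_map_EFin.
  exact: cg.
have cG : continuous (fun x : 'cV[R]_4 => g (map_mx EFin (Mbc *m x))).
  move=> x; apply: (@continuous_comp _ _ _ (fun y : 'cV[R]_4 => map_mx EFin (Mbc *m y))).
    exact: cEM.
  exact: cg.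
have /cvgrPdist_le hW : \int[P n]_w g (map_mx EFin (Mbc *m Wn w)) @[n --> \oo] -->
    \int[Q]_w g (map_mx EFin (Mbc *m W w)).
  by apply: (cW _ cG); exists C.
apply/cvgrPdist_le => e e0.
pose c := e / 2 / (1 + 2 * C).
have c0 : 0 < c by rewrite divr_gt0 ?divr_gt0// ltr_pwDl// mulr_ge0.
have [B [mB nB]] := linearization_events c0 (fun y => near_diag_continuous y c0 cgE).
near=> n.
have [PB lin] : fine (P n (B n)) <= c /\ forall w, ~ B n w ->
    exists2 x, err w = map_mx EFin x &
      `|g (map_mx EFin x) - g (map_mx EFin (Mbc *m Wn w))| <= c.
  by near: n.
have h1 : `|\int[Q]_w g (map_mx EFin (Mbc *m W w)) -
    \int[P n]_w g (map_mx EFin (Mbc *m Wn w))| <= e / 2.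
  by near: n; apply: hW; rewrite divr_gt0.
have h2 : `|\int[P n]_w g (err w) - \int[P n]_w g (map_mx EFin (Mbc *m Wn w))| <= e / 2.
  apply: (@le_trans _ _ (c + 2 * C * fine (P n (B n)))).
    apply: Rintegral_dist_le => //.
    - apply: random_element_measurable; exact: (random_element_comp cg (rerr n)).
    - apply: random_element_measurable; exact: (random_element_comp cG (rWn n)).
    - exact: ltW.
    - by move=> w /lin[x ->].
  apply: (@le_trans _ _ (c + 2 * C * c)); first by rewrite lerD2l ler_wpM2l// mulr_ge0.
  by rewrite -[X in X + _]mul1r -mulrDl mulrC divfK// gt_eqF// ltr_pwDl// mulr_ge0.
have := ler_distD (\int[P n]_w g (map_mx EFin (Mbc *m Wn w)))
  (\int[Q]_w g (map_mx EFin (Mbc *m W w))) (\int[P n]_w g (err w)).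
by move: h1; rewrite distrC in h2; move: h2; lra.
Unshelve. all: by end_near. Qed.

End limit_theorem.

Theorem theorem3p10 (R : realType)
  (d : nat -> measure_display) (Omega : forall n, measurableType (d n))
  (P : forall n, probability (Omega n) R)
  (k : nat -> nat) (k_ge2 : forall n, (2 <= k n)%N)
  (k_infty : k n @[n --> \oo] --> \oo)
  (X Y : forall n, 'I_(k n) -> {RV (P n) >-> R})
  (XY_pos : forall n i w, 0 < Y n i w <= X n i w)
  (ties : P n [set w | constant (sample (X n) (Y n) w)] @[n --> \oo] --> 0%E)
  (rho : R -> R) (rhoC : pickands_class rho)
  (alpha0 : R) (alpha0_gt0 : 0 < alpha0)
  (sigma : nat -> R) (sigma_gt0 : forall n, 0 < sigma n)
  (am alpha1 ap : R) (alpha1E : alpha1 = varpi (rho 0) * alpha0)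
  (am_gt0 : 0 < am) (am_alpha1 : am < alpha1) (alpha1_ap : alpha1 < ap)
  (H : probability (R * R)%type R) (HE : is_welsch rho alpha0 1 H)
  (d' : measure_display) (T : measurableType d') (Q : probability T R)
  (lln : forall f, F2 am ap f ->
    weak_cvg P (fun n w => emp_mean (sample (X n) (Y n) w) (sigma n) f)
             Q (cst (\int[H]_(p in quadrant) f p)))
  (v : nat -> R) (v_gt0 : forall n, 0 < v n) (v_infty : v n @[n --> \oo] --> +oo)
  (W : T -> 'cV[R]_4)
  (clt : weak_cvg P (fun n w => Wvec H (v n) (sample (X n) (Y n) w) (sigma n) alpha1)
                  Q W)
  (rhat : forall n, {RV (P n) >-> R}) (rhat01 : forall n w, 0 <= rhat n w <= 1)
  (rhat_cvg : is_oP P (fun n => (v n)^-1) (fun n w => (rhat n w - rho 0)%:E)) :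
  let Wn n w := Wvec H (v n) (sample (X n) (Y n) w) (sigma n) alpha1 in
  let err n w :=
    bc_error alpha0 (sigma n) (v n) (rhat n w) (sample (X n) (Y n) w) in
  let Mbc := M_bc (rho 0) alpha0 in
  [/\ forall i : 'I_2, is_oP P (fun=> 1)
        (fun n w => (err n w i ord0 - ((Mbc *m Wn n w) i ord0)%:E)%E),
      weak_cvg P err Q (fun w => map_mx EFin (Mbc *m W w)),
      rho 0 = 1 <-> (forall eta, eta \in `[0, 1] -> rho eta = rho_ind eta) &
      rho 0 = 1 ->
        M_bc 1 alpha0 = M_mle 1 alpha0 /\ M_mle 1 alpha0 = M_ind alpha0].
Proof.
split.
- move=> i.
  exact: (bc_error_oP k_ge2 XY_pos ties rhoC alpha0_gt0 sigma_gt0 alpha1E am_alpha1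
    alpha1_ap HE lln v_gt0 v_infty clt rhat01 rhat_cvg i).
- exact: (bc_error_weak_cvg k_ge2 XY_pos ties rhoC alpha0_gt0 sigma_gt0 alpha1E am_alpha1
    alpha1_ap HE lln v_gt0 v_infty clt rhat01 rhat_cvg).
- exact: pickands_eq1.
- by move=> _; split; [exact: M_bc1|exact: M_mle1].
Qed.
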